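(* Let $\Omega\subseteq\mathbb{R}^n$ be a nonempty open set, $s\in\mathbb{R}$, $1<p<\infty$, and let $(s,p,\Omega)$ be a smooth multiplication triple. Then $C_c^\infty(\Omega)$ is dense in $W^{s,p}_{loc}(\Omega)$.
   Context: All functions are real-valued. $C_c^\infty(\Omega)$ is the set of smooth functions with compact support in $\Omega$; $D'(\Omega)$ is the space of distributions on $\Omega$; a function $\varphi\in C_c^\infty(\Omega)$ is identified with the distribution $\psi\mapsto\int_\Omega\varphi\psi\,dx$. Let $\frac1p+\frac1{p'}=1$. Sobolev-Slobodeckij spaces: for $k\in\mathbb{N}_0$, $W^{k,p}(\Omega)=\{u\in L^p(\Omega):\|u\|_{W^{k,p}(\Omega)}:=\sum_{|\nu|\le k}\|\partial^\nu u\|_{L^p(\Omega)}<\infty\}$; for $0<\theta<1$, $|u|_{W^{\theta,p}(\Omega)}:=\big(\iint_{\Omega\times\Omega}\frac{|u(x)-u(y)|^p}{|x-y|^{n+\theta p}}dx\,dy\big)^{1/p}$; for $s=k+\theta$ with $k\in\mathbb{N}_0$, $0<\theta<1$, $W^{s,p}(\Omega)=\{u\in W^{k,p}(\Omega):\|u\|_{W^{s,p}(\Omega)}:=\|u\|_{W^{k,p}(\Omega)}+\sum_{|\nu|=k}|\partial^\nu u|_{W^{\theta,p}(\Omega)}<\infty\}$. $W^{s,p}_0(\Omega)$ is the closure of $C_c^\infty(\Omega)$ in $W^{s,p}(\Omega)$. For $s<0$, $W^{s,p}(\Omega)=(W^{-s,p'}_0(\Omega))^*$ with the dual norm, viewed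 as a subspace of $D'(\Omega)$ by restricting functionals to $C_c^\infty(\Omega)$. $W^{s,p}_{loc}(\Omega)=\{u\in D'(\Omega):\varphi u\in W^{s,p}(\Omega)\ \forall\varphi\in C_c^\infty(\Omega)\}$, equipped with the topology induced by the seminorms $u\mapsto\|\varphi u\|_{W^{s,p}(\Omega)}$, $\varphi\in C_c^\infty(\Omega)$. $(s,p,\Omega)$ is a smooth multiplication triple if for every $\varphi\in C_c^\infty(\Omega)$ the map $u\mapsto\varphi u$ is well-defined and bounded from $W^{s,p}(\Omega)$ to $W^{s,p}(\Omega)$. *)

(* Defs.v *)
From HB Require Import structures.
From mathcomp Require Import all_boot all_order all_algebra.
From mathcomp Require Import all_classical all_reals all_analysis.

Set Implicit Arguments.
Unset Strict Implicit.
Unset Printing Implicit Defensive.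
Import Order.TTheory GRing.Theory Num.Theory.
Import numFieldNormedType.Exports.
Local Open Scope classical_set_scope.
Local Open Scope ring_scope.

Definition rV_display : measure_display. Proof. exact: default_measure_display. Qed.

(* The sigma-algebra generated by the coordinate functions, i.e. the Borel
   sigma-algebra of R^n. *)
Section measurable_rV.
Context {R : realType} {n : nat}.

Definition rV_coord (i : 'I_n) (x : 'rV[R]_n) : R := x ord0 i.

Let rV_set0 : g_sigma_preimage rV_coord set0.
Proof. exact: sigma_algebra0. Qed.

Let rV_setC A : g_sigma_preimage rV_coord A -> g_sigma_preimage rV_coord (~` A).
Proof. exact: sigma_algebraC. Qed.

Let rV_bigcup (F : _^nat) : (forall i, g_sigma_preimage rV_coord (F i)) ->
  g_sigma_preimage rV_coord (\bigcup_i (F i)).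
Proof. exact: sigma_algebra_bigcup. Qed.

HB.instance Definition _ := @isMeasurable.Build rV_display
  'rV[R]_n (g_sigma_preimage rV_coord) rV_set0 rV_setC rV_bigcup.

End measurable_rV.

Section lebesgue_rV.
Context {R : realType}.

Lemma measurable_rV_coord n (i : 'I_n) :
  measurable_fun [set: 'rV[R]_n] (@rV_coord R n i).
Proof.
move=> _ Y mY; rewrite setTI; apply: sub_sigma_algebra => /=.
rewrite -bigcup_seq/=; exists i => /=; first by rewrite mem_index_enum.
by exists Y => //; rewrite setTI.
Qed.

Lemma measurable_fun_rV d (T : measurableType d) n (f : T -> 'rV[R]_n) :
  (forall i, measurable_fun [set: T] (@rV_coord R n i \o f)) ->
  measurable_fun [set: T] f.
Proof.
move=> mf _ A; rewrite setTI => mA.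
pose F' := image_set_system [set: T] f measurable.
have : F' A; last by rewrite /F' /image_set_system /= setTI.
apply: mA; split.
  exact/sigma_algebra_image/sigma_algebra_measurable.
move=> B; rewrite -bigcup_seq => -[i _ [Y mY <-]].
rewrite /F' /image_set_system /= setTI [_ @^-1` _]setTI.
by have := mf i measurableT _ mY; rewrite setTI.
Qed.

Definition rV_cons n (z : R * 'rV[R]_n) : 'rV[R]_n.+1 :=
  row_mx (const_mx z.1 : 'rV_1) z.2.

Definition rV_uncons n (x : 'rV[R]_n.+1) : R * 'rV[R]_n :=
  (rV_coord ord0 x, \row_j rV_coord (lift ord0 j) x).

Lemma rV_consK n : cancel (@rV_cons n) (@rV_uncons n).
Proof.
case=> a x; rewrite /rV_uncons /rV_cons /rV_coord; congr (_, _).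
  rewrite mxE; case: splitP => j //= _; by rewrite mxE.
apply/rowP => i; rewrite !mxE; case: splitP => j /=; first by case: j => -[].
by rewrite /bump leq0n => -[] /ord_inj ->.
Qed.

Lemma measurable_rV_cons n : measurable_fun setT (@rV_cons n).
Proof.
apply: measurable_fun_rV => i; have [j ->|->] := unliftP ord0 i.
  rewrite (_ : _ \o _ = @rV_coord R n j \o snd); last first.
    apply/funext => z; rewrite /= -[in RHS](rV_consK z) /rV_uncons/=.
    by rewrite [in RHS]/rV_coord mxE.
  by apply: measurableT_comp; [exact: measurable_rV_coord|].
rewrite (_ : _ \o _ = fst) //; apply/funext => z /=.
by rewrite -[in RHS](rV_consK z).
Qed.

Lemma measurable_rV_uncons n : measurable_fun setT (@rV_uncons n).
Proof.
apply/measurable_fun_pairP; split; first exact: measurable_rV_coord.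
apply: measurable_fun_rV => i.
rewrite (_ : _ \o _ = @rV_coord R _ (lift ord0 i)).
  exact: measurable_rV_coord.
by apply/funext => x /=; rewrite /rV_coord mxE.
Qed.

(* The image of (Lebesgue measure on R) x mu under R x R^n ~ R^(n+1). *)
Section rV_cons_measure.
Variables (n : nat) (mu : {sigma_finite_measure set 'rV[R]_n -> \bar R}).

Definition rV_cons_measure : set 'rV[R]_n.+1 -> \bar R :=
  pushforward (@lebesgue_measure R \x mu)%E (@rV_cons n).

Let rV_cons_measure0 : rV_cons_measure set0 = 0%E.
Proof. by rewrite /rV_cons_measure /pushforward preimage_set0 measure0. Qed.

Let rV_cons_measure_ge0 A : (0 <= rV_cons_measure A)%E.
Proof. by rewrite /rV_cons_measure /pushforward. Qed.

Let rV_cons_measure_sigma_additive : semi_sigma_additive rV_cons_measure.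
Proof.
have mc A : measurable A -> measurable (@rV_cons n @^-1` A).
  by move=> mA; rewrite -[X in measurable X]setTI; exact: measurable_rV_cons.
move=> F mF tF mUF; rewrite /rV_cons_measure /pushforward preimage_bigcup.
apply: measure_semi_sigma_additive.
- by move=> k; exact: mc.
- apply/trivIsetP => /= i j _ _ ij; rewrite -preimage_setI.
  by move/trivIsetP : tF => /(_ _ _ _ _ ij) ->//; rewrite preimage_set0.
- by rewrite -preimage_bigcup; exact: mc.
Qed.

HB.instance Definition _ := isMeasure.Build _ _ _ rV_cons_measure
  rV_cons_measure0 rV_cons_measure_ge0 rV_cons_measure_sigma_additive.

Let rV_cons_sigma_finite : sigma_finite setT rV_cons_measure.
Proof.
have /sigma_finiteP[F [TF ndF Foo]] := sigma_finiteT (@lebesgue_measure R).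
have /sigma_finiteP[G [TG ndG Goo]] := sigma_finiteT mu.
exists (fun k => @rV_uncons n @^-1` (F k `*` G k)).
  rewrite -preimage_bigcup (_ : \bigcup_i _ = setT) ?preimage_setT //.
  apply/seteqP; split=> // -[x y] _.
  have [k _ Fkx] : (\bigcup_i F i) x by rewrite -TF.
  have [l _ Gly] : (\bigcup_i G i) y by rewrite -TG.
  exists (maxn k l) => //; split => /=.
  - by move: x Fkx; exact/subsetPset/ndF/leq_maxl.
  - by move: y Gly; exact/subsetPset/ndG/leq_maxr.
move=> k; have [mFk Fkoo] := Foo k; have [mGk Gkoo] := Goo k; split.
  rewrite -[X in measurable X]setTI; apply: measurable_rV_uncons => //.
  exact: measurableX.
rewrite /rV_cons_measure /pushforward -comp_preimage.
rewrite (_ : _ \o _ = id); last by apply/funext => z /=; rewrite rV_consK.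
by rewrite preimage_id product_measure1E// lte_mul_pinfty// ge0_fin_numE.
Qed.

HB.instance Definition _ :=
  @Measure_isSigmaFinite.Build _ _ _ rV_cons_measure rV_cons_sigma_finite.

End rV_cons_measure.

Fixpoint lebesgue_rV (n : nat) : {sigma_finite_measure set 'rV[R]_n -> \bar R} :=
  match n with
  | 0 => \d_(0 : 'rV[R]_0)
  | m.+1 => rV_cons_measure (lebesgue_rV m)
  end.

End lebesgue_rV.

Section smooth.
Context {R : realType} {n : nat}.
Implicit Types (f g : 'rV[R]_n -> R) (i : 'I_n) (k : nat).

Definition partial_deriv i f : 'rV[R]_n -> R := 'D_(delta_mx 0 i) f.

Fixpoint Ck k f : Prop :=
  if k is k'.+1 then
    continuous f /\ forall i,
      (forall x, derivable f x (delta_mx 0 i)) /\ Ck k' (partial_deriv i f)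
  else continuous f.

Definition smooth f := forall k, Ck k f.

Definition fsupport f : set 'rV[R]_n := closure [set x | f x != 0].

Lemma Ck_continuous k f : Ck k f -> continuous f.
Proof. by case: k => [//|k] []. Qed.

Lemma CkW k f : Ck k.+1 f -> Ck k f.
Proof.
elim: k f => [f []//|k IH f [cf df]]; split=> // i.
by have [dfi /IH] := df i.
Qed.

Lemma Ck_lin k a f g : Ck k f -> Ck k g -> Ck k (fun x => a * f x + g x).
Proof.
elim: k f g => [f g cf cg x|k IH f g [cf df] [cg dg]].
  exact: (cvgD (cvgM (cvg_cst a) (cf x)) (cg x)).
split=> [x|i].
  exact: (cvgD (cvgM (cvg_cst a) (cf x)) (cg x)).
have [dfi Cf] := df i; have [dgi Cg] := dg i; split=> [x|].
  exact: (derivableD (derivableZ (k := a) (dfi x)) (dgi x)).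
rewrite (_ : partial_deriv i _ =
             fun x => a * partial_deriv i f x + partial_deriv i g x).
  exact: IH.
apply/funext => x; rewrite /partial_deriv.
rewrite (deriveD (derivableZ (k := a) (dfi x)) (dgi x)).
by rewrite (deriveZ a (dfi x)).
Qed.

Lemma CkD k f g : Ck k f -> Ck k g -> Ck k (fun x => f x + g x).
Proof.
move=> Cf Cg; rewrite (_ : (fun _ => _) = fun x => 1 * f x + g x).
  exact: Ck_lin.
by apply/funext => x; rewrite mul1r.
Qed.

Lemma CkM k f g : Ck k f -> Ck k g -> Ck k (fun x => f x * g x).
Proof.
elim: k f g => [f g cf cg x|k IH f g Cf Cg].
  exact: (cvgM (cf x) (cg x)).
have [Cf' Cg'] := (CkW Cf, CkW Cg).
move: Cf Cg => [cf df] [cg dg]; split=> [x|i].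
  exact: (cvgM (cf x) (cg x)).
have [dfi Cfi] := df i; have [dgi Cgi] := dg i; split=> [x|].
  exact: (derivableM (dfi x) (dgi x)).
rewrite (_ : partial_deriv i _ =
             fun x => f x * partial_deriv i g x + g x * partial_deriv i f x).
  by apply: CkD; exact: IH.
by apply/funext => x; rewrite /partial_deriv (deriveM (dfi x) (dgi x)).
Qed.

Lemma smooth_cst a : smooth (fun=> a).
Proof.
move=> k; elim: k a => [a|k IH a]; first exact: cst_continuous.
split=> [|i]; first exact: cst_continuous.
split=> [x|]; first exact: derivable_cst.
rewrite (_ : partial_deriv i _ = fun=> 0); first exact: IH.
by apply/funext => x; rewrite /partial_deriv (derive_cst a).
Qed.

Lemma smooth_partial i f : smooth f -> smooth (partial_deriv i f).
Proof. by move=> sf k; have [_ /(_ i) []] := sf k.+1. Qed.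

Lemma support_partial i f : fsupport (partial_deriv i f) `<=` fsupport f.
Proof.
have -> : fsupport f = closure (fsupport f).
  by apply/closure_id; exact: closed_closure.
apply: closureS => x /=; apply: contra_neqP => xf.
have fx0 : \near x, f x = cst 0 x.
  have : nbhs x (~` fsupport f).
    by apply: open_nbhs_nbhs; split=> //; apply: closed_openC; exact: closed_closure.
  apply: filterS => y yf /=; apply/eqP; apply: contra_notT yf.
  exact: (@subset_closure _ [set x | f x != 0]).
by rewrite /partial_deriv (near_eq_derive _ fx0) derive_cst.
Qed.

End smooth.

(* [multiindex n k] contains all the multi-indices nu with |nu| <= k. *)
Definition multiindex (n k : nat) := {ffun 'I_n -> 'I_k.+1}.

Definition mi_size n k (nu : multiindex n k) : nat := (\sum_(i < n) nu i)%N.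

Section testfun.
Context {R : realType} {n : nat} (Omega : set 'rV[R]_n).

(* A function on Omega with compact support in Omega is represented by its
   extension by 0 to the whole space. *)
Definition is_testfun : {pred 'rV[R]_n -> R} := mem [set f : 'rV[R]_n -> R |
  [/\ smooth f, compact (fsupport f) & fsupport f `<=` Omega]].

Record testfun := Testfun { testfun_val :> 'rV[R]_n -> R;
                            testfunP : testfun_val \in is_testfun }.
HB.instance Definition _ := [isSub for testfun_val].
HB.instance Definition _ := [Choice of testfun by <:].

Lemma is_testfunS (K : set 'rV[R]_n) f : smooth f -> closed K -> compact K ->
  K `<=` Omega -> [set x | f x != 0] `<=` K -> f \in is_testfun.
Proof.
move=> sf clK cK KO fK; rewrite inE.
have sfK : fsupport f `<=` K by rewrite ((closure_id K).1 clK); exact: closureS.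
split=> //; last exact: subset_trans KO.
by apply: (subclosed_compact _ cK sfK); exact: closed_closure.
Qed.

Lemma is_testfun_submod_closed : GRing.submod_closed is_testfun.
Proof.
split=> [|a f g].
  apply: (@is_testfunS set0) => //; [|exact: closed0|exact: compact0|].
    exact: (smooth_cst 0).
  by move=> x /=; rewrite eqxx.
move=> /set_mem[sf cf fO] /set_mem[sg cg gO].
apply: (@is_testfunS (fsupport f `|` fsupport g)).
- by move=> k; exact: Ck_lin.
- by apply: closedU; exact: closed_closure.
- exact: compactU.
- by move=> x [/fO|/gO].
- move=> x /= fgx; have [fx|fx] := eqVneq (f x) 0; last first.
    by left; exact: subset_closure.
  right; apply: subset_closure => /=; apply: contra_neq fgx => gx.
  by rewrite (_ : _ x = a * f x + g x) // fx gx mulr0 addr0.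
Qed.

HB.instance Definition _ :=
  GRing.isSubmodClosed.Build R ('rV[R]_n -> R) is_testfun is_testfun_submod_closed.
HB.instance Definition _ := [SubChoice_isSubLmodule of testfun by <:].

Lemma testfun_mul_subproof (phi psi : testfun) :
  (fun x => phi x * psi x) \in is_testfun.
Proof.
have [sf cf fO] := set_mem (testfunP phi).
have [sg _ _] := set_mem (testfunP psi).
apply: (@is_testfunS (fsupport phi)) => //; last first.
- move=> x /= fgx; apply: subset_closure => /=.
  by apply: contra_neq fgx => ->; rewrite mul0r.
- exact: closed_closure.
- by move=> k; exact: CkM.
Qed.

Definition testfun_mul (phi psi : testfun) : testfun :=
  Testfun (testfun_mul_subproof phi psi).

Lemma testfun_partial_subproof i (psi : testfun) :
  partial_deriv i psi \in is_testfun.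
Proof.
have [sf cf fO] := set_mem (testfunP psi).
apply: (@is_testfunS (fsupport psi)) => //.
- exact: smooth_partial.
- exact: closed_closure.
- by move=> x xf; apply: (@support_partial _ _ i); exact: subset_closure.
Qed.

Definition testfun_partial i (psi : testfun) : testfun :=
  Testfun (testfun_partial_subproof i psi).

Definition testfun_deriv k (nu : multiindex n k) (psi : testfun) : testfun :=
  foldr (fun i => iter (nu i) (testfun_partial i)) psi (enum 'I_n).

End testfun.

Section distributions.
Context {R : realType} {n : nat} (Omega : set 'rV[R]_n).
Notation testfun := (testfun Omega).
Implicit Types (u : testfun -> R) (phi psi : testfun).

(* Distributions form a set of plain functionals on test functions; the
   operations below are defined on all functionals. *)
Definition is_distribution : set (testfun -> R) := [set u |
  scalar u /\
  forall K : set 'rV[R]_n, compact K -> K `<=` Omega ->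
    exists (C : R) (N : nat), forall psi, fsupport psi `<=` K ->
      `|u psi| <= C * \sum_(nu : multiindex n N | (mi_size nu <= N)%N)
                        sup [set `|testfun_deriv nu psi x| | x in setT] ].

Definition regular_distribution (f : 'rV[R]_n -> R) : testfun -> R :=
  fun psi => \int[lebesgue_rV n]_(x in Omega) (f x * psi x).

Definition dist_mul phi u : testfun -> R := fun psi => u (testfun_mul phi psi).

Definition dist_deriv k (nu : multiindex n k) u : testfun -> R :=
  fun psi => (-1) ^+ mi_size nu * u (testfun_deriv nu psi).

End distributions.

Arguments regular_distribution {R n} Omega f.

Section sobolev.
Context {R : realType} {n : nat} (Omega : set 'rV[R]_n).
Notation testfun := (testfun Omega).
Implicit Types (u : testfun -> R) (phi psi : testfun) (s p theta : R).

Definition Lp p : set ('rV[R]_n -> R) :=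
  [set f | f \_ Omega \in Lfun (lebesgue_rV n) p%:E].

Definition Lp_norm p (f : 'rV[R]_n -> R) : \bar R :=
  'N[lebesgue_rV n]_p%:E[EFin \o (f \_ Omega)]%E.

Definition euclidean_norm (x : 'rV[R]_n) : R :=
  Num.sqrt (\sum_(i < n) x ord0 i ^+ 2).

Definition slobodeckij_seminorm theta p (f : 'rV[R]_n -> R) : \bar R :=
  ((\int[lebesgue_rV n \x lebesgue_rV n]_(z in Omega `*` Omega)
      (`|f z.1 - f z.2| `^ p /
       euclidean_norm (z.1 - z.2) `^ (n%:R + theta * p))%:E) `^ p^-1)%E.

(* The L^p functions on Omega of which u is the distribution. *)
Definition Lp_density p u : set ('rV[R]_n -> R) :=
  [set f | Lp p f /\ u = regular_distribution Omega f].

(* Both infima range over functions that are equal a.e. on Omega, hence over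
   at most one value; they are +oo when u is not given by an L^p function. *)
Definition dist_Lp_norm p u : \bar R :=
  ereal_inf [set Lp_norm p f | f in Lp_density p u].

Definition dist_slobodeckij_seminorm theta p u : \bar R :=
  ereal_inf [set slobodeckij_seminorm theta p f | f in Lp_density p u].

(* The norm of W^{s,p}(Omega) for s = k + theta >= 0, where k is a natural
   number and 0 <= theta < 1; +oo outside of W^{s,p}(Omega). *)
Definition sobolev_norm_ge0 s p u : \bar R :=
  let k := Num.truncn s in
  let theta := s - k%:R in
  (\sum_(nu : multiindex n k | (mi_size nu <= k)%N)
     dist_Lp_norm p (dist_deriv nu u) +
   if theta == 0%R then 0 else
     \sum_(nu : multiindex n k | mi_size nu == k)
       dist_slobodeckij_seminorm theta p (dist_deriv nu u))%E.

Definition sobolev_ge0 s p : set (testfun -> R) :=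
  [set u | sobolev_norm_ge0 s p u < +oo]%E.

(* W^{s,p}_0(Omega), s >= 0 *)
Definition sobolev0 s p : set (testfun -> R) := [set u | sobolev_ge0 s p u /\
  forall e : R, 0 < e ->
    exists psi,
      (sobolev_norm_ge0 s p (u - regular_distribution Omega psi)%R < e%:E)%E].

(* Functionals on W^{s,p}_0(Omega), s >= 0; their values outside of this space
   are irrelevant. *)
Definition sobolev0_linear s p : set ((testfun -> R) -> R) := [set F |
  forall (a : R) v w, sobolev0 s p v -> sobolev0 s p w ->
    F (a *: v + w) = a * F v + F w].

Definition sobolev0_dual_norm s p (F : (testfun -> R) -> R) : \bar R :=
  ereal_sup [set `|F v|%:E | v in
    [set v | sobolev0 s p v /\ (sobolev_norm_ge0 s p v <= 1)%E]].

Definition sobolev0_dual s p : set ((testfun -> R) -> R) := [set F |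
  sobolev0_linear s p F /\ (sobolev0_dual_norm s p F < +oo)%E].

Definition conjugate_exponent p : R := (1 - p^-1)^-1.

(* For s < 0, the infimum ranges over the elements of the dual space whose
   restriction to test functions is u; as test functions are dense in
   W^{-s,p'}_0(Omega), all of them agree on this space and have the same norm. *)
Definition sobolev_norm s p u : \bar R :=
  if 0 <= s then sobolev_norm_ge0 s p u else
  let p' := conjugate_exponent p in
  ereal_inf [set sobolev0_dual_norm (- s) p' F | F in [set F |
    sobolev0_dual (- s) p' F /\
    forall psi, F (regular_distribution Omega psi) = u psi]].

Definition sobolev s p : set (testfun -> R) :=
  [set u | sobolev_norm s p u < +oo]%E.

Definition smooth_multiplication_triple s p : Prop :=
  forall phi, exists C : R, forall u, sobolev s p u ->
    sobolev s p (dist_mul phi u) /\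
    (sobolev_norm s p (dist_mul phi u) <= C%:E * sobolev_norm s p u)%E.

Definition sobolev_loc s p : set (testfun -> R) :=
  [set u | is_distribution u /\ forall phi, sobolev s p (dist_mul phi u)].

(* Basic neighborhoods of u for the topology induced by the seminorms
   u |-> ||phi u||, for finitely many phi. *)
Definition sobolev_loc_ball s p (L : seq testfun) (e : R) u :
    set (testfun -> R) :=
  [set v | forall phi, phi \in L ->
             (sobolev_norm s p (dist_mul phi (v - u)%R) < e%:E)%E].

End sobolev.

Section sobolev_loc_topology.
Context {R : realType} {n : nat} (Omega : set 'rV[R]_n) (s p : R).

(* W^{s,p}_loc(Omega) as a topological space. *)
Definition sobolev_loc_space := {u : testfun Omega -> R | sobolev_loc s p u}.

HB.instance Definition _ := gen_eqMixin sobolev_loc_space.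
HB.instance Definition _ := gen_choiceMixin sobolev_loc_space.

Definition sobolev_loc_open : set_system sobolev_loc_space := [set U |
  forall u, U u -> exists (L : seq (testfun Omega)) (e : R), 0 < e /\
    forall v : sobolev_loc_space,
      sobolev_loc_ball s p L e (sval u) (sval v) -> U v].

Let sobolev_loc_openT : sobolev_loc_open setT.
Proof. by move=> u _; exists [::], 1; split. Qed.

Let sobolev_loc_openI : setI_closed sobolev_loc_open.
Proof.
move=> U V oU oV u [/oU[L1 [e1 [e1_gt0 U1]]] /oV[L2 [e2 [e2_gt0 V2]]]].
exists (L1 ++ L2), (Num.min e1 e2); split; first by rewrite lt_min e1_gt0.
move=> v uv; split.
- apply: U1 => phi phiL.
  by rewrite (lt_le_trans (uv phi _)) ?mem_cat ?phiL // lee_fin ge_min lexx.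
- apply: V2 => phi phiL.
  by rewrite (lt_le_trans (uv phi _)) ?mem_cat ?phiL ?orbT // lee_fin ge_min
             lexx orbT.
Qed.

Let sobolev_loc_open_bigU (I : Type) (f : I -> set sobolev_loc_space) :
  (forall i, sobolev_loc_open (f i)) -> sobolev_loc_open (\bigcup_i f i).
Proof.
move=> of_ u [i _ /of_[L [e [e_gt0 fi]]]].
by exists L, e; split=> // v /fi fiv; exists i.
Qed.

HB.instance Definition _ := isOpenTopological.Build sobolev_loc_space
  sobolev_loc_openT sobolev_loc_openI sobolev_loc_open_bigU.

End sobolev_loc_topology.

Arguments smooth_multiplication_triple {R n} Omega s p.
Arguments sobolev_loc {R n} Omega s p.

(* Main.v *)
(** Multiplying [u] by a cutoff [chi] equal to 1 near finitely many supports, it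
    suffices to approximate [w = chi u] by test functions in the norm of W^{s,p}.

    For [s >= 0], let [g] and [g_nu] be L^p densities of [w] and of its
    derivatives, cut off near the support of [chi]. Integrating by parts on the
    mollifier, the derivatives of [rho * g] have the densities [rho * g_nu], and
    both [rho * g_nu - g_nu] and its weighted difference quotients are small in
    L^p by Jensen's inequality and the L^p-continuity of translations.

    For [s < 0], put [t = - s], [q = p'] and let [E eta] be the sum of the q-th
    powers of the L^q norms of the derivatives of [eta] up to order [t], together
    with the Slobodeckij seminorms of those of highest order. A near-minimizer
    [v] of [E / q - w] over the test functions satisfies [w ~ E'(v) / q]
    uniformly on sets of bounded energy. The functional [E'(v) / q] integrates
    derivatives (or difference quotients) of [eta] against functions in L^p;
    approximating these by test functions and integrating by parts turns it into
    [eta |-> int psi eta] up to a small error, so [psi] is close to [w] in the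
    dual norm. *)
From HB Require Import structures.
Require Import Defs.
From mathcomp Require Import all_boot all_order all_algebra.
From mathcomp Require Import all_classical all_reals all_analysis.
From mathcomp Require Import measurable_realfun.
From mathcomp Require Import ring lra.
Set Implicit Arguments.
Unset Strict Implicit.
Unset Printing Implicit Defensive.
Import Order.TTheory GRing.Theory Num.Theory.
Import numFieldNormedType.Exports.
Local Open Scope classical_set_scope.
Local Open Scope ring_scope.

(** * Measure-preserving maps of R^n *)

(** The sign of [s] decides the method. For [s >= 0] the norm is explicit, and the convolution of a
    cut-off density is itself the wanted test function. For [s < 0] the norm is a supremum over the
    unit ball of W^{t,q}_0, whose elements are only limits of test functions, and a functional on it
    offers no density to mollify. Duality would represent it by L^p functions through Hahn-Banach
    and Riesz; minimizing [E / q - w] yields such a representation directly. An approximate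
    minimizer satisfies the Euler-Lagrange equation up to an error, provided that the step of the
    variation is fixed before the minimizer is picked, from a bound on its energy alone. This is why
    the first-order expansion of [E] comes with an error proportional to [E v + E x] and with a step
    size that depends on neither [v] nor [x]. Boundedness of multiplication leads back to the
    seminorms: [phi chi = phi] for the finitely many [phi] of a basic neighbourhood, so closeness to
    [chi u] in W^{s,p} gives closeness to [u] in each of these seminorms. *)

Lemma eq_lew d (T : porderType d) (x y : T) : x = y -> (x <= y)%O.
Proof. by move=> ->. Qed.

Section measure_preserving.
Context d (T : measurableType d) (R : realType).
Variable m : {measure set T -> \bar R}.

Definition mpres (s : T -> T) :=
  measurable_fun setT s /\ forall A, measurable A -> m (s @^-1` A) = m A.

Lemma ge0_integral_mpres s (f : T -> \bar R) : mpres s -> measurable_fun setT f ->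
  (forall x, 0 <= f x)%E -> (\int[m]_x f (s x) = \int[m]_x f x)%E.
Proof.
move=> [ms sE] mf f0.
rewrite -[LHS](@ge0_integral_pushforward _ _ _ _ _ s ms m setT) //.
by apply: eq_measure_integral => A mA _; exact: sE.
Qed.

Lemma integrable_mpres s (f : T -> \bar R) : mpres s -> m.-integrable setT f ->
  m.-integrable setT (f \o s).
Proof.
move=> sP /integrableP[mf fi]; apply/integrableP; split.
  by apply: measurableT_comp => //; exact: sP.1.
have /= -> // := @ge0_integral_mpres s (abse \o f) sP _ _.
exact: measurableT_comp.
Qed.

Lemma Rintegral_mpres s (f : T -> R) : mpres s -> measurable_fun setT f ->
  \int[m]_x f (s x) = \int[m]_x f x.
Proof.
move=> sP mf; rewrite /Rintegral; congr fine.
have mE : measurable_fun setT (fun x => (f x)%:E) by exact/measurable_EFinP.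
rewrite integralE [RHS]integralE; congr (_ - _)%E.
- rewrite -[RHS](ge0_integral_mpres sP (measurable_funepos mE))//.
  by apply: eq_integral => x _; rewrite !funeposE.
- rewrite -[RHS](ge0_integral_mpres sP (measurable_funeneg mE))//.
  by apply: eq_integral => x _; rewrite !funenegE.
Qed.

End measure_preserving.

(** The image of the product measure agrees with it on measurable rectangles, and these determine
    it. *)
Lemma mpres_prod d1 d2 (T1 : measurableType d1) (T2 : measurableType d2)
  (R : realType) (m1 : {sigma_finite_measure set T1 -> \bar R})
  (m2 : {sigma_finite_measure set T2 -> \bar R}) s1 s2 :
  mpres m1 s1 -> mpres m2 s2 ->
  mpres (m1 \x m2)%E (fun z => (s1 z.1, s2 z.2)).
Proof.
move=> [ms1 s1E] [ms2 s2E].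
have ms : measurable_fun setT (fun z : T1 * T2 => (s1 z.1, s2 z.2)).
  apply/measurable_fun_pairP; split; rewrite /comp /=.
    by apply: measurableT_comp ms1 _; exact: measurable_fst.
  by apply: measurableT_comp ms2 _; exact: measurable_snd.
split=> // A mA.
pose m' := [the measure _ _ of pushforward (m1 \x m2)%E
  (fun z : T1 * T2 => (s1 z.1, s2 z.2))].
transitivity (m' ms A) => //; symmetry.
apply: (@product_measure_unique _ _ _ _ _ m1 m2 (m' ms)) => // B C mB mC.
transitivity ((m1 \x m2)%E ((s1 @^-1` B) `*` (s2 @^-1` C))) => //.
by rewrite product_measure1E ?s1E ?s2E// -[X in measurable X]setTI;
  [exact: ms1|exact: ms2].
Qed.

Section lebesgue_invariance.
Variable R : realType.

(** Reflections come before translations: convolutions substitute [x - y], and a translation is the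
    composite of two reflections. *)
Lemma mpres_subl (a : R) : mpres lebesgue_measure (fun y : R => a - y).
Proof.
have mf : measurable_fun setT (fun y : R => a - y) by exact: measurable_funB.
split=> // A mA.
pose sg : measurableTypeR R -> measurableTypeR R := fun y => a - y.
pose m' := [the measure _ _ of pushforward (@lebesgue_measure R) sg].
have U := @lebesgue_measure_unique R (m' mf).
apply/esym/U => //.
move=> X [[x y] /= _ <-].
(* A reflection exchanges the open and the closed endpoint of the generating half-open interval,
   which does not change its length. *)
transitivity (lebesgue_measure (`[a - y, a - x[%classic : set R)); last first.
  congr (lebesgue_measure _).
  by apply/seteqP; split=> z /=; rewrite /sg !in_itv /= => /andP[? ?]; apply/andP;
    split; lra.
rewrite !lebesgue_measure_itv /= !lte_fin.
case: ifPn => xy; case: ifPn => // xy'.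
- by rewrite -!EFinD; congr (_%:E); lra.
- by exfalso; lra.
- by exfalso; lra.
Qed.

Lemma mpres_addr (a : R) : mpres lebesgue_measure (fun y : R => y + a).
Proof.
have [m0 p0] := mpres_subl 0; have [ma pa] := mpres_subl a.
rewrite (_ : (fun x => _) = (fun x => a - x) \o (fun x : R => 0 - x)); last first.
  by apply/funext => x /=; rewrite sub0r opprK addrC.
split; first exact: measurableT_comp.
by move=> B mB; rewrite comp_preimage p0 ?pa// -[X in measurable X]setTI; exact: ma.
Qed.

Lemma rV_normP n (x : 'rV[R]_n) (r : R) : 0 <= r ->
  `|x| <= r <-> forall i, `|x ord0 i| <= r.
Proof.
move=> r0; rewrite [`|x|]mx_normrE; split => [|h].
  by move=> /bigmax_leP[_ h] i; exact: (h (ord0, i)).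
by apply/bigmax_leP; split => // -[i j] _ /=; rewrite ord1.
Qed.

Lemma mpres_rV_subl n (a : 'rV[R]_n) :
  mpres (lebesgue_rV n) (fun y : 'rV[R]_n => a - y).
Proof.
elim: n a => [|n IH] a.
  rewrite (_ : (fun y : 'rV_0 => a - y) = id); last first.
    by apply/funext => y; apply/rowP => -[].
  by split=> //; exact: measurable_id.
have mf : measurable_fun setT (fun y : 'rV[R]_n.+1 => a - y).
  apply: measurable_fun_rV => i.
  rewrite (_ : _ \o _ = fun y => a ord0 i - rV_coord i y); last first.
    by apply/funext => y; rewrite /rV_coord /= !mxE.
  by apply: measurable_funB => //; exact: measurable_rV_coord.
split=> // A mA.
have [_ h] := mpres_prod (mpres_subl (rV_uncons a).1) (IH (rV_uncons a).2).
have mA' : measurable (@rV_cons R n @^-1` A).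
  by rewrite -[X in measurable X]setTI; exact: measurable_rV_cons.
rewrite /= /rV_cons_measure /pushforward -[RHS]h //; congr (_ _).
have E x y : rV_cons ((rV_uncons a).1 - x, (rV_uncons a).2 - y) = a - rV_cons (x, y).
  apply/rowP => j; rewrite !mxE; case: splitP => k /= jk; rewrite !mxE /rV_coord.
    by rewrite (_ : j = ord0) //; apply/val_inj => /=; rewrite jk; case: (k) => -[].
  by congr (a _ _ - _); apply/val_inj => /=; rewrite jk.
by apply/funext => -[x y]; rewrite /preimage /= E.
Qed.

Lemma mpres_rV_addr n (a : 'rV[R]_n) :
  mpres (lebesgue_rV n) (fun y : 'rV[R]_n => y + a).
Proof.
have [m0 h0] := mpres_rV_subl (0 : 'rV[R]_n).
have [ma ha] := mpres_rV_subl a.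
rewrite (_ : (fun y => y + a) = (fun y => a - y) \o (fun y : 'rV[R]_n => 0 - y));
  last first.
  by apply/funext => y /=; rewrite sub0r opprK addrC.
split; first exact: measurableT_comp.
move=> A mA; rewrite comp_preimage h0 ?ha// -[X in measurable X]setTI.
exact: ma.
Qed.

Lemma rV_normE n (x : 'rV[R]_n) (i : 'I_n) : `|x ord0 i| <= `|x|.
Proof. by have /rV_normP : `|x| <= `|x| by []; exact. Qed.

Lemma measurable_rV_ball n (r : R) : measurable [set x : 'rV[R]_n | `|x| <= r].
Proof.
have [r0|r0] := leP 0 r; last first.
  rewrite (_ : [set _ | _] = set0) //.
  apply/seteqP; split=> // x /= xr; have := le_lt_trans xr r0.
  by rewrite normr_lt0.
rewrite (_ : [set _ | _] = \bigcap_(i in [set: 'I_n]) (@rV_coord R n i @^-1` `[- r,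
  r])).
  apply: fin_bigcap_measurable => // i _.
  by rewrite -[X in measurable X]setTI; exact: measurable_rV_coord.
apply/seteqP; split=> x /=.
  by move=> /(rV_normP _ r0) h i _; rewrite /preimage /= in_itv /= -ler_norml; exact: h.
move=> h; apply/(rV_normP _ r0) => i; have := h i Logic.I.
by rewrite /preimage /= in_itv /= -ler_norml.
Qed.

Lemma measurable_rV_shift_ball n (a : 'rV[R]_n) (r : R) :
  measurable [set x : 'rV[R]_n | `|a - x| <= r].
Proof.
have [m _] := mpres_rV_subl a.
by have := m measurableT _ (@measurable_rV_ball n r); rewrite setTI.
Qed.

(** The sigma-algebra is generated by the coordinates, so an open set is written as a countable
    union of boxes, the balls of the sup norm with rational centre and radius. *)
Lemma open_measurable_rV n (A : set 'rV[R]_n) : open A -> measurable A.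
Proof.
move=> oA.
pose q2 (z : 'rV[rat]_n * rat) : 'rV[R]_n * R := (map_mx ratr z.1, ratr z.2).
pose B z : set 'rV[R]_n := [set x | `|(q2 z).1 - x| <= (q2 z).2].
have -> : A = \bigcup_(z in [set z | B z `<=` A]) B z.
  apply/seteqP; split => [x Ax|x [z /=]]; last exact.
  have /nbhs_ballP[e /= e0 eA] : nbhs x A by exact: open_nbhs_nbhs.
  (* A centre within [e / 4] of [x] and a radius between [e / 4] and [e / 2] give a ball that
     contains [x] and stays within [3 * e / 4] of it. *)
  have e4 : 0 < e / 4 by lra.
  have [r /= /andP[r1 r2]] : exists r : rat, e / 4 < ratr r < e / 2.
    have [|r] := @rat_in_itvoo R (e/4) (e/2); first by lra.
    by rewrite in_itv /=; exists r.
  have qx i : exists q : rat, `|ratr q - x ord0 i| <= e / 4.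
    have [|q] := @rat_in_itvoo R (x ord0 i - e/4) (x ord0 i + e/4); first by lra.
    rewrite in_itv /= => /andP[q1 q2']; exists q.
    by rewrite ler_norml; apply/andP; split; lra.
  have [f fP] := choice qx.
  pose z : 'rV[rat]_n * rat := (\row_i f i, r).
  have zx : `|(q2 z).1 - x| <= e / 4.
    apply/rV_normP; first by lra.
    by move=> i; rewrite !mxE; exact: fP.
  exists z; last by rewrite /B /= (le_trans zx)// ltW.
  move=> y; rewrite /B /= => zy; apply: eA; rewrite -ball_normE /=.
  rewrite (_ : x - y = ((q2 z).1 - y) - ((q2 z).1 - x)); last first.
    by rewrite opprB [RHS]addrC addrA subrK.
  by rewrite (le_lt_trans (ler_normB _ _))//; move: zy zx; rewrite /=; lra.
rewrite bigcup_mkcond;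
  apply: (@countable_bigcupT_measurable _ _ ('rV[rat]_n * rat)%type).
  exact: countableP.
move=> z; case: ifPn => // _; exact: measurable_rV_shift_ball.
Qed.

Lemma closed_measurable_rV n (A : set 'rV[R]_n) : closed A -> measurable A.
Proof.
move=> cA; rewrite -[A]setCK; apply: measurableC; apply: open_measurable_rV.
exact: closed_openC.
Qed.

Lemma continuous_measurable_rV n (f : 'rV[R]_n -> R) :
  continuous f -> measurable_fun setT f.
Proof.
move=> cf; apply: (measurability _ (RGenOpens.measurableE R)).
move=> _ [_ [a [b ->] <-]]; rewrite setTI; apply: open_measurable_rV.
move/continuousP : cf; apply; exact: interval_open.
Qed.

(** The norm is the sup norm, so the ball is a cube. For [n = 0] the measure is a Dirac mass and the
    formula gives 1. *)
Lemma lebesgue_rV_ball n (r : R) : 0 <= r ->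
  lebesgue_rV n [set x : 'rV[R]_n | `|x| <= r] = ((r *+ 2) ^+ n)%:E.
Proof.
move=> r0; elim: n => [|n IH].
  rewrite /= diracE mem_set //=.
  by apply/rV_normP => // -[].
rewrite /= /rV_cons_measure /pushforward.
have -> : @rV_cons R n @^-1` [set x | `|x| <= r] =
    `[- r, r] `*` [set x : 'rV[R]_n | `|x| <= r].
  apply/seteqP; split=> -[x y] /= h.
    move/(rV_normP _ r0) : h => h; split.
      have := h ord0; rewrite mxE in_itv /= -ler_norml.
      by case: splitP => j //= _; rewrite mxE.
    apply/rV_normP => // i; have := h (lift ord0 i).
    rewrite mxE; case: splitP => j /=; first by case: j => -[].
    by rewrite /bump leq0n => -[] /ord_inj ->.
  case: h; rewrite in_itv /= -ler_norml => hx /(rV_normP _ r0) hy.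
  apply/rV_normP => // i; rewrite mxE.
  by case: splitP => j /= _; rewrite ?mxE.
rewrite product_measure1E //; last first.
  exact: measurable_rV_ball.
have I : lebesgue_measure (`[- r, r]%classic : set R) = (r *+ 2)%:E.
  rewrite lebesgue_measure_itv /= lte_fin.
  move: r0; rewrite le_eqVlt => /predU1P[<-|r0].
    by rewrite oppr0 ltxx mul0rn.
  by rewrite gtrN // -EFinD opprK mulr2n.
by rewrite [X in (X * _)%E = _]I IH -EFinM exprS.
Qed.

Lemma lebesgue_rV_ball_lty n (r : R) :
  (lebesgue_rV n [set x : 'rV[R]_n | (`|x| <= r)%R] < +oo)%E.
Proof.
have [r0|r0] := leP 0 r; first by rewrite lebesgue_rV_ball // ltry.
rewrite (_ : [set _ | _] = set0) ?measure0 ?ltry//.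
apply/seteqP; split=> // x /= xr; have := le_lt_trans xr r0.
by rewrite normr_lt0.
Qed.

End lebesgue_invariance.

Lemma cvge0_le (R : realType) (I : Type) (F : set_system I) (f : I -> \bar R) :
  Filter F -> f t @[t --> F] --> (0%E : \bar R) ->
  forall e : R, 0 < e -> \forall t \near F, (f t <= e%:E)%E.
Proof.
move=> FF /fine_cvgP[fin c] e e0.
have /cvgrPdist_lt/(_ _ e0) ce := c.
apply: filterS2 fin ce => t ft; rewrite sub0r normrN /= => h.
by rewrite -(fineK ft) lee_fin (le_trans (ler_norm _)) // ltW.
Qed.

Lemma compact_add_open (R : realType) (V : normedModType R) (K U : set V) :
  compact K -> open U -> K `<=` U ->
  \forall h \near (0 : V), forall x, K x -> U (x + h).
Proof.
move=> /compact_near_coveringP cK oU KU.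
apply: (cK V (nbhs (0 : V)) (fun h x => U (x + h))) => x Kx.
have : U (x + 0) by rewrite addr0; exact: KU.
have c : (z.1 + z.2) @[z --> (nbhs x, nbhs (0 : V))] --> x + 0.
  by apply: cvgD; [exact: cvg_fst|exact: cvg_snd].
by move=> Ux; apply: c; exact: open_nbhs_nbhs.
Qed.

Lemma near_all_lt (I : Type) (F : set_system I) (Q : nat -> I -> Prop) (N : nat) :
  Filter F -> (forall j, \forall t \near F, Q j t) ->
  \forall t \near F, forall j, (j < N)%N -> Q j t.
Proof.
move=> FF h; elim: N => [|N IH]; first exact: nearW.
apply: filterS2 IH (h N) => t a b j; rewrite ltnS leq_eqVlt => /predU1P[->//|].
exact: a.
Qed.

(** * Families of measure-preserving maps that move sets little *)

Section lcont.
Context d (T : measurableType d) (R : realType).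
Variable m : {measure set T -> \bar R}.

Lemma measure_tail (A : set T) (E : (set T)^nat) : measurable A ->
  (m A < +oo)%E -> (forall k, measurable (E k)) -> nondecreasing_seq E ->
  A `<=` \bigcup_k E k ->
  forall e : R, 0 < e -> exists k, (m (A `\` E k) <= e%:E)%E.
Proof.
move=> mA Aoo mE ndE AE e e0.
have mAE k : measurable (A `\` E k) by exact: measurableD.
have E0 : \bigcap_k (A `\` E k) = set0.
  apply/seteqP; split=> // x /= h; have [Ax _] := h 0%N Logic.I.
  by have [k _ Ekx] := AE _ Ax; have [] := h k Logic.I.
have := @nonincreasing_cvg_mu _ T R m (fun k => A `\` E k).
rewrite E0 measure0 => /(_ _ mAE measurable0) h.
have {}h : (m \o (fun k => A `\` E k)) n @[n --> \oo] --> (0%E : \bar R).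
  apply: h.
    by rewrite (le_lt_trans _ Aoo) // le_measure ?inE //; exact: subDsetl.
  move=> i j ij; apply/subsetPset => x [Ax nEx]; split=> //.
  by apply: contra_not nEx; have /subsetPset := ndE _ _ ij; exact.
have [k _ kP] := cvge0_le _ h e0.
by exists k; exact: (kP k (leqnn k)).
Qed.

Lemma measure_bigsetU_le (B : (set T)^nat) (N : nat) (c : R) :
  (forall j, measurable (B j)) -> (forall j, (j < N)%N -> (m (B j) <= c%:E)%E) ->
  (m (\big[setU/set0]_(j < N) B j) <= (c * N%:R)%:E)%E.
Proof.
move=> mB; elim: N => [|N IH] h; first by rewrite big_ord0 measure0 mulr0.
rewrite big_ord_recr /= (le_trans (measureU2 _ _ _)) //.
  exact: bigsetU_measurable.
rewrite -natr1 mulrDr mulr1 EFinD leeD ?h //.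
by apply: IH => j jN; apply: h; rewrite (ltn_trans jN).
Qed.

(* [m (A `\` s t @^-1` A)] measures how far [s t] is from fixing [A]; when
   [s t] preserves [m] and [m A] is finite the other half of the symmetric
   difference has the same measure. *)
Definition lcont (I : Type) (F : set_system I) (s : I -> T -> T) :=
  forall A, measurable A -> (m A < +oo)%E -> forall e : R, 0 < e ->
    \forall t \near F, (m (A `\` s t @^-1` A) <= e%:E)%E.

Lemma lcont_id (I : Type) (F : set_system I) : Filter F -> lcont F (fun=> id).
Proof.
move=> FF A mA Aoo e e0; apply: nearW => t.
by rewrite preimage_id setDv measure0 lee_fin ltW.
Qed.

Lemma mpres_measurable s A : mpres m s -> measurable A -> measurable (s @^-1` A).
Proof. by move=> [ms _] mA; rewrite -[X in measurable X]setTI; exact: ms. Qed.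

Lemma mpres_measureD s A : mpres m s -> measurable A -> (m A < +oo)%E ->
  m (s @^-1` A `\` A) = m (A `\` s @^-1` A).
Proof.
move=> sP mA Aoo; have [ms sE] := sP.
have msA := mpres_measurable sP mA.
have h1 : m (s @^-1` A `\` A) = (m A - m (A `&` s @^-1` A))%E.
  have oo : (m (s @^-1` A) < +oo)%E by rewrite (sE _ mA).
  transitivity (m (s @^-1` A) - m (s @^-1` A `&` A))%E; first exact: measureD.
  by rewrite (sE _ mA) setIC.
by rewrite h1; apply/esym; exact: measureD.
Qed.

End lcont.

Section lcont_R.
Variable R : realType.

(** Take [K] compact and [U] open around [A] by regularity. Small translations send [K] into [U], so
    a point of [A] that leaves [A] is either outside [K] or is sent into the part of [U] outside
    [A]. *)
Lemma lcont_R (I : Type) (F : set_system I) (h : I -> R) : Filter F ->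
  h t @[t --> F] --> (0 : R) ->
  lcont lebesgue_measure F (fun t (x : R) => x + h t).
Proof.
move=> FF h0 A mA Aoo e e0.
have e2 : 0 < e / 2 by lra.
have [K [cK KA mAK]] := lebesgue_regularity_inner mA Aoo e2.
have [U [oU AU mUA]] := lebesgue_regularity_outer mA Aoo e2.
have KU : \forall t \near F, forall x, K x -> U (x + h t).
  exact: h0 (@compact_add_open R R^o K U cK oU (subset_trans KA AU)).
apply: filterS KU => t KU.
have mp := mpres_addr (h t).
have mK : measurable K by exact: compact_measurable.
have mU : measurable U by exact: open_measurable.
have mUA' := measurableD mU mA.
have -> : e = e / 2 + e / 2 by lra.
apply: (@le_trans _ _ (lebesgue_measure ((A `\` K) `|`
    ((fun x => x + h t) @^-1` (U `\` A))))).
  rewrite le_measure ?inE //.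
  - by apply: measurableD => //; exact: (mpres_measurable mp).
  - apply: measurableU; first exact: measurableD.
    exact: (mpres_measurable mp).
  - move=> x [Ax nAx]; have [Kx|nKx] := pselect (K x); last by left.
    by right; split=> //; exact: KU.
rewrite (le_trans (measureU2 _ _ _)) //.
- exact: measurableD.
- exact: (mpres_measurable mp).
- rewrite EFinD leeD // ?(ltW mAK) //.
  by rewrite [leLHS](mp.2 _ mUA') ltW.
Qed.

End lcont_R.

Section lcont_prod.
Context d1 d2 (T1 : measurableType d1) (T2 : measurableType d2) (R : realType).
Variable m1 : {sigma_finite_measure set T1 -> \bar R}.
Variable m2 : {sigma_finite_measure set T2 -> \bar R}.
Variables (I : Type) (F : set_system I) (FF : Filter F).
Variables (s1 : I -> T1 -> T1) (s2 : I -> T2 -> T2).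
Hypothesis p1 : forall t, mpres m1 (s1 t).
Hypothesis p2 : forall t, mpres m2 (s2 t).
Hypothesis l1 : lcont m1 F s1.
Hypothesis l2 : lcont m2 F s2.

Let s t (z : T1 * T2) := (s1 t z.1, s2 t z.2).
Let m := (m1 \x m2)%E.
Let mp t : mpres m (s t). Proof. exact: mpres_prod. Qed.

(** A point of a rectangle that leaves it does so through one of the two coordinates. *)
Let lrect A B : measurable A -> measurable B -> (m1 A < +oo)%E -> (m2 B < +oo)%E ->
  forall e : R, 0 < e ->
    \forall t \near F, (m ((A `*` B) `\` s t @^-1` (A `*` B)) <= e%:E)%E.
Proof.
move=> mA mB Aoo Boo e e0.
(* Adding 1 gives positive upper bounds for the two measures, by which one can divide. *)
pose a := fine (m1 A) + 1; pose b := fine (m2 B) + 1.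
have a0 : 0 < a by rewrite ltr_wpDl ?fine_ge0.
have b0 : 0 < b by rewrite ltr_wpDl ?fine_ge0.
have aE : (m1 A <= a%:E)%E by rewrite -(@fineK _ (m1 A)) ?ge0_fin_numE// lee_fin lerDl.
have bE : (m2 B <= b%:E)%E by rewrite -(@fineK _ (m2 B)) ?ge0_fin_numE// lee_fin lerDl.
have ea : 0 < e / 2 / a by rewrite !divr_gt0.
have eb : 0 < e / 2 / b by rewrite !divr_gt0.
apply: filterS2 (l1 mA Aoo eb) (l2 mB Boo ea) => t h1 h2.
have mA' := measurableD mA (mpres_measurable (p1 t) mA).
have mB' := measurableD mB (mpres_measurable (p2 t) mB).
apply: (@le_trans _ _ (m (((A `\` s1 t @^-1` A) `*` B) `|`
   (A `*` (B `\` s2 t @^-1` B))))).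
  rewrite le_measure ?inE //.
  - apply: measurableD; first exact: measurableX.
    by apply: (mpres_measurable (mp t)); exact: measurableX.
  - by apply: measurableU; exact: measurableX.
  - move=> [x y] [[/= Ax By] nAB].
    have [nAx|nAx] := pselect (A (s1 t x)); last by left.
    by right; split => //; split=> // By'; apply: nAB.
rewrite (le_trans (measureU2 _ _ _)) //; [exact: measurableX|exact: measurableX|].
rewrite (_ : e = e / 2 / b * b + a * (e / 2 / a)); last first.
  by field; rewrite !gt_eqF.
rewrite EFinD !EFinM leeD //.
  by rewrite [leLHS](product_measure1E m1 m2 mA' mB) lee_pmul.
by rewrite [leLHS](product_measure1E m1 m2 mA mB') lee_pmul.
Qed.

(** Inside a rectangle [E k] of finite measure the property is extended from rectangles to all
    measurable sets by Dynkin induction; a set of finite measure is then cut by a large [E k]. *)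
Lemma lcont_prod : lcont m F s.
Proof.
have /sigma_finiteP[F1 [TF1 nd1 F1oo]] := sigma_finiteT m1.
have /sigma_finiteP[F2 [TF2 nd2 F2oo]] := sigma_finiteT m2.
pose E k := F1 k `*` F2 k.
have mE k : measurable (E k) by apply: measurableX;
  [exact: (F1oo k).1|exact: (F2oo k).1].
have ndE : nondecreasing_seq E.
  move=> i j ij; apply/subsetPset => -[x y] [/= x1 y1]; split.
    by have /subsetPset := nd1 _ _ ij; exact.
  by have /subsetPset := nd2 _ _ ij; exact.
have Eoo k : (m (E k) < +oo)%E.
  have [mF1 F1k] := F1oo k; have [mF2 F2k] := F2oo k.
  by rewrite /m /E product_measure1E// lte_mul_pinfty// ge0_fin_numE.
have mps t A : measurable A ->
  measurable (s t @^-1` A) by exact: (mpres_measurable (mp t)).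
have sub A B : measurable A -> measurable B -> A `<=` B -> (m A <= m B)%E.
  by move=> mA mB AB; rewrite le_measure ?inE.
have EP k : forall A, measurable A -> forall e : R, 0 < e ->
    \forall t \near F, (m ((A `&` E k) `\` s t @^-1` (A `&` E k)) <= e%:E)%E.
  pose P (A : set (T1 * T2)) := forall e : R, 0 < e ->
    \forall t \near F, (m ((A `&` E k) `\` s t @^-1` (A `&` E k)) <= e%:E)%E.
  suff PP : forall A, <<s [set A `*` B | A in measurable & B in measurable] >> A -> P A.
    by move=> A; rewrite measurable_prod_measurableType; exact: PP.
  apply: (dynkin_induction (measurable_prod_measurableType T1 T2)).
  - move=> _ _ [A1 mA1 [B1 mB1 <-]] [A2 mA2 [B2 mB2 <-]].
    exists (A1 `&` A2); first exact: measurableI.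
    by exists (B1 `&` B2); [exact: measurableI|rewrite setXI].
  - rewrite /P setTI => e e0; apply: lrect => //;
    by [exact: (F1oo k).1|exact: (F2oo k).1|exact: (F1oo k).2|exact: (F2oo k).2].
  - move=> _ [A1 mA1 [B1 mB1 <-]] e e0; rewrite -setXI.
    have [mF1 F1k] := F1oo k; have [mF2 F2k] := F2oo k.
    apply: lrect => //; [exact: measurableI|exact: measurableI|..].
      by rewrite (le_lt_trans _ F1k) // le_measure ?inE //; exact: measurableI.
    by rewrite (le_lt_trans _ F2k) // le_measure ?inE //; exact: measurableI.
  - move=> S mS PS e e0.
    have e2 : 0 < e / 2 by lra.
    have PE : \forall t \near F, (m (E k `\` s t @^-1` E k) <= (e/2)%:E)%E.
      apply: lrect => //; by [exact: (F1oo k).1|exact: (F2oo k).1|exact: (F1oo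
        k).2|exact: (F2oo k).2].
    apply: filterS2 PE (PS _ e2) => t h1 h2.
    have mSE := measurableI _ _ mS (mE k).
    have SEoo : (m (S `&` E k) < +oo)%E.
      by rewrite (le_lt_trans _ (Eoo k)) //; exact: sub.
    (* Complementation brings up the other half of the symmetric difference; the two halves have the
       same measure. *)
    have {}h2 : (m (s t @^-1` (S `&` E k) `\` (S `&` E k)) <= (e / 2)%:E)%E.
      by rewrite [leLHS](mpres_measureD (mp t) mSE SEoo).
    apply: (@le_trans _ _ (m ((E k `\` s t @^-1` E k) `|`
        (s t @^-1` (S `&` E k) `\` (S `&` E k))))).
      apply: sub.
      - apply: measurableD; first by apply: measurableI => //; exact: measurableC.
        by apply: mps; apply: measurableI => //; exact: measurableC.
      - by apply: measurableU; apply: measurableD => //; exact: mps.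
      - move=> x [[nSx Ex] h].
        have [Esx|nEsx] := pselect (E k (s t x)); last by left.
        right; split; last by move=> [].
        by split=> //; apply: contrapT => nS; apply: h.
    rewrite (le_trans (measureU2 _ _ _)) //;
      [..|by rewrite (_ : e = e / 2 + e / 2) ?EFinD ?leeD//; lra].
    + by apply: measurableD => //; exact: mps.
    + by apply: measurableD => //; exact: mps.
  - move=> G mG tG PG e e0.
    have mGE j := measurableI _ _ (mG j) (mE k).
    have e2 : 0 < e / 2 by lra.
    (* Beyond some [H N] only measure [e / 2] is left, and the finitely many sets in [H N] share the
       other half of [e]. *)
    pose H j := \bigcup_(i in `I_j) G i.
    have mH j : measurable (H j) by exact: bigcup_measurable.
    have mU : measurable (\bigcup_k0 G k0 `&` E k).
      by apply: measurableI => //; exact: bigcup_measurable.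
    have Uoo : (m (\bigcup_k0 G k0 `&` E k) < +oo)%E.
      by rewrite (le_lt_trans _ (Eoo k)) //; exact: sub.
    have ndH : nondecreasing_seq H.
      move=> i j ij; apply/subsetPset => x [l /= li Gl]; exists l => //=.
      exact: leq_trans ij.
    have UH : \bigcup_k0 G k0 `&` E k `<=` \bigcup_j H j.
      by move=> x [[l _ Gl] _]; exists l.+1 => //; exists l => /=.
    have [N NP] := measure_tail mU Uoo mH ndH UH e2.
    (* [N.+1] and not [N], since [N] may be 0. *)
    have eN : 0 < e / 2 / N.+1%:R by rewrite divr_gt0 // ltr0n.
    have : \forall t \near F, forall j, (j < N)%N ->
      (m ((G j `&` E k) `\` s t @^-1` (G j `&` E k)) <= (e / 2 / N.+1%:R)%:E)%E.
      by apply: near_all_lt => j; exact: PG.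
    apply: filterS => t ht.
    pose B j := (G j `&` E k) `\` s t @^-1` (G j `&` E k).
    have mB j : measurable (B j) by apply: measurableD => //; exact: mps.
    apply: (@le_trans _ _ (m ((\bigcup_k0 G k0 `&` E k) `\` H N `|`
        \big[setU/set0]_(j < N) B j))).
      apply: sub.
      - by apply: measurableD => //; exact: mps.
      - apply: measurableU; first exact: measurableD.
        exact: bigsetU_measurable.
      - move=> x [[Ux Ex] nU]; have [[j /= jN Gj]|nH] := pselect (H N x); last by left.
        right; rewrite -bigcup_mkord; exists j => //; split=> // -[Gs Es]; apply: nU.
        by split=> //; exists j.
    rewrite (le_trans (measureU2 _ _ _)) //;
      [exact: measurableD|exact: bigsetU_measurable|].
    rewrite (_ : e = e / 2 + e / 2); last by lra.
    rewrite EFinD leeD //.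
    rewrite (le_trans (measure_bigsetU_le mB ht)) // lee_fin mulrC mulrA.
    by rewrite ler_pdivrMr ?ltr0n // mulrC ler_wpM2l ?ler_nat // ltW.
move=> A mA Aoo e e0.
have e2 : 0 < e / 2 by lra.
have [|k kP] := measure_tail mA Aoo mE ndE _ e2.
  move=> [x y] _.
  have [k _ Fkx] : (\bigcup_i F1 i) x by rewrite -TF1.
  have [l _ Gly] : (\bigcup_i F2 i) y by rewrite -TF2.
  exists (maxn k l) => //; split => /=.
  - by move: x Fkx; exact/subsetPset/nd1/leq_maxl.
  - by move: y Gly; exact/subsetPset/nd2/leq_maxr.
apply: filterS (EP k A mA _ e2) => t h.
have mAE := measurableI _ _ mA (mE k).
apply: (@le_trans _ _ (m ((A `\` E k) `|` ((A `&` E k) `\` s t @^-1` (A `&` E k))))).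
  apply: sub.
  - by apply: measurableD => //; exact: mps.
  - by apply: measurableU; apply: measurableD => //; exact: mps.
  - move=> x [Ax nA]; have [Ex|nEx] := pselect (E k x); last by left.
    by right; split=> // -[].
rewrite (le_trans (measureU2 _ _ _)) //;
  [..|by rewrite (_ : e = e / 2 + e / 2) ?EFinD ?leeD//; lra].
- exact: measurableD.
- by apply: measurableD => //; exact: mps.
Qed.

End lcont_prod.

Section lcont_rV.
Variable R : realType.

Lemma lcont_rV n (I : Type) (F : set_system I) (h : I -> 'rV[R]_n) : Filter F ->
  (forall i, h t ord0 i @[t --> F] --> (0 : R)) ->
  lcont (lebesgue_rV n) F (fun t (x : 'rV[R]_n) => x + h t).
Proof.
move=> FF; elim: n h => [|n IH] h h0.
  rewrite (_ : (fun t _ => _) = fun=> id); first exact: lcont_id.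
  by apply/funext => t; apply/funext => x; apply/rowP => -[].
move=> A mA Aoo e e0.
have lR := lcont_R FF (h0 ord0).
have ln : lcont (lebesgue_rV n) F (fun t (x : 'rV[R]_n) =>
  x + \row_j h t ord0 (lift ord0 j)).
  apply: IH => i; apply: cvg_trans (h0 (lift ord0 i)).
  by apply: near_eq_cvg; near=> t; rewrite mxE.
have l := lcont_prod FF (fun t => mpres_addr (h t ord0 ord0)) (fun t =>
  mpres_rV_addr (\row_j h t ord0 (lift ord0 j))) lR ln.
have mA' : measurable (@rV_cons R n @^-1` A).
  by rewrite -[X in measurable X]setTI; exact: measurable_rV_cons.
apply: filterS (l _ mA' Aoo _ e0) => t; apply: le_trans.
apply: eq_lew.
rewrite /= /rV_cons_measure /pushforward; congr (_ _).
have E x y : rV_cons (x + h t ord0 ord0,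
  y + \row_j h t ord0 (lift ord0 j)) = rV_cons (x, y) + h t.
  apply/rowP => j; rewrite !mxE; case: splitP => k /= jk; rewrite !mxE /rV_coord.
    by rewrite (_ : j = ord0) //; apply/val_inj => /=; rewrite jk; case: (k) => -[].
  by congr (_ + h t _ _); apply/val_inj => /=; rewrite jk.
apply/seteqP; split => -[x y] /= [Axy nA]; split=> // A'; apply: nA; move: A'.
  by rewrite /preimage /= E.
by rewrite /preimage /= E.
Unshelve. all: by end_near. Qed.

End lcont_rV.

(** * Continuity of translations and mollification in L^p *)

Section powR_inequalities.
Variable R : realType.
Implicit Types a b c d p u v x : R.

Lemma powR_succ x p : 0 <= x -> p != 0 -> x * x `^ (p - 1) = x `^ p.
Proof.
rewrite le_eqVlt => /predU1P[<-|x0] p0; first by rewrite mul0r powR0.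
have := @powRD _ x 1 (p - 1); rewrite powRr1 ?ltW// addrC subrK => -> //.
by rewrite (gt_eqF x0) implybT.
Qed.

Lemma ler_powRD a b p : 0 <= a -> 0 <= b -> 0 <= p ->
  (a + b) `^ p <= 2 `^ p * (a `^ p + b `^ p).
Proof.
move=> a0 b0 p0; have [ab|/ltW ab] := leP a b.
  apply: (@le_trans _ _ ((2 * b) `^ p)).
    by apply: ge0_ler_powR => //; rewrite ?nnegrE; lra.
  by rewrite powRM // ler_wpM2l ?powR_ge0 // lerDr powR_ge0.
apply: (@le_trans _ _ ((2 * a) `^ p)).
  by apply: ge0_ler_powR => //; rewrite ?nnegrE; lra.
by rewrite powRM // ler_wpM2l ?powR_ge0 // lerDl powR_ge0.
Qed.

Lemma powR_le a b p : 0 <= p -> 0 <= a -> a <= b -> a `^ p <= b `^ p.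
Proof.
move=> p0 a0 ab; apply: ge0_ler_powR; rewrite ?nnegrE //.
exact: le_trans ab.
Qed.

Lemma powR_superadditive u v p : 0 <= u -> 0 <= v -> 1 <= p ->
  u `^ p + v `^ p <= (u + v) `^ p.
Proof.
move=> u0 v0 p1; have p0 : p != 0 by rewrite gt_eqF // (lt_le_trans ltr01).
rewrite -(powR_succ u0 p0) -(powR_succ v0 p0) -(powR_succ _ p0) ?addr_ge0 // mulrDl.
by apply: lerD; apply: ler_wpM2l => //; apply: ge0_ler_powR; rewrite ?nnegrE; lra.
Qed.

(** Superadditivity applied to [b] and [a - b]. It turns L^1 estimates for p-th powers into L^p
    estimates. *)
Lemma powR_dist a b p : 0 <= a -> 0 <= b -> 1 <= p ->
  `|a - b| `^ p <= `|a `^ p - b `^ p|.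
Proof.
move=> a0 b0 p1; wlog ab : a b a0 b0 / b <= a.
  move=> W; have [ba|/ltW ab] := leP b a; first exact: W.
  by rewrite distrC [leRHS]distrC; exact: W.
rewrite !ger0_norm ?subr_ge0 //; last by apply: ge0_ler_powR; rewrite ?nnegrE; lra.
rewrite lerBrDr -[X in _ <= X `^ _](subrK b a).
by apply: powR_superadditive => //; rewrite subr_ge0.
Qed.

(** The graph of the power lies above its tangent at [c]. This is Young's inequality for [d] and
    [c ^ (p - 1)] with the conjugate exponents [p] and [q = p / (p - 1)], multiplied by [p]. *)
Lemma powR_tangent c d p : 0 <= c -> 0 <= d -> 1 < p ->
  c `^ p + p * c `^ (p - 1) * (d - c) <= d `^ p.
Proof.
move=> c0 d0 p1; have p0 : 0 < p by lra.
pose q := p / (p - 1).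
have q0 : 0 < q by rewrite /q divr_gt0 //; lra.
have pq : p^-1 + q^-1 = 1.
  by rewrite /q; field; apply/andP; split; apply/eqP; lra.
have := conjugate_powR d0 (powR_ge0 c (p - 1)) p0 q0 pq.
rewrite -powRrM (_ : (p - 1) * q = p); last by rewrite /q; field; apply/eqP; lra.
move=> /(ler_wpM2l (ltW p0)).
have -> : p * (d `^ p / p + c `^ p / q) = d `^ p + (p - 1) * c `^ p.
  by rewrite /q; field; apply/andP; split; apply/eqP; lra.
have := powR_succ c0 (lt0r_neq0 p0).
set X := c `^ (p - 1); set Y := c `^ p; set Z := d `^ p => <-.
nra.
Qed.

Lemma le1D_powR x p : 0 <= x -> 1 <= p -> x <= 1 + x `^ p.
Proof.
move=> x0 p1; have [x1|x1] := leP x 1; first by rewrite (le_trans x1)// lerDl powR_ge0.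
by rewrite (le_trans (le1r_powR _ p1)) ?lerDr // ltW.
Qed.

End powR_inequalities.

Lemma measurable_fun_powRr d (T : measurableType d) (R : realType) (D : set T)
  (f : T -> R) p : measurable_fun D f -> measurable_fun D (fun x => f x `^ p).
Proof. by move=> mf; exact: (measurableT_comp (measurable_powR p) mf). Qed.

Section product_sigma_finite.
Context d1 d2 (T1 : measurableType d1) (T2 : measurableType d2) (R : realType).
Variable m1 : {sigma_finite_measure set T1 -> \bar R}.
Variable m2 : {sigma_finite_measure set T2 -> \bar R}.

Let product_sigma_finite : sigma_finite setT (m1 \x m2)%E.
Proof.
have /sigma_finiteP[F [TF ndF Foo]] := sigma_finiteT m1.
have /sigma_finiteP[G [TG ndG Goo]] := sigma_finiteT m2.
exists (fun k => F k `*` G k).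
  apply/seteqP; split=> // -[x y] _.
  have [k _ Fkx] : (\bigcup_i F i) x by rewrite -TF.
  have [l _ Gly] : (\bigcup_i G i) y by rewrite -TG.
  exists (maxn k l) => //; split => /=.
  - by move: x Fkx; exact/subsetPset/ndF/leq_maxl.
  - by move: y Gly; exact/subsetPset/ndG/leq_maxr.
move=> k; have [mFk Fkoo] := Foo k; have [mGk Gkoo] := Goo k; split.
  exact: measurableX.
by rewrite product_measure1E// lte_mul_pinfty// ge0_fin_numE.
Qed.

(* An alias, since the canonical structures of [m1 \x m2] only consider
   subprobabilities. *)
Definition product_sfm : set (T1 * T2)%type -> \bar R := (m1 \x m2)%E.

HB.instance Definition _ := Measure.copy product_sfm
  ((m1 \x m2)%E : {measure set (T1 * T2)%type -> \bar R}).
HB.instance Definition _ :=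
  @Measure_isSigmaFinite.Build _ _ _ product_sfm product_sigma_finite.

End product_sigma_finite.

Section Lp_continuity.
Context d (T : measurableType d) (R : realType).
Variable m : {sigma_finite_measure set T -> \bar R}.
Variables (I : Type) (F : set_system I) (FF : Filter F) (s : I -> T -> T).
Hypothesis mp : forall t, mpres m (s t).
Hypothesis lc : lcont m F s.

(* The subgraph of [f] has measure [\int f], so continuity on sets applied to it
   gives continuity in L^1. *)
Lemma L1_continuity (f : T -> R) : measurable_fun setT f -> (forall x, 0 <= f x) ->
  (\int[m]_x (f x)%:E < +oo)%E -> forall e : R, 0 < e ->
  \forall t \near F, (\int[m]_x `|f (s t x) - f x|%:E <= e%:E)%E.
Proof.
move=> mf f0 foo e e0.
pose Sg (g : T -> R) : set (T * R) := [set z | 0 <= z.2] `&` [set z | z.2 < g z.1].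
pose S := Sg f.
have m1 : measurable_fun setT (fun z : T * R => f z.1) by exact: measurableT_comp.
have mS : measurable S.
  apply: measurableI.
    rewrite [X in measurable X](_ : _ = snd @^-1` `[0, +oo[%classic); last first.
      by apply/seteqP; split=> z /=; rewrite in_itv /= andbT.
    by rewrite -[X in measurable X]setTI; exact: measurable_snd.
  have := measurable_fun_ltr (@measurable_snd _ _ T R) m1.
  by move=> /(_ measurableT [set true] Logic.I); rewrite setTI.
have xS (g : T -> R) x :
    xsection (Sg g) x = `[0, g x[%classic.
  apply/seteqP; split=> y /=; rewrite in_itv /=.
    by rewrite /xsection /= => /set_mem[/= -> ->].
  by move=> /andP[y0 yg]; apply/mem_set; split.
have Soo : ((m \x @lebesgue_measure R) S < +oo)%E.
  rewrite [ltLHS](_ : _ = \int[m]_x (f x)%:E)%E // /product_measure1.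
  apply: eq_integral => x _ /=; rewrite xS lebesgue_measure_itv /= lte_fin.
  by have := f0 x; rewrite le_eqVlt => /predU1P[<-|->];
    rewrite ?ltxx ?oppr0 ?sube0 ?adde0.
have e2 : 0 < e / 2 by lra.
have mpid : mpres lebesgue_measure (@id R) by split => //; exact: measurable_id.
have lp := lcont_prod FF mp (fun=> mpid) lc (@lcont_id _ _ _ lebesgue_measure _ _ FF).
apply: filterS (lp _ mS Soo _ e2) => t St.
have mpt := mpres_prod (mp t) mpid.
have St' := mpres_measureD mpt mS Soo.
have E (a b : R) : 0 <= a -> 0 <= b ->
    lebesgue_measure (`[0, a[%classic `\` `[0, b[%classic) = (Num.max (a - b) 0)%:E.
  move=> a0 b0; rewrite (_ : _ `\` _ = `[b, a[%classic); last first.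
    apply/seteqP; split=> y /=; rewrite !in_itv /=.
      by move=> [/andP[y0 ->]]; rewrite y0 /= => /negP; rewrite -leNgt => ->.
    by move=> /andP[by_ ya]; rewrite ya (le_trans b0 by_); split=> //;
      rewrite ltNge by_.
  rewrite lebesgue_measure_itv /= lte_fin.
  by case: ltP => ab; [rewrite -EFinD max_l// subr_ge0 ltW|rewrite max_r// subr_le0].
have msf : measurable_fun setT (f \o s t) by apply: measurableT_comp => //;
  exact: (mp t).1.
(* The two positive parts are the lengths of the sections of the two differences between the
   subgraphs of [f] and [f \o s t]. *)
have -> : (\int[m]_x `|f (s t x) - f x|%:E =
    \int[m]_x (Num.max (f x - f (s t x)) 0)%:E +
      \int[m]_x (Num.max (f (s t x) - f x) 0)%:E)%E.
  rewrite -ge0_integralD //.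
  - apply: eq_integral => x _; rewrite -EFinD; congr _%:E.
    have [h|h] := leP (f x) (f (s t x)).
      by rewrite ger0_norm ?subr_ge0 // max_r ?subr_le0 // max_l ?add0r // subr_ge0.
    by rewrite ltr0_norm ?subr_lt0 // max_l ?subr_ge0 1?ltW // max_r ?addr0 ?opprB //
      subr_le0 ltW.
  - by move=> x _; rewrite lee_fin le_max lexx orbT.
  - apply/measurable_EFinP; apply: measurable_maxr => //.
    exact: measurable_funB.
  - by move=> x _; rewrite lee_fin le_max lexx orbT.
  - apply/measurable_EFinP; apply: measurable_maxr => //.
    exact: measurable_funB.
rewrite (_ : e = e / 2 + e / 2) ?EFinD; last by lra.
apply: leeD.
  apply: le_trans St; apply: eq_lew.
  rewrite [RHS](_ : _ = (m \x lebesgue_measure) (S `\` Sg (f \o s t)))%E //.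
  rewrite /product_measure1; apply: eq_integral => x _ /=.
  by rewrite xsectionD !xS E //=; exact: f0.
apply: le_trans (le_trans _ St); last first.
  by apply: eq_lew; exact: St'.
apply: eq_lew.
rewrite [RHS](_ : _ = (m \x lebesgue_measure) (Sg (f \o s t) `\` S))%E //.
rewrite /product_measure1; apply: eq_integral => x _ /=.
by rewrite xsectionD !xS E //=; exact: f0.
Qed.

(** L^1-continuity is applied to the p-th powers of the positive and the negative part of [f];
    [powR_dist] brings the result back to [f]. *)
Lemma Lp_continuity p (f : T -> R) : 1 <= p -> measurable_fun setT f ->
  (\int[m]_x (`|f x| `^ p)%:E < +oo)%E -> forall e : R, 0 < e ->
  \forall t \near F, (\int[m]_x (`|f (s t x) - f x| `^ p)%:E <= e%:E)%E.
Proof.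
move=> p1 mf foo e e0.
have p0 : 0 <= p by lra.
pose f1 x := (Num.max (f x) 0) `^ p; pose f2 x := (Num.max (- f x) 0) `^ p.
have mf1 : measurable_fun setT f1.
  by apply: measurable_fun_powRr; exact: measurable_maxr.
have mf2 : measurable_fun setT f2.
  apply: measurable_fun_powRr.
  by apply: measurable_maxr => //; exact: measurableT_comp.
have f10 x : 0 <= f1 x by exact: powR_ge0.
have f20 x : 0 <= f2 x by exact: powR_ge0.
have mfp : measurable_fun setT (fun x => (`|f x| `^ p)%:E).
  apply/measurable_EFinP; apply: measurable_fun_powRr.
  exact: measurableT_comp.
have max0 (a : R) : 0 <= Num.max a 0 by rewrite le_max lexx orbT.
have maxn (a : R) : Num.max a 0 <= `|a| by rewrite ge_max ler_norm normr_ge0.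
have f1oo : (\int[m]_x (f1 x)%:E < +oo)%E.
  apply: le_lt_trans foo; apply: ge0_le_integral => //.
  - by move=> x _; rewrite lee_fin.
  - exact/measurable_EFinP.
  - by move=> x _; rewrite lee_fin; apply: powR_le.
have f2oo : (\int[m]_x (f2 x)%:E < +oo)%E.
  apply: le_lt_trans foo; apply: ge0_le_integral => //.
  - by move=> x _; rewrite lee_fin.
  - exact/measurable_EFinP.
  - by move=> x _; rewrite lee_fin; apply: powR_le => //; rewrite -[`|f x|]normrN.
(* The factor that [ler_powRD] costs when the two parts are added up; [e / 2 / k] for each part
   makes [e] in total. *)
pose k := 2 `^ p.
have k0 : 0 < k by exact: powR_gt0.
have ek : 0 < e / 2 / k by rewrite !divr_gt0.
apply: filterS2 (L1_continuity mf1 f10 f1oo ek) (L1_continuity mf2 f20 f2oo ek) =>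
  t h1 h2.
have ms (g : T -> R) : measurable_fun setT g ->
  measurable_fun setT (fun x => g (s t x)).
  by move=> mg; apply: measurableT_comp => //; exact: (mp t).1.
have mn (g : T -> R) : measurable_fun setT g ->
  measurable_fun setT (fun x => `|g (s t x) - g x|%:E).
  move=> mg; apply/measurable_EFinP; apply: measurableT_comp => //.
  by apply: measurable_funB => //; exact: ms.
apply: (@le_trans _ _ (k%:E * (\int[m]_x `|f1 (s t x) - f1 x|%:E +
  \int[m]_x `|f2 (s t x) - f2 x|%:E))%E).
  have mm : measurable_fun setT (fun x =>
    `|f1 (s t x) - f1 x|%:E + `|f2 (s t x) - f2 x|%:E)%E.
    by apply: emeasurable_funD; exact: mn.
  have -> : (k%:E * (\int[m]_x `|f1 (s t x) - f1 x|%:E +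
    \int[m]_x `|f2 (s t x) - f2 x|%:E) =
      \int[m]_x (k%:E * (`|f1 (s t x) - f1 x|%:E + `|f2 (s t x) - f2 x|%:E)))%E.
    rewrite ge0_integralZl //.
    - by rewrite ge0_integralD //; exact: mn.
    - by move=> x _; rewrite -EFinD lee_fin addr_ge0.
    - by rewrite lee_fin ltW.
  apply: ge0_le_integral => //.
  - apply/measurable_EFinP; apply: measurable_fun_powRr.
    by apply: measurableT_comp => //; apply: measurable_funB => //; exact: ms.
  - exact: measurable_funeM.
  - move=> x _; rewrite -EFinD -EFinM lee_fin.
    have nE (a : R) : a = Num.max a 0 - Num.max (- a) 0.
      have [h|h] := leP a 0; first by rewrite max_l ?oppr_ge0 // sub0r opprK.
      by rewrite max_r ?subr0 // oppr_le0 ltW.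
    set a := f (s t x); set b := f x.
    apply: (@le_trans _ _ ((`|Num.max a 0 - Num.max b 0| +
      `|Num.max (- a) 0 - Num.max (- b) 0|) `^ p)).
      apply: powR_le => //.
      rewrite [X in `|X - _| <= _]nE [X in `|_ - X| <= _]nE.
      rewrite (_ : _ - _ - _ =
        (Num.max a 0 - Num.max b 0) - (Num.max (- a) 0 - Num.max (- b) 0)).
        exact: ler_normB.
      by ring.
    rewrite (le_trans (ler_powRD _ _ _)) // ler_wpM2l ?powR_ge0 // lerD //.
      exact: powR_dist.
    exact: powR_dist.
apply: (@le_trans _ _ (k%:E * ((e / 2 / k)%:E + (e / 2 / k)%:E))%E).
  by apply: lee_wpmul2l; [rewrite lee_fin (ltW k0)|exact: leeD h1 h2].
by rewrite -EFinD -EFinM lee_fin (_ : k * _ = e) //; field; rewrite gt_eqF.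
Qed.

End Lp_continuity.

Lemma Lp_continuity_prod d1 d2 (T1 : measurableType d1) (T2 : measurableType d2)
    (R : realType) (m1 : {sigma_finite_measure set T1 -> \bar R})
    (m2 : {sigma_finite_measure set T2 -> \bar R})
    (I : Type) (F : set_system I) (s : I -> T1 * T2 ->
      T1 * T2) (p : R) (f : T1 * T2 -> R) :
  Filter F -> (forall t, mpres (m1 \x m2)%E (s t)) -> lcont (m1 \x m2)%E F s ->
  1 <= p -> measurable_fun setT f ->
  (\int[(m1 \x m2)%E]_x (`|f x| `^ p)%:E < +oo)%E -> forall e : R, 0 < e ->
  \forall t \near F, (\int[(m1 \x m2)%E]_x (`|f (s t x) - f x| `^ p)%:E <= e%:E)%E.
Proof.
by move=> FF mps ls; exact: (@Lp_continuity _ _ _ (product_sfm m1 m2) _ _ FF _ mps ls).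
Qed.

(** * Jensen's inequality and averages over a family of maps *)

Section mollification.
Context d1 d2 (H : measurableType d1) (T : measurableType d2) (R : realType).
Variable mu : {sigma_finite_measure set H -> \bar R}.
Variable m : {sigma_finite_measure set T -> \bar R}.
Implicit Types (rho u : H -> R) (p c : R).

(** Integrate against [rho] the tangent of the p-th power at the mean [A] of [|u - c|]; the linear
    term drops out. When the right-hand side is finite, [x <= 1 + x ^ p] makes [rho * (u - c)]
    integrable, and otherwise the bound is trivial. *)
Lemma jensen_powR rho u p c : 1 < p -> measurable_fun setT rho ->
  measurable_fun setT u -> (forall h, 0 <= rho h) -> (\int[mu]_h (rho h)%:E = 1)%E ->
  ((`|\int[mu]_h (rho h * u h) - c| `^ p)%:E <=
   \int[mu]_h (rho h * `|u h - c| `^ p)%:E)%E.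
Proof.
move=> p1 mrho mu' rho0 rho1.
have p0 : 0 <= p by lra.
have mdist : measurable_fun setT (fun h => `|u h - c|).
  by apply: measurableT_comp => //; exact: measurable_funB.
have mp : measurable_fun setT (fun h => rho h * `|u h - c| `^ p).
  by apply: measurable_funM => //; exact: measurable_fun_powRr.
have [oo|] := leP (+oo)%E (\int[mu]_h (rho h * `|u h - c| `^ p)%:E)%E.
  by rewrite (le_trans (leey _)).
move=> foo.
have irho : mu.-integrable setT (EFin \o rho).
  apply/integrableP; split; first exact/measurable_EFinP.
  rewrite (eq_integral (fun h => (rho h)%:E)) ?rho1 ?ltry // => h _ /=.
  by rewrite ger0_norm.
have ip : mu.-integrable setT (EFin \o (fun h => rho h * `|u h - c| `^ p)).
  apply/integrableP; split; first exact/measurable_EFinP.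
  rewrite (eq_integral (fun h => (rho h * `|u h - c| `^ p)%:E)) // => h _ /=.
  by rewrite ger0_norm // mulr_ge0 ?powR_ge0.
have id : mu.-integrable setT (EFin \o (fun h => rho h * (u h - c))).
  apply: (@le_integrable _ _ _ mu setT measurableT _ (fun h =>
    (rho h)%:E + (rho h * `|u h - c| `^ p)%:E)%E) => //.
  - by apply/measurable_EFinP; apply: measurable_funM => //; exact: measurable_funB.
  - move=> h _ /=; rewrite lee_fin [leRHS]ger0_norm; last first.
      by rewrite addr_ge0 // mulr_ge0 ?powR_ge0.
    rewrite normrM ger0_norm // -[X in _ <= X + _]mulr1 -mulrDr ler_wpM2l //.
    by apply: le1D_powR => //; exact: ltW.
  - exact: integrableD.
have ida : mu.-integrable setT (EFin \o (fun h => rho h * `|u h - c|)).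
  apply: le_integrable id => //.
    by apply/measurable_EFinP; exact: measurable_funM.
  by move=> h _ /=; rewrite lee_fin !normrM normr_id.
pose A := \int[mu]_h (rho h * `|u h - c|).
have A0 : 0 <= A by apply: Rintegral_ge0 => h _; rewrite mulr_ge0.
have rho1' : \int[mu]_h rho h = 1 by rewrite /Rintegral rho1.
have irc (k : R) : mu.-integrable setT (EFin \o (fun h => rho h * k)).
  rewrite (_ : _ \o _ = (fun h => k%:E * (rho h)%:E)%E); last first.
    by apply/funext => h /=; rewrite mulrC EFinM.
  exact: integrableZl.
have uE : \int[mu]_h (rho h * u h) - c = \int[mu]_h (rho h * (u h - c)).
  rewrite (_ : \int[mu]_h (rho h * u h) =
    \int[mu]_h (rho h * (u h - c) + rho h * c)); last first.
    by apply: eq_Rintegral => h _; ring.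
  by rewrite RintegralD // RintegralZr // rho1' mul1r addrK.
have uA : `|\int[mu]_h (rho h * u h) - c| <= A.
  rewrite uE (le_trans (le_normr_Rintegral _ _)) // /A.
  apply: eq_lew; apply: eq_Rintegral => h _.
  by rewrite normrM ger0_norm.
apply: (@le_trans _ _ (A `^ p)%:E).
  by rewrite lee_fin; apply: powR_le.
rewrite -[leRHS]fineK; last exact: (integrable_fin_num _ ip).
rewrite lee_fin -[leRHS]/(\int[mu]_h (rho h * `|u h - c| `^ p)).
have -> : A `^ p = \int[mu]_h (rho h * (A `^ p - p * A `^ (p - 1) * A) +
  (rho h * `|u h - c|) * (p * A `^ (p - 1))).
  have i2 : mu.-integrable setT (EFin \o (fun h =>
    rho h * `|u h - c| * (p * A `^ (p - 1)))).
    rewrite (_ : _ \o _ = (fun h =>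
      (p * A `^ (p - 1))%:E * (rho h * `|u h - c|)%:E)%E); last first.
      by apply/funext => h /=; rewrite mulrC EFinM.
    exact: integrableZl.
  by rewrite RintegralD // !RintegralZr // rho1' -/A; ring.
apply: le_Rintegral => //.
  rewrite (_ : _ \o _ = (fun h =>
    (rho h * (A `^ p - p * A `^ (p - 1) * A))%:E +
    (p * A `^ (p - 1))%:E * (rho h * `|u h - c|)%:E)%E); last first.
    by apply/funext => h /=; rewrite EFinD; congr (_ + _)%E; rewrite mulrC EFinM.
  by apply: integrableD => //; [exact: irc|exact: integrableZl].
move=> h _; have := powR_tangent A0 (normr_ge0 (u h - c)) p1.
move=> /(ler_wpM2l (rho0 h)); apply: le_trans.
by apply: eq_lew; ring.
Qed.

(** Jensen's inequality for each [x], followed by Tonelli, bounds the left-hand side by the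
    [rho]-average over [h] of the L^p distances between [f \o s h] and [f]. The family [s] is kept
    general so as to cover both shifts of points and simultaneous shifts of pairs of points. *)
Lemma mollify_Lp (s : H -> T -> T) (D : set H) p (f g : T -> R) rho (e : R) :
  measurable_fun setT (fun z : T * H => s z.2 z.1) -> 1 < p ->
  measurable_fun setT f -> measurable_fun setT g ->
  measurable_fun setT rho -> (forall h, 0 <= rho h) ->
  (\int[mu]_h (rho h)%:E = 1)%E -> (forall h, ~ D h -> rho h = 0) ->
  (forall h, D h -> \int[m]_x (`|f (s h x) - f x| `^ p)%:E <= e%:E)%E -> 0 <= e ->
  (forall x, g x = \int[mu]_h (rho h * f (s h x))) ->
  (\int[m]_x (`|g x - f x| `^ p)%:E <= e%:E)%E.
Proof.
move=> ms p1 mf mg mrho rho0 rho1 rhoD De e0 gE.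
have msh x : measurable_fun setT (fun h => s h x).
  exact: (measurableT_comp ms (pair1_measurable _)).
have mfs : measurable_fun setT (fun z : T * H =>
  f (s z.2 z.1)) by exact: measurableT_comp.
have mK : measurable_fun setT (fun z : T * H =>
  (rho z.2 * `|f (s z.2 z.1) - f z.1| `^ p)%:E).
  apply/measurable_EFinP; apply: measurable_funM; first exact: measurableT_comp.
  apply: measurable_fun_powRr; apply: measurableT_comp => //.
  by apply: measurable_funB => //; exact: measurableT_comp.
have K0 (z : T * H) : (0 <= (rho z.2 * `|f (s z.2 z.1) - f z.1| `^ p)%:E)%E.
  by rewrite lee_fin mulr_ge0 ?powR_ge0.
have mF : measurable_fun setT (fun x =>
  \int[mu]_h (rho h * `|f (s h x) - f x| `^ p)%:E)%E.
  exact (measurable_fun_fubini_tonelli_F (m2 := mu) _ mK K0).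
have mG : measurable_fun setT (fun h =>
  \int[m]_x (rho h * `|f (s h x) - f x| `^ p)%:E)%E.
  exact (measurable_fun_fubini_tonelli_G (m1 := m) _ mK K0).
apply: (@le_trans _ _ (\int[m]_x \int[mu]_h (rho h * `|f (s h x) - f x| `^ p)%:E)%E).
  apply: ge0_le_integral => //.
  - apply/measurable_EFinP; apply: measurable_fun_powRr; apply: measurableT_comp => //.
    exact: measurable_funB.
  - move=> x _; rewrite gE; apply: jensen_powR => //.
    exact: (measurableT_comp mf (msh x)).
have -> : (\int[m]_x \int[mu]_h (rho h * `|f (s h x) - f x| `^ p)%:E =
    \int[mu]_h \int[m]_x (rho h * `|f (s h x) - f x| `^ p)%:E)%E.
  exact: (fubini_tonelli (m1 := m) (m2 := mu) _ mK K0).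
apply: (@le_trans _ _ (\int[mu]_h (e%:E * (rho h)%:E))%E); last first.
  have mrE : measurable_fun setT (fun h => (rho h)%:E) by exact/measurable_EFinP.
  have r0 h : setT h -> (0 <= (rho h)%:E)%E by rewrite lee_fin.
  have eE : (0 <= e%:E)%E by rewrite lee_fin.
  by rewrite (ge0_integralZl _ measurableT mrE r0 eE) rho1 mule1.
apply: ge0_le_integral => //.
- by move=> h _; apply: integral_ge0 => x _; exact: (K0 (x, h)).
- by apply: measurable_funeM; exact/measurable_EFinP.
- move=> h _.
  have mh : measurable_fun setT (fun x => (`|f (s h x) - f x| `^ p)%:E).
    apply/measurable_EFinP; apply: measurable_fun_powRr; apply: measurableT_comp => //.
    apply: measurable_funB => //.
    exact: (measurableT_comp mfs (pair2_measurable h)).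
  rewrite (eq_integral (fun x => (rho h)%:E * (`|f (s h x) - f x| `^ p)%:E)%E) //.
  rewrite ge0_integralZl //; last by rewrite lee_fin.
  have [Dh|nDh] := pselect (D h); last by rewrite (rhoD _ nDh) !mul0e mule0.
  by rewrite muleC lee_pmul ?lee_fin // ?De //; apply: integral_ge0 => x _;
    rewrite lee_fin powR_ge0.
Qed.

End mollification.

Lemma mollify_Lp_prod d d1 d2 (H : measurableType d) (T1 : measurableType d1)
    (T2 : measurableType d2) (R : realType)
    (mu : {sigma_finite_measure set H -> \bar R})
    (m1 : {sigma_finite_measure set T1 -> \bar R})
    (m2 : {sigma_finite_measure set T2 -> \bar R})
    (s : H -> T1 * T2 -> T1 * T2) (D : set H) (p : R) (f g : T1 * T2 -> R)
    (rho : H -> R) (e : R) :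
  measurable_fun setT (fun z : (T1 * T2) * H => s z.2 z.1) -> 1 < p ->
  measurable_fun setT f -> measurable_fun setT g ->
  measurable_fun setT rho -> (forall h, 0 <= rho h) ->
  (\int[mu]_h (rho h)%:E = 1)%E -> (forall h, ~ D h -> rho h = 0) ->
  (forall h, D h -> \int[(m1 \x m2)%E]_x (`|f (s h x) - f x| `^ p)%:E <= e%:E)%E ->
  0 <= e -> (forall x, g x = \int[mu]_h (rho h * f (s h x))) ->
  (\int[(m1 \x m2)%E]_x (`|g x - f x| `^ p)%:E <= e%:E)%E.
Proof. exact: (@mollify_Lp _ _ _ _ _ mu (product_sfm m1 m2)). Qed.

(** * Smooth functions with compact support *)

Section line_derivative.
Context {R : realType} {V : normedModType R}.
Implicit Types (f : V -> R) (x v : V) (t : R).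

Let lineE f x v t : (fun h : R => h^-1 *: (((fun s =>
  f (x + s *: v)) \o shift t) (h *: 1) - f (x + t *: v))) =
  (fun h : R => h^-1 *: ((f \o shift (x + t *: v)) (h *: v) - f (x + t *: v))).
Proof.
apply/funext => h /=; congr (_ *: (f _ - _)).
by rewrite /GRing.scale /= mulr1 -/(GRing.scale _ _) scalerDl addrCA.
Qed.

Lemma derivable_line f x v t : derivable f (x + t *: v) v ->
  is_derive t (1 : R) (fun s => f (x + s *: v)) ('D_v f (x + t *: v)).
Proof. by move=> df; apply: DeriveDef; rewrite /derivable /derive lineE. Qed.

Lemma line_derivable f x v df : is_derive (0 : R) (1 : R) (fun s =>
  f (x + s *: v)) df ->
  is_derive x v f df.
Proof.
move=> [d dE]; apply: DeriveDef.
  by move: d; rewrite /derivable lineE scale0r addr0.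
by rewrite -dE /derive lineE scale0r addr0.
Qed.

Lemma line_MVT f x v t (M : R) : (forall y, derivable f y v) ->
  (forall y, `|'D_v f y| <= M) -> `|f (x + t *: v) - f x| <= M * `|t|.
Proof.
move=> df fM.
have M0 : 0 <= M by exact: le_trans (fM x).
pose g s := f (x + s *: v).
have dg s : is_derive s (1 : R) g ('D_v f (x + s *: v)) by exact: derivable_line.
have cg A : {within A, continuous g}.
  apply: continuous_subspaceT => s; apply: differentiable_continuous.
  by apply/derivable1_diffP; have [] := dg s.
have main a b : a < b -> `|g b - g a| <= M * `|b - a|.
  move=> ab; have [c _ ->] := MVT ab (fun s _ => dg s) (cg _).
  by rewrite normrM ler_wpM2r.
have -> : f x = g 0 by rewrite /g scale0r addr0.
have [t0|t0|->] := ltgtP t 0.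
- by have := main _ _ t0; rewrite distrC sub0r normrN.
- by have := main _ _ t0; rewrite subr0.
- by rewrite subrr normr0 mulr0.
Qed.

End line_derivative.

Section Ccinf.
Context {R : realType} {n : nat}.
Implicit Types (f g : 'rV[R]_n -> R) (x y : 'rV[R]_n).

(** Bounded support on the whole space, with no reference to [Omega]. Where a support inside [Omega]
    is needed, it is recovered from [is_testfun_near] or from a cutoff factor. *)
Definition Cc f := exists r, forall x, r < `|x| -> f x = 0.

Definition Ccinf f := smooth f /\ Cc f.

Lemma smooth_continuous f : smooth f -> continuous f.
Proof. by move=> /(_ 0%N). Qed.

Lemma compact_closed_ball (r : R) : compact [set x : 'rV[R]_n | `|x| <= r].
Proof.
apply: bounded_closed_compact.
  exists r; split; first exact: num_real.
  by move=> s rs x /= xr; rewrite (le_trans xr) // ltW.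
apply: (@preimage_closed _ _ (fun x : 'rV[R]_n => `|x|) [set y | y <= r]).
  by move=> x _; exact: norm_continuous.
exact: closed_le.
Qed.

Lemma Cc_bounded f : continuous f -> Cc f -> exists2 M, 0 <= M & forall x, `|f x| <= M.
Proof.
move=> cf [r fr].
have := @compact_bounded _ R^o (f @` [set x | `|x| <= r]).
case.
  apply: continuous_compact; last exact: compact_closed_ball.
  exact: continuous_subspaceT.
move=> M [_ /(_ (`|M| + 1))] h.
exists (`|M| + 1) => [|x]; first by rewrite addr_ge0.
have [xr|xr] := leP `|x| r; last by rewrite fr // normr0 addr_ge0.
apply: h; last by exists x.
by rewrite (le_lt_trans (ler_norm M)) // ltrDl.
Qed.

Lemma derive_eq0_open f v x : (\forall y \near x, f y = 0) -> 'D_v f x = 0.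
Proof.
move=> f0; rewrite (near_eq_derive v (g := cst 0)) ?derive_cst //.
Qed.

Lemma Cc_partial f i : Cc f -> Cc (partial_deriv i f).
Proof.
move=> [r fr]; exists r => x xr; apply: derive_eq0_open.
have o : open [set y : 'rV[R]_n | r < `|y|].
  apply: (@open_comp _ _ (fun x : 'rV[R]_n => `|x|) [set y | r < y]).
    by move=> y _; exact: norm_continuous.
  exact: open_gt.
have : nbhs x [set y : 'rV[R]_n | r < `|y|] by exact: open_nbhs_nbhs.
by apply: filterS => y; exact: fr.
Qed.

Lemma Ccinf_partial f i : Ccinf f -> Ccinf (partial_deriv i f).
Proof. by move=> [sf cf]; split; [exact: smooth_partial|exact: Cc_partial]. Qed.

Lemma Ccinf_continuous f : Ccinf f -> continuous f.
Proof. by move=> [/smooth_continuous]. Qed.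

Lemma Ccinf_bounded f : Ccinf f -> exists2 M, 0 <= M & forall x, `|f x| <= M.
Proof. by move=> [/smooth_continuous cf sf]; exact: Cc_bounded. Qed.

Lemma smooth_derivable f i x : smooth f -> derivable f x (delta_mx 0 i).
Proof. by move=> /(_ 1%N)[_ /(_ i)[]]. Qed.

(** Only the partial derivatives are at hand, so the way from [x] to [y] changes one coordinate at a
    time and the mean value theorem is applied on each segment. *)
Lemma Ccinf_lipschitz f : Ccinf f ->
  exists2 L, 0 <= L & forall x y, `|f x - f y| <= L * `|x - y|.
Proof.
move=> ff.
have [M M0 fM] : exists2 M, 0 <= M & forall i x, `|partial_deriv i f x| <= M.
  have h i := Ccinf_bounded (Ccinf_partial i ff).
  have {}h i : exists M, 0 <= M /\ forall x, `|partial_deriv i f x| <= M.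
    by have [M ? ?] := h i; exists M.
  have [M MP] := choice h.
  exists (\sum_i M i) => [|i x]; first by apply: sumr_ge0 => i _; have [] := MP i.
  rewrite (bigD1 i) //= (le_trans (proj2 (MP i) x)) // lerDl.
  by apply: sumr_ge0 => j _; have [] := MP j.
exists (n%:R * M); first by rewrite mulr_ge0.
move=> x y.
(* The path from [x] to [y]: the first [k] coordinates have already been replaced. *)
pose z k := \row_(j < n) if (j < k)%N then y ord0 j else x ord0 j.
have h k : (k <= n)%N -> `|f x - f (z k)| <= k%:R * M * `|x - y|.
  elim: k => [_|k IH kn].
    rewrite mul0r mul0r (_ : z 0%N = x) ?subrr ?normr0 //.
    by apply/rowP => j; rewrite mxE.
  pose i := Ordinal kn.
  have zE : z k.+1 = z k + (y ord0 i - x ord0 i) *: delta_mx 0 i.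
    apply/rowP => j; rewrite !mxE ltnS leq_eqVlt.
    have [->|ji] := eqVneq j i; first by rewrite /= eqxx ltnn /= mulr1 addrC subrK.
    rewrite mulr0 addr0 (_ : (j == k :> nat) = false) //.
    by apply/negP => /eqP jk; move/eqP: ji; apply; exact/val_inj.
  rewrite -natr1 mulrDl mul1r mulrDl.
  rewrite (_ : f x - f (z k.+1) = (f x - f (z k)) + - (f (z k.+1) - f (z k)));
    last by ring.
  rewrite (le_trans (ler_normD _ _)) // lerD ?IH ?(ltnW kn) // normrN zE.
  have := @line_MVT _ _ f (z k) (delta_mx 0 i) (y ord0 i - x ord0 i) M.
  move=> /(_ (fun y => @smooth_derivable f i y ff.1) (fM i)) /le_trans; apply.
  rewrite ler_wpM2l // distrC; have := rV_normE (x - y) i.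
  by rewrite !mxE.
have := h n (leqnn n); rewrite (_ : z n = y) //.
by apply/rowP => j; rewrite mxE ltn_ord.
Qed.

End Ccinf.

(** * Smooth bump functions *)

Section bump.
Context {R : realType}.
Implicit Types (t : R).

(** The powers of [t^-1] close the family under differentiation, so smoothness of all its members
    follows by one induction; [m = 0] is the usual flat function. *)
Definition bump1 (m : nat) t : R := if 0 < t then expR (- t^-1) * t^-1 ^+ m else 0.

Lemma bump1_ge0 m t : 0 <= bump1 m t.
Proof.
rewrite /bump1; case: ifPn => // t0.
by rewrite mulr_ge0 ?expR_ge0 // exprn_ge0 // invr_ge0 ltW.
Qed.

Lemma bump1_gt0 m t : 0 < t -> 0 < bump1 m t.
Proof. by move=> t0; rewrite /bump1 t0 mulr_gt0 ?expR_gt0 // exprn_gt0 ?invr_gt0. Qed.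

Lemma bump1_le0 m t : t <= 0 -> bump1 m t = 0.
Proof. by move=> t0; rewrite /bump1 ltNge t0. Qed.

(** Raise [u <= expR u] to the power [k] for [u = t / (k + 1)]; the [+ 1] keeps the quotient
    meaningful for [k = 0]. *)
Lemma expR_ge_exprn k t : 0 <= t -> t ^+ k <= k.+1%:R ^+ k * expR t.
Proof.
move=> t0; pose u := t / k.+1%:R.
have u0 : 0 <= u by rewrite divr_ge0.
have : u <= expR u by rewrite (le_trans _ (expR_ge1Dx u)) // lerDr.
move=> /(lerXn2r k); rewrite !nnegrE u0 expR_ge0 => /(_ isT isT).
rewrite /u expr_div_n ler_pdivrMr ?exprn_gt0 ?ltr0n // mulrC => /le_trans; apply.
rewrite ler_wpM2l // -expRM_natl ler_expR mulrA ler_pdivrMr ?ltr0n //.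
by rewrite mulrC ler_wpM2l // ler_nat.
Qed.

(** The exponential absorbs two more powers of [t^-1] than are present, which leaves the decay
    [t ^ 2] at the origin. *)
Lemma bump1_bound m t : 0 < t -> bump1 m t <= m.+3%:R ^+ m.+2 * t ^+ 2.
Proof.
move=> t0; rewrite /bump1 t0.
have := expR_ge_exprn m.+2 (ltW (_ : 0 < t^-1)); rewrite invr_gt0 => /(_ t0) h.
set u := t^-1 in h *.
have ut : u ^+ 2 * t ^+ 2 = 1 by rewrite -exprMn mulVf ?expr1n // gt_eqF.
have -> : expR (- u) * u ^+ m = u ^+ m.+2 / expR u * t ^+ 2.
  by rewrite expRN -[LHS]mulr1 -ut -[m.+2]addn2 exprD; ring.
by rewrite (ler_wpM2r (exprn_ge0 _ (ltW t0))) // ler_pdivrMr ?expR_gt0.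
Qed.

Lemma is_derive_bump1 m t :
  is_derive t (1 : R) (bump1 m) (bump1 m.+2 t - m%:R * bump1 m.+1 t).
Proof.
have [t0|t0|->] := ltgtP t 0.
- rewrite !bump1_le0 ?ltW // mulr0 subr0.
  have d : is_derive t (1 : R) (cst (0 : R)) 0 by exact: is_derive_cst.
  apply: (near_eq_is_derive _ d).
  have : nbhs t [set s : R | s < 0] by apply: open_nbhs_nbhs; split => //;
    exact: open_lt.
  by apply: filterS => s /= s0; rewrite bump1_le0 // ltW.
- have tn0 : t != 0 by rewrite gt_eqF.
  have dV : is_derive t (1 : R) (fun s : R => s^-1) (- t ^- 2 *: 1).
    by apply: (@is_deriveV _ id) => //; exact: is_derive_id.
  have dN : is_derive t (1 : R) (fun s : R =>
    - s^-1) (- (- t ^- 2 *: 1)) by exact: is_deriveN.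
  have dE := @is_derive1_comp R expR (fun s : R => - s^-1) t _ _ (is_derive_expR _) dN.
  have d := is_deriveM dE (is_deriveX m dV).
  have {}d : is_derive t (1 : R) (fun s : R =>
    expR (- s^-1) * s^-1 ^+ m) (bump1 m.+2 t - m%:R * bump1 m.+1 t).
    have E : (expR \o (fun s : R => - s^-1)) * (fun s : R => s^-1) ^+ m =
        (fun s : R => expR (- s^-1) * s^-1 ^+ m).
      by apply/funext => s; rewrite exprfctE.
    rewrite E in d; apply: (is_derive_eq d);
      rewrite exprfctE /bump1 t0 /GRing.scale /= mulr1.
    have -> : t ^- 2 = t^-1 ^+ 2 by rewrite exprVn.
    case: (m) => [|k]; first by rewrite /= !expr0 !expr1; ring.
    by rewrite /= !exprS; ring.
  apply: (near_eq_is_derive _ d).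
  have : nbhs t [set s : R | 0 < s] by apply: open_nbhs_nbhs; split => //;
    exact: open_gt.
  by apply: filterS => s /= s0; rewrite /bump1 s0.
- rewrite !bump1_le0 // mulr0 subr0; apply/is_derive1_caratheodory.
  (* The difference quotient at 0 is [bump1 m.+1], because [bump1 m z = bump1 m.+1 z * z]; it
     remains to see that it is continuous at 0. *)
  exists (bump1 m.+1); split; last by rewrite bump1_le0.
    move=> z; rewrite (@bump1_le0 _ 0) // !subr0 /bump1.
    case: ifPn => z0; last by rewrite mul0r.
    by rewrite exprSr -!mulrA mulVf ?mulr1 // gt_eqF.
  have b0 : bump1 m.+1 0 = 0 by rewrite bump1_le0.
  rewrite /prop_for /continuous_at b0; apply/cvgrPdist_le => e e0.
  set C : R := m.+1.+3%:R ^+ m.+1.+2.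
  have C1 : 1 <= C by rewrite exprn_ege1 // ler1n.
  have C0 : 0 < C by rewrite (lt_le_trans ltr01).
  have : nbhs (0 : R) (ball (0 : R) (Num.min 1 (e / C))).
    by apply: nbhsx_ballx; rewrite lt_min ltr01 divr_gt0.
  apply: filterS => z; rewrite -ball_normE /= !sub0r !normrN lt_min => /andP[z1 ze].
  rewrite ger0_norm ?bump1_ge0 //.
  have [z0|z0] := leP z 0; first by rewrite bump1_le0 // ltW.
  rewrite (le_trans (bump1_bound _ z0)) // -/C -ler_pdivlMl // mulrC.
  rewrite (le_trans _ (ltW ze)) // (gtr0_norm z0) expr2 ler_piMr ?ltW //.
  by rewrite -(gtr0_norm z0).
Qed.

Lemma bump1_continuous m : continuous (bump1 m).
Proof.
move=> t; apply: differentiable_continuous; apply/derivable1_diffP.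
by have [] := is_derive_bump1 m t.
Qed.

End bump.

Section bump_rV.
Context {R : realType} {n : nat}.
Implicit Types (f : 'rV[R]_n -> R) (i : 'I_n).

Lemma continuous_coord_affine (a b : R) i :
  continuous (fun x : 'rV[R]_n => a * x ord0 i + b).
Proof.
move=> x; have c : (fun y : 'rV[R]_n =>
  y ord0 i) @ x --> x ord0 i by exact: coord_continuous.
exact: (cvgD (cvgM (cvg_cst a) c) (cvg_cst b)).
Qed.

Lemma smooth_bump1 m (a b : R) i : smooth (fun x : 'rV[R]_n =>
  bump1 m (a * x ord0 i + b)).
Proof.
move=> k; elim: k m => [|k IH] m.
  move=> x; apply: (@continuous_comp _ _ _ (fun x : 'rV[R]_n =>
    a * x ord0 i + b) (bump1 m)).
    exact: continuous_coord_affine.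
  exact: bump1_continuous.
have d x j : is_derive x ('e_j : 'rV[R]_n) (fun x : 'rV[R]_n =>
  bump1 m (a * x ord0 i + b))
   ((bump1 m.+2 (a * x ord0 i + b) - m%:R * bump1 m.+1 (a * x ord0 i +
     b)) * (a * (i == j)%:R)).
  apply: line_derivable.
  have da : is_derive (0 : R) (1 : R) (fun s : R =>
    (a * (i == j)%:R) * s + (a * x ord0 i + b)) (a * (i == j)%:R).
    have := is_deriveD (is_deriveZ (a * (i == j)%:R) (is_derive_id (0 : R) (1 : R)))
      (is_derive_cst (a * x ord0 i + b) (0 : R) (1 : R)).
    by move=> h; apply: (is_derive_eq h); rewrite addr0 /GRing.scale /= mulr1.
  have D := is_derive_bump1 m (a * x ord0 i + b).
  have {}D : is_derive ((a * (i == j)%:R) * 0 + (a * x ord0 i + b)) (1 : R) (bump1 m)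
    (bump1 m.+2 (a * x ord0 i + b) - m%:R * bump1 m.+1 (a * x ord0 i + b)).
    by rewrite mulr0 add0r.
  have := @is_derive1_comp R (bump1 m) (fun s : R =>
    a * (i == j)%:R * s + (a * x ord0 i + b)) 0 _ _ D da.
  congr (is_derive _ _ _ _); apply/funext => s /=; congr bump1.
  by rewrite !mxE eqxx /=; ring.
split.
  move=> x; apply: (@continuous_comp _ _ _ (fun x : 'rV[R]_n =>
    a * x ord0 i + b) (bump1 m)).
    exact: continuous_coord_affine.
  exact: bump1_continuous.
move=> j; split=> [x|]; first by have [] := d x j.
rewrite (_ : partial_deriv j _ = fun x =>
  (- (m%:R * (a * (i == j)%:R))) * bump1 m.+1 (a * x ord0 i + b)
   + ((a * (i == j)%:R) * bump1 m.+2 (a * x ord0 i + b) + 0)).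
  apply: (@Ck_lin _ _ k _ (fun x : 'rV[R]_n => bump1 m.+1 (a * x ord0 i + b))
    (fun x : 'rV[R]_n => (a * (i == j)%:R) * bump1 m.+2 (a * x ord0 i + b) + 0)) => //.
  exact: (@Ck_lin _ _ k _ (fun x : 'rV[R]_n =>
    bump1 m.+2 (a * x ord0 i + b)) (fun=> 0) (IH _) (smooth_cst 0 k)).
by apply/funext => x; rewrite /partial_deriv; have [_ ->] := d x j; ring.
Qed.

Lemma smoothM f g : smooth f -> smooth g -> smooth (fun x => f x * g x).
Proof. by move=> sf sg k; exact: CkM. Qed.

Lemma smooth_prod (I : Type) (r : seq I) (F : I -> 'rV[R]_n -> R) :
  (forall k, smooth (F k)) -> smooth (fun x => \prod_(i <- r) F i x).
Proof.
move=> sF; elim: r => [|i r IH].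
  by rewrite (_ : (fun _ => _) = fun=> 1); [exact: smooth_cst|apply/funext => x;
    rewrite big_nil].
rewrite (_ : (fun _ => _) = fun x => F i x * \prod_(i <- r) F i x).
  exact: smoothM.
by apply/funext => x; rewrite big_cons.
Qed.

(** For [d > 0] it is positive exactly on the open cube of half-side [d], which is the open ball of
    the sup norm, and it is even. *)
Definition bumpf (d : R) (x : 'rV[R]_n) : R :=
  \prod_(i < n) (bump1 0 (d^-1 * x ord0 i + 1) * bump1 0 (- d^-1 * x ord0 i + 1)).

Lemma smooth_bumpf d : smooth (bumpf d).
Proof. by apply: smooth_prod => i; apply: smoothM; exact: smooth_bump1. Qed.

Lemma bumpf_ge0 d x : 0 <= bumpf d x.
Proof. by apply: prodr_ge0 => i _; rewrite mulr_ge0 ?bump1_ge0. Qed.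

Lemma bumpfN d x : bumpf d (- x) = bumpf d x.
Proof.
apply: eq_bigr => i _; rewrite mxE mulrC.
by congr (bump1 _ _ * bump1 _ _); ring.
Qed.

Lemma bumpf_eq0 d x : 0 < d -> d < `|x| -> bumpf d x = 0.
Proof.
move=> d0 dx; have [i xi] : exists i, d < `|x ord0 i|.
  apply: contrapT => h; move: dx; rewrite ltNge => /negP; apply.
  apply/rV_normP; first exact: ltW.
  by move=> i; rewrite leNgt; apply/negP => h'; apply: h; exists i.
rewrite /bumpf (bigD1 i) //=; move: xi; rewrite lter_normr => /orP[h|h].
  rewrite (@bump1_le0 _ _ (- d^-1 * _ + 1)) ?mulr0 ?mul0r //.
  by rewrite mulNr addrC subr_le0 mulrC ler_pdivlMr // mul1r ltW.
rewrite (@bump1_le0 _ _ (d^-1 * _ + 1)) ?mul0r //.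
by rewrite -[_ * _]opprK -mulrN addrC subr_le0 mulrC ler_pdivlMr // mul1r ltW.
Qed.

Lemma bump1_le (t s : R) : 0 < t -> t <= s -> bump1 0 t <= bump1 0 s.
Proof.
move=> t0 ts; have s0 := lt_le_trans t0 ts.
by rewrite /bump1 t0 s0 !expr0 !mulr1 ler_expR lerN2 lef_pV2.
Qed.

Lemma bumpf_lb d : 0 < d -> exists2 c, 0 < c & forall x, `|x| <= d / 2 ->
  c <= bumpf d x.
Proof.
move=> d0; exists (\prod_(i < n) (bump1 0 (2^-1 : R) * bump1 0 2^-1)).
  by apply: prodr_gt0 => i _; rewrite mulr_gt0 // bump1_gt0.
move=> x xd; apply: ler_prod => i _; have := le_trans (rV_normE x i) xd.
rewrite ler_norml => /andP[h1 h2].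
have dx : - 2^-1 <= d^-1 * x ord0 i <= 2^-1.
  by rewrite mulrC ler_pdivlMr // ler_pdivrMr //; apply/andP; split; lra.
move/andP: dx => [dx1 dx2].
rewrite mulr_ge0 ?bump1_ge0 //= ler_pM ?bump1_ge0 // bump1_le //; first by lra.
by rewrite mulNr; lra.
Qed.

End bump_rV.

(** * Convolution *)

Section real_integrable.
Context d (T : measurableType d) (R : realType).
Variables (m : {measure set T -> \bar R}) (D : set T) (mD : measurable D).
Implicit Types f g : T -> R.

Lemma integrable_addr f g : m.-integrable D (EFin \o f) ->
  m.-integrable D (EFin \o g) ->
  m.-integrable D (EFin \o (fun x => f x + g x)).
Proof. by move=> mf mg; exact: (integrableD mD mf mg). Qed.

Lemma integrable_subr f g : m.-integrable D (EFin \o f) ->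
  m.-integrable D (EFin \o g) ->
  m.-integrable D (EFin \o (fun x => f x - g x)).
Proof. by move=> mf mg; exact: (integrableB mD mf mg). Qed.

Lemma integrable_scaler c f : m.-integrable D (EFin \o f) ->
  m.-integrable D (EFin \o (fun x => c * f x)).
Proof. by move=> mf; exact: (integrableZl mD c mf). Qed.

End real_integrable.

Section convolution.
Context {R : realType} {n : nat}.
Local Notation mu := (lebesgue_rV n : {measure set 'rV[R]_n -> \bar R}).
Local Notation B r := [set x : 'rV[R]_n | `|x| <= r].
Implicit Types (f g rho eta : 'rV[R]_n -> R) (x y : 'rV[R]_n) (i : 'I_n).

Definition convol rho g x := \int[mu]_y (rho (x - y) * g y).

Definition locint g := measurable_fun setT g /\
  forall r, mu.-integrable (B r) (EFin \o g).

(** The majorant used in all domination arguments for convolutions. *)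
Lemma locint_dom g r (M : R) : locint g ->
  mu.-integrable setT (fun y => (M * ((fun y => `|g y|) \_ (B r)) y)%:E).
Proof.
move=> [mg /(_ r) ig].
have h : mu.-integrable setT ((EFin \o (fun y => `|g y|)) \_ (B r)).
  apply/(integrable_mkcond _ (measurable_rV_ball r)); exact: integrable_norm ig.
have := integrableZl measurableT M h; apply: eq_integrable => // y _ /=.
by rewrite EFinM /patch; case: ifPn.
Qed.

Lemma measurable_conv_arg rho g x : continuous rho -> measurable_fun setT g ->
  measurable_fun setT (fun y => rho (x - y) * g y).
Proof.
move=> cr mg; apply: measurable_funM => //.
by apply: (measurableT_comp (continuous_measurable_rV cr)); exact: (mpres_rV_subl x).1.
Qed.

Lemma convol_dom rho g x r (s M : R) : (forall y, r < `|y| -> rho y = 0) ->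
  (forall y, `|rho y| <= M) -> `|x| <= s ->
  forall y, `|rho (x - y) * g y| <= M * ((fun y => `|g y|) \_ (B (s + r))) y.
Proof.
move=> r0 rM xs y; rewrite /patch; case: ifPn => [_|].
  by rewrite normrM ler_wpM2r.
move=> /negP h; rewrite mulr0 r0 ?mul0r ?normr0 //.
rewrite ltNge; apply/negP => xyr; apply: h; rewrite inE /=.
rewrite (_ : y = x - (x - y)); last by rewrite opprB addrC subrK.
by rewrite (le_trans (ler_normB _ _)) // lerD.
Qed.

Lemma convol_integrable rho g x : continuous rho -> Cc rho -> locint g ->
  mu.-integrable setT (EFin \o (fun y => rho (x - y) * g y)).
Proof.
move=> cr Ccr lg; have [r r0] := Ccr; have [M M0 rM] := Cc_bounded cr Ccr.
apply: le_integrable (locint_dom (`|x| + r) M lg) => //.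
  by apply/measurable_EFinP; apply: measurable_conv_arg => //; exact: lg.1.
move=> y _ /=; rewrite lee_fin (le_trans _ (ler_norm _)) //.
exact: (convol_dom _ r0 rM).
Qed.

Lemma convol_continuous rho g : Ccinf rho -> locint g -> continuous (convol rho g).
Proof.
move=> Cr lg; suff h (x : 'rV[R]_n) : convol rho g z @[z --> x] --> convol rho g x by
  exact: h.
have [L L0 rL] := Ccinf_lipschitz Cr; have [r r0] := Cr.2.
have cr := Ccinf_continuous Cr.
(* The radius covers every [y] with [rho (w - y) != 0] for some [w] of norm at most [|x| + 1]. *)
set I := \int[mu]_y (1 * ((fun y => `|g y|) \_ (B (`|x| + 1 + r))) y).
have I0 : 0 <= I.
  by apply: Rintegral_ge0 => y _; rewrite mul1r /patch; case: ifPn.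
apply: (proj2 (@cvgrPdist_le _ _ _ (nbhs x) _ (convol rho g) (convol rho g x))) => e e0.
(* The bound 1 keeps [z] where [I] is valid; the [+ 1] keeps the denominator positive when [L * I]
   is 0. *)
have d0 : 0 < Num.min 1 (e / (L * I + 1)).
  by rewrite lt_min ltr01 divr_gt0 // ltr_wpDl // mulr_ge0.
have : nbhs x (ball x (Num.min 1 (e / (L * I + 1)))) by exact: nbhsx_ballx.
apply: filterS => z; rewrite -ball_normE /= lt_min => /andP[xz1 xze].
have ix y := convol_integrable y cr Cr.2 lg.
rewrite /convol -RintegralB //.
apply: (@le_trans _ _ (\int[mu]_y ((L * `|x - z|) * ((fun y =>
  `|g y|) \_ (B (`|x| + 1 + r))) y))).
  have iB : mu.-integrable setT (EFin \o (fun y =>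
    rho (x - y) * g y - rho (z - y) * g y)).
    exact: integrable_subr.
  rewrite (le_trans (le_normr_Rintegral _ _)) //; apply: le_Rintegral => //.
  - by have := integrable_norm iB.
  - exact: (locint_dom _ _ lg).
  - move=> y _; rewrite -mulrBl normrM /patch; case: ifPn => [_|].
      rewrite ler_wpM2r // (le_trans (rL _ _)) //.
      by rewrite opprB addrA subrK.
    move=> /negP h; rewrite mulr0.
    have far (w : 'rV[R]_n) : `|w| <= `|x| + 1 -> rho (w - y) = 0.
      move=> wx; apply: r0; rewrite ltNge; apply/negP => wyr; apply: h; rewrite inE /=.
      rewrite (_ : y = w - (w - y)); last by rewrite opprB addrC subrK.
      by rewrite (le_trans (ler_normB _ _)) // lerD.
    rewrite !far ?subrr ?normr0 ?mul0r ?lerDl //.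
    rewrite (_ : z = x - (x - z)); last by rewrite opprB addrC subrK.
    by rewrite (le_trans (ler_normB _ _)) // lerD // ltW.
have -> : \int[mu]_y ((L * `|x - z|) * ((fun y =>
  `|g y|) \_ (B (`|x| + 1 + r))) y) = L * `|x - z| * I.
  rewrite -RintegralZl //; last exact: (locint_dom _ _ lg).
  by apply: eq_Rintegral => y _; rewrite mul1r.
rewrite mulrAC; move: xze; rewrite ltr_pdivlMr; last by rewrite ltr_wpDl // mulr_ge0.
rewrite mulrC => /ltW; apply: le_trans.
by rewrite ler_wpM2r // lerDl.
Qed.

(** Differentiation under the integral sign along the line through [x] in direction ['e_i], for
    parameters in ]-1, 1[; the majorant is a multiple of [|g|] on a ball of radius [|x| + 1 + r]. *)
Lemma is_derive_convol rho g x i : Ccinf rho -> locint g ->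
  is_derive x ('e_i : 'rV[R]_n) (convol rho g) (convol (partial_deriv i rho) g x).
Proof.
move=> Cr lg.
have cr := Ccinf_continuous Cr.
have Cd := Ccinf_partial i Cr.
have [M M0 dM] := Ccinf_bounded Cd.
have [r r0] := Cd.2.
pose F (t : R) y := rho (x + t *: 'e_i - y) * g y.
have dF t y : is_derive t (1 : R) (F ^~ y) (partial_deriv i rho (x +
  t *: 'e_i - y) * g y).
  have -> : (F ^~ y) = g y \*: (fun t : R => rho ((x - y) + t *: 'e_i)).
    by apply/funext => s; rewrite /F addrAC mulrC.
  have d : derivable rho ((x - y) + t *: 'e_i) 'e_i by exact: smooth_derivable Cr.1.
  have := is_deriveZ (g y) (derivable_line d).
  by rewrite addrAC mulrC.
have I0 : `]-1, 1[%classic (0 : R) by rewrite /= in_itv /= ltrN10 ltr01.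
have e1 : `|('e_i : 'rV[R]_n)| <= 1.
  by apply/rV_normP => // j; rewrite mxE eqxx /=; case: (j == i);
    rewrite ?normr1 ?normr0.
have H := @cvg_differentiation_under_integral R _ _ mu F setT measurableT 0 (-1) 1 I0.
have {}H := H _ _ (fun y => M * ((fun y => `|g y|) \_ (B ((`|x| + 1) + r))) y).
have {}H : h^-1 *: (convol rho g (x + (h + 0) *: 'e_i) - convol rho g (x +
  0 *: 'e_i)) @[h --> 0^'] --> \int[mu]_y (partial1of2 F 0 y).
  apply: H.
  - by move=> t _; exact: (convol_integrable _ cr Cr.2 lg).
  - by move=> t y _ _; have [] := dF t y.
  - move=> y; rewrite mulr_ge0 // /patch; case: ifPn => //.
  - exact: (locint_dom _ _ lg).
  - move=> t y; rewrite /= in_itv /= => /andP[t1 t2] _.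
    rewrite partial1of2E; have [_ ->] := dF t y.
    apply: (convol_dom _ r0 dM); rewrite (le_trans (ler_normD _ _)) // lerD //.
    rewrite normrZ -[leRHS]mulr1 ler_pM //.
    by rewrite ler_norml !ltW.
apply: line_derivable.
have E : convol (partial_deriv i rho) g x = \int[mu]_y (partial1of2 F 0 y).
  apply: eq_Rintegral => y _; rewrite partial1of2E; have [_ ->] := dF 0 y.
  by rewrite scale0r addr0.
rewrite E; move: H; set l := (X in _ --> X -> _) => H.
have {}H : h^-1 *: (((fun s =>
  convol rho g (x + s *: 'e_i)) \o shift 0) (h *: (1 : R)) - convol rho g (x +
  0 *: 'e_i)) @[h --> 0^'] --> l.
  apply: cvg_trans H; apply: near_eq_cvg; near=> h => /=.
  by rewrite /GRing.scale /= mulr1.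
apply: DeriveDef; first by apply/cvg_ex; exists l.
by apply/cvg_lim.
Unshelve. all: by end_near. Qed.

Lemma partial_convol rho g i : Ccinf rho -> locint g ->
  partial_deriv i (convol rho g) = convol (partial_deriv i rho) g.
Proof.
move=> Cr lg; apply/funext => x; rewrite /partial_deriv.
by have [_ ->] := is_derive_convol x i Cr lg.
Qed.

Lemma smooth_convol rho g : Ccinf rho -> locint g -> smooth (convol rho g).
Proof.
move=> Cr lg k; elim: k rho Cr => [|k IH] rho Cr; first exact: convol_continuous.
split; first exact: convol_continuous.
move=> i; split; first by move=> x; have [] := is_derive_convol x i Cr lg.
by rewrite partial_convol //; apply: IH; exact: Ccinf_partial.
Qed.

Lemma locint_cst (c : R) : locint (fun=> c).
Proof.
split=> // r; apply/integrableP; split; first exact: measurable_cst.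
rewrite (eq_integral (cst (`|c|%:E))) // integral_cst //;
  last exact: measurable_rV_ball.
by rewrite lte_mul_pinfty // lebesgue_rV_ball_lty.
Qed.

Lemma locint_integrable g : mu.-integrable setT (EFin \o g) -> locint g.
Proof.
move=> ig; split; first by have /integrableP[/measurable_EFinP] := ig.
by move=> r; apply: (integrableS _ _ _ ig) => //; exact: measurable_rV_ball.
Qed.

Lemma Ccinf_locint f : continuous f -> Cc f -> mu.-integrable setT (EFin \o f).
Proof.
move=> cf Cf; have [r r0] := Cf; have [M M0 fM] := Cc_bounded cf Cf.
apply: le_integrable (locint_dom r M (locint_cst 1)) => //.
  by apply/measurable_EFinP; exact: continuous_measurable_rV.
move=> y _ /=; rewrite lee_fin (le_trans _ (ler_norm _)) // /patch.
case: ifPn => [_|/negP]; first by rewrite normr1 mulr1.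
by rewrite inE /= => /negP; rewrite -ltNge => /r0 ->; rewrite normr0 mulr0.
Qed.

(* [int d_i f] is the derivative of the constant function [convol f 1]. *)
Lemma integral_partial f i : Ccinf f -> \int[mu]_x partial_deriv i f x = 0.
Proof.
move=> Cf.
have cE h x : continuous h -> convol h (fun=> 1) x = \int[mu]_y h y.
  move=> ch; rewrite -[RHS](Rintegral_mpres (mpres_rV_subl x)).
    by apply: eq_Rintegral => y _; rewrite mulr1.
  exact: continuous_measurable_rV.
have := partial_convol i Cf (locint_cst 1) => /(congr1 (fun h => h 0)).
rewrite cE; last exact: Ccinf_continuous (Ccinf_partial i Cf).
move=> <-; rewrite /partial_deriv.
rewrite (_ : convol f (fun=> 1) = cst (\int[mu]_y f y)) ?derive_cst //.
by apply/funext => x; rewrite cE //; exact: Ccinf_continuous.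
Qed.

Lemma CcinfM f g : Ccinf f -> smooth g -> Ccinf (fun x => f x * g x).
Proof.
move=> [sf [r fr]] sg; split; first exact: smoothM.
by exists r => x /fr ->; rewrite mul0r.
Qed.

Lemma Ccinf_integrable f : Ccinf f -> mu.-integrable setT (EFin \o f).
Proof. by move=> Cf; apply: Ccinf_locint; [exact: Ccinf_continuous|exact: Cf.2]. Qed.

Lemma integration_by_parts f g i : Ccinf f -> smooth g ->
  \int[mu]_x (partial_deriv i f x * g x) = - \int[mu]_x (f x * partial_deriv i g x).
Proof.
move=> Cf sg; have := integral_partial i (CcinfM Cf sg).
have i1 := Ccinf_integrable (CcinfM (Ccinf_partial i Cf) sg).
have i2 := Ccinf_integrable (CcinfM Cf (smooth_partial i sg)).
have -> : \int[mu]_x partial_deriv i (fun x => f x * g x) x =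
    \int[mu]_x (partial_deriv i f x * g x + f x * partial_deriv i g x).
  apply: eq_Rintegral => x _; rewrite /partial_deriv.
  have df : derivable f x 'e_i by exact: smooth_derivable Cf.1.
  have dg : derivable g x 'e_i by exact: smooth_derivable sg.
  by rewrite (deriveM df dg) addrC /GRing.scale /= mulrC.
by rewrite RintegralD // => /eqP; rewrite addr_eq0 => /eqP.
Qed.

(** Iterated partial derivatives, the head of the list being outermost. Integration by parts moves
    the outermost derivative before the others and thus reverses the list, which explains the [rev]
    in later statements. *)
Definition pd (l : seq 'I_n) f := foldr partial_deriv f l.

Lemma Ccinf_pd l f : Ccinf f -> Ccinf (pd l f).
Proof. by move=> Cf; elim: l => //= i l; exact: Ccinf_partial. Qed.

Lemma smooth_pd l f : smooth f -> smooth (pd l f).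
Proof. by move=> Cf; elim: l => //= i l; exact: smooth_partial. Qed.

Lemma integration_by_parts_pd l f g : Ccinf f -> smooth g ->
  \int[mu]_x (pd l f x * g x) = (-1) ^+ size l * \int[mu]_x (f x * pd (rev l) g x).
Proof.
move=> Cf; elim: l g => [|i l IH] g sg; first by rewrite expr0 mul1r.
rewrite /= integration_by_parts //; last exact: Ccinf_pd.
rewrite IH; last exact: smooth_partial.
by rewrite exprS mulN1r mulNr rev_cons /pd foldr_rcons.
Qed.

Lemma pd_convol l rho g : Ccinf rho -> locint g ->
  pd l (convol rho g) = convol (pd l rho) g.
Proof.
move=> Cr lg; elim: l => //= i l ->; apply: partial_convol => //.
exact: Ccinf_pd.
Qed.

Lemma convolC rho g : measurable_fun setT rho -> measurable_fun setT g ->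
  convol rho g = convol g rho.
Proof.
move=> mr mg; apply/funext => x; rewrite /convol.
have ms := (mpres_rV_subl x).1.
rewrite -[RHS](Rintegral_mpres (mpres_rV_subl x)); last first.
  by apply: measurable_funM => //; exact: measurableT_comp mg ms.
apply: eq_Rintegral => y _; rewrite mulrC; congr (g _ * _).
by rewrite opprB addrC subrK.
Qed.

Lemma measurable_subr_pair :
  measurable_fun setT (fun z : 'rV[R]_n * 'rV[R]_n => z.1 - z.2).
Proof.
apply: measurable_fun_rV => i.
rewrite (_ : _ \o _ = fun z : 'rV[R]_n * 'rV[R]_n =>
  rV_coord i z.1 - rV_coord i z.2); last first.
  by apply/funext => z; rewrite /rV_coord /= !mxE.
by apply: measurable_funB; apply: measurableT_comp => //; exact: measurable_rV_coord.
Qed.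

(** Fubini for [rho (x - y) * f y * g x], which is integrable because [rho] is bounded; evenness of
    [rho] exchanges the roles of the two variables. It moves a mollifier from a density to the test
    function. *)
Lemma convol_adjoint rho f g : continuous rho -> Cc rho ->
  (forall x, rho (- x) = rho x) ->
  mu.-integrable setT (EFin \o f) -> mu.-integrable setT (EFin \o g) ->
  \int[mu]_x (convol rho f x * g x) = \int[mu]_x (f x * convol rho g x).
Proof.
move=> cr Cr re intf intg.
have [M M0 rM] := Cc_bounded cr Cr.
have mf : measurable_fun setT f by have /integrableP[/measurable_EFinP] := intf.
have mg : measurable_fun setT g by have /integrableP[/measurable_EFinP] := intg.
pose F (z : 'rV[R]_n * 'rV[R]_n) := rho (z.1 - z.2) * f z.2 * g z.1.
have mF : measurable_fun setT F.
  apply: measurable_funM; last exact: measurableT_comp.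
  apply: measurable_funM; last exact: measurableT_comp.
  exact: (measurableT_comp (continuous_measurable_rV cr) measurable_subr_pair).
have iF : (lebesgue_rV n \x lebesgue_rV n)%E.-integrable setT (EFin \o F).
  apply/integrable12ltyP; first exact/measurable_EFinP.
  pose A := (\int[mu]_y `|f y|%:E)%E.
  have Aoo : (A < +oo)%E by have /integrableP[] := intf.
  have A0 : (0 <= A)%E by apply: integral_ge0 => y _; rewrite lee_fin.
  have mnf : measurable_fun setT (fun y => `|f y|%:E) by apply/measurable_EFinP;
    exact: measurableT_comp.
  have mng : measurable_fun setT (fun y => `|g y|%:E) by apply/measurable_EFinP;
    exact: measurableT_comp.
  apply: (@le_lt_trans _ _ (\int[mu]_x ((M%:E * A) * `|g x|%:E))%E); last first.
    rewrite ge0_integralZl //; last by rewrite mule_ge0 // lee_fin.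
    apply: lte_mul_pinfty => //.
    - by rewrite mule_ge0 // lee_fin.
    - by rewrite fin_numM // ge0_fin_numE.
    - by have /integrableP[] := intg.
  apply: ge0_le_integral => //.
  - by move=> x _; apply: integral_ge0.
  - have mE : measurable_fun setT (abse \o (EFin \o F)).
      by apply: measurableT_comp => //; exact/measurable_EFinP.
    exact (measurable_fun_fubini_tonelli_F (m2 := lebesgue_rV n) _ mE (fun z =>
      abse_ge0 _)).
  - exact: measurable_funeM.
  - move=> x _.
    apply: (@le_trans _ _ (\int[mu]_y ((M * `|g x|)%:E * `|f y|%:E))%E).
      apply: ge0_le_integral => //.
      - apply: measurableT_comp => //; apply/measurable_EFinP.
        exact: (measurableT_comp mF (pair1_measurable x)).
      - exact: measurable_funeM.
      - move=> y _; rewrite /= -EFinM lee_fin !normrM mulrAC.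
        by rewrite ler_wpM2r // ler_wpM2r.
    rewrite ge0_integralZl //; last by rewrite lee_fin mulr_ge0.
    by rewrite EFinM muleAC.
have i1 x : mu.-integrable setT (EFin \o (fun y => rho (x - y) * f y)).
  exact: convol_integrable (locint_integrable intf).
have i2 x : mu.-integrable setT (EFin \o (fun y => rho (x - y) * g y)).
  exact: convol_integrable (locint_integrable intg).
rewrite /Rintegral; congr fine.
transitivity (\int[mu]_x \int[mu]_y (EFin \o F) (x, y))%E.
  apply: eq_integral => x _; rewrite EFinM /convol /Rintegral fineK; last first.
    exact: integrable_fin_num (i1 x).
  rewrite muleC -(integralZl measurableT (i1 x) (g x)); apply: eq_integral => y _.
  by rewrite /= -EFinM mulrC.
rewrite (Fubini (m1 := lebesgue_rV n) (m2 := lebesgue_rV n) iF).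
apply: eq_integral => y _; rewrite EFinM /convol /Rintegral fineK; last first.
  exact: integrable_fin_num (i2 y).
rewrite -(integralZl measurableT (i2 y) (f y)); apply: eq_integral => x _.
by rewrite /= -EFinM /F -[x - y]opprB re; congr _%:E; ring.
Qed.

Lemma convol_neq0 rho g d x : (forall y, d < `|y| -> rho y = 0) ->
  convol rho g x != 0 ->
  exists2 y, g y != 0 & `|x - y| <= d.
Proof.
move=> rd; apply: contra_neqP => h.
rewrite /convol (_ : (fun y => _) = cst 0); first by rewrite Rintegral_cst // mul0r.
apply/funext => y /=; have [xy|xy] := leP `|x - y| d; last by rewrite rd ?mul0r.
have [->|gy] := eqVneq (g y) 0; first by rewrite mulr0.
by exfalso; apply: h; exists y.
Qed.

(** Evenness is included for the sake of [convol_adjoint]. *)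
Definition mollifier (d : R) rho := [/\ Ccinf rho, forall x, 0 <= rho x,
  forall x, rho (- x) = rho x, (\int[mu]_x (rho x)%:E = 1)%E &
  forall x, d < `|x| -> rho x = 0].

Lemma mollifier_exists (d : R) : 0 < d -> exists rho, mollifier d rho.
Proof.
move=> d0.
have Cb : Ccinf (@bumpf R n d).
  by split; [exact: smooth_bumpf|exists d => x; exact: bumpf_eq0].
have ib := Ccinf_integrable Cb.
pose I : \bar R := (\int[mu]_x (bumpf d x)%:E)%E.
have Ifin : I \is a fin_num by exact: integrable_fin_num ib.
have mb : measurable_fun setT (fun x : 'rV[R]_n => (bumpf d x)%:E).
  by apply/measurable_EFinP; exact: continuous_measurable_rV (Ccinf_continuous Cb).
have I0 : (0 < I)%E.
  have [c c0 cb] := @bumpf_lb R n d d0.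
  pose r := d / 2; have r0 : 0 < r by rewrite divr_gt0.
  apply: (@lt_le_trans _ _ (\int[mu]_(x in B r) c%:E)%E).
    rewrite integral_cst //; last exact: measurable_rV_ball.
    by rewrite [X in (_ * X)%E](lebesgue_rV_ball _ (ltW r0)) -EFinM lte_fin mulr_gt0 //
      exprn_gt0 // mulrn_wgt0.
  apply: (@le_trans _ _ (\int[mu]_(x in B r) (bumpf d x)%:E)%E).
    apply: ge0_le_integral => //; first exact: measurable_rV_ball.
    - by move=> x _; rewrite lee_fin ltW.
    - exact: measurable_funTS.
  apply: ge0_subset_integral => //; first exact: measurable_rV_ball.
  by move=> x _; rewrite lee_fin bumpf_ge0.
pose c := (fine I)^-1.
have c0 : 0 < c by rewrite invr_gt0 fine_gt0 // I0 /= -ge0_fin_numE // ltW.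
exists (fun x => c * bumpf d x); split.
- rewrite (_ : (fun x => _) = fun x => bumpf d x * c); last by apply/funext => x;
  rewrite mulrC.
  by apply: CcinfM => //; exact: smooth_cst.
- by move=> x; rewrite mulr_ge0 ?bumpf_ge0 // ltW.
- by move=> x; rewrite bumpfN.
- rewrite (eq_integral (fun x => c%:E * (bumpf d x)%:E)%E) // ge0_integralZl //.
  + by rewrite -/I -(fineK Ifin) -EFinM mulVf // gt_eqF // -invr_gt0.
  + by move=> x _; rewrite lee_fin bumpf_ge0.
  + by rewrite lee_fin ltW.
- by move=> x dx; rewrite bumpf_eq0 // mulr0.
Qed.

Lemma closure_dist (A : set 'rV[R]_n) x d : 0 < d -> closure A x ->
  exists2 y, A y & `|x - y| < d.
Proof.
move=> d0 /(_ _ (nbhsx_ballx x d d0)) [y [Ay xy]]; exists y => //.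
by move: xy; rewrite -ball_normE.
Qed.

(** Where [f] is nonzero the distance to [K] is at most [d]. Passing to the closure costs at most
    another [d], hence the margin [2 * d]. *)
Lemma is_testfun_near (Omega K : set 'rV[R]_n) f d : compact K -> 0 < d ->
  (forall h, `|h| <= 2 * d -> forall x, K x -> Omega (x + h)) ->
  smooth f -> (forall x, f x != 0 -> exists2 y, K y & `|x - y| <= d) ->
  f \in is_testfun Omega.
Proof.
move=> cK d0 KO sf fK.
have [M [_ KM]] := compact_bounded cK.
have {}KM x : K x -> `|x| <= `|M| + 1.
  by move=> Kx; apply: KM => //; rewrite (le_lt_trans (ler_norm M)) // ltrDl.
have clK x : fsupport f x -> exists2 y, K y & `|x - y| <= 2 * d.
  move=> /(closure_dist d0)[y /= fy xy]; have [z Kz yz] := fK y fy.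
  exists z => //; rewrite (_ : x - z = (x - y) + (y - z)); last by rewrite addrA subrK.
  by rewrite (le_trans (ler_normD _ _)) // mulr_natl mulr2n lerD // ltW.
rewrite inE; split=> //.
- apply: (@subclosed_compact _ _ (B (`|M| + 1 + 2 * d))).
  + exact: closed_closure.
  + exact: compact_closed_ball.
  move=> x /clK[y Ky xy] /=; rewrite -[x](subrK y) addrC.
  by rewrite (le_trans (ler_normD _ _)) // lerD // KM.
- move=> x /clK[y Ky xy]; have := KO _ xy _ Ky.
  by rewrite addrC subrK.
Qed.

Lemma testfun_Ccinf (Omega : set 'rV[R]_n) (phi : testfun Omega) : Ccinf phi.
Proof.
have [sf cf _] := set_mem (testfunP phi); split=> //.
have [M [_ KM]] := compact_bounded cf.
exists (`|M| + 1) => x Mx; apply/eqP/negPn/negP => fx.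
have : `|x| <= `|M| + 1.
  apply: KM; last exact: subset_closure.
  by rewrite (le_lt_trans (ler_norm M)) // ltrDl.
by rewrite leNgt Mx.
Qed.

Lemma compact_margin (Omega K : set 'rV[R]_n) : compact K -> open Omega ->
  K `<=` Omega ->
  exists2 d : R, 0 < d & forall h, `|h| <= d -> forall x, K x -> Omega (x + h).
Proof.
move=> cK oO KO.
have /nbhs_ballP[e /= e0 h] := compact_add_open cK oO KO.
exists (e / 2); first by rewrite divr_gt0.
move=> z ze x Kx; apply: h => //; rewrite -ball_normE /= sub0r normrN.
by rewrite (le_lt_trans ze) // ltr_pdivrMr // ltr_pMr // ltr1n.
Qed.

(** Mollify the indicator of the [2 * e]-neighbourhood of [K] at scale [e]. The value 1 is reached
    on an open neighbourhood of [K], so that derivatives are unaffected there by the cutoff. *)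
Lemma cutoff_exists (Omega K : set 'rV[R]_n) : compact K -> open Omega ->
  K `<=` Omega ->
  exists chi : testfun Omega, (forall x, 0 <= chi x <= 1) /\
    exists U, [/\ open U, K `<=` U & forall x, U x -> chi x = 1].
Proof.
move=> cK oO KO; have [d d0 dO] := compact_margin cK oO KO.
(* The result is supported within [3 * e] of [K], and [is_testfun_near] asks for twice that
   distance. *)
pose e := d / 6; have e0 : 0 < e by rewrite divr_gt0.
have [rho [Cr r0 re r1 rd]] := mollifier_exists e0.
pose A := \bigcup_(y in K) ball y (2 * e).
have oA : open A by apply: bigcup_open => y _; apply: ball_open; rewrite mulr_gt0.
have mA : measurable A by exact: open_measurable_rV.
have mI : measurable_fun setT (\1_A : 'rV[R]_n -> R) by exact: measurable_indic.
have lI : locint (\1_A : 'rV[R]_n -> R).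
  split=> // r; apply: le_integrable ((locint_cst 1).2 r) => //;
    first exact: measurable_rV_ball.
    by apply/measurable_EFinP; exact: measurable_funTS.
  by move=> x _ /=; rewrite lee_fin indicE; case: (x \in A); rewrite ?normr1 ?normr0.
have irho x : mu.-integrable setT (EFin \o (fun y => rho (x - y))).
  exact: (integrable_mpres (mpres_rV_subl x) (Ccinf_integrable Cr)).
have rho1 x : \int[mu]_y rho (x - y) = 1.
  rewrite (Rintegral_mpres (mpres_rV_subl x)) /Rintegral ?r1 //.
  exact: continuous_measurable_rV (Ccinf_continuous Cr).
have ci x : mu.-integrable setT (EFin \o (fun y => rho (x - y) * \1_A y)).
  exact: convol_integrable (Ccinf_continuous Cr) Cr.2 lI.
have tf : convol rho (\1_A) \in is_testfun Omega.
  apply: (@is_testfun_near _ K _ (3 * e)) => //.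
  - by rewrite mulr_gt0.
  - by move=> h he; apply: dO; rewrite (le_trans he) // /e; lra.
  - exact: smooth_convol.
  - move=> x /(convol_neq0 rd)[y];
    rewrite indicE pnatr_eq0 eqb0 negbK => /set_mem[z Kz].
    rewrite -ball_normE /= => zy xy; exists z => //.
    rewrite (_ : x - z = (x - y) - (z - y)); last by rewrite opprB addrA subrK.
    rewrite (le_trans (ler_normB _ _)) // (_ : 3 * e = e + 2 * e); last by ring.
    by rewrite lerD // ltW.
exists (Testfun tf); split=> [x|].
  apply/andP; split=> /=.
    by apply: Rintegral_ge0 => y _; rewrite mulr_ge0 // indicE.
  rewrite -(rho1 x); apply: le_Rintegral => //.
  by move=> y _; rewrite indicE; case: (y \in A); rewrite ?mulr1 ?mulr0.
exists (\bigcup_(y in K) ball y e); split.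
- by apply: bigcup_open => y _; apply: ball_open.
- by move=> y Ky; exists y => //; exact: ballxx.
- move=> x [z Kz]; rewrite -ball_normE /= => zx.
  rewrite -(rho1 x); apply: eq_Rintegral => y _; rewrite indicE.
  have [xy|xy] := leP `|x - y| e; last by rewrite rd // mul0r.
  rewrite mem_set ?mulr1 //; exists z => //; rewrite -ball_normE /=.
  rewrite (_ : z - y = (z - x) + (x - y)); last by rewrite addrA subrK.
  by rewrite (le_lt_trans (ler_normD _ _)) // mulr_natl mulr2n ltr_leD.
Qed.

End convolution.

(** * Integrals of p-th powers and mollification in L^p *)

Section powint.
Context d (T : measurableType d) (R : realType).
Variable m : {measure set T -> \bar R}.
Implicit Types (f g : T -> R) (p : R).

(** The L^p norm without its root. Instead of Minkowski's inequality, sums are estimated with the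
    factor [2 ^ p] of [powintD]. *)
Definition powint p f := (\int[m]_x (`|f x| `^ p)%:E)%E.

Lemma measurable_powint p f : measurable_fun setT f ->
  measurable_fun setT (fun x => (`|f x| `^ p)%:E).
Proof.
move=> mf; apply/measurable_EFinP; apply: measurable_fun_powRr.
exact: measurableT_comp.
Qed.

Lemma powint_ge0 p f : (0 <= powint p f)%E.
Proof. by apply: integral_ge0 => x _; rewrite lee_fin powR_ge0. Qed.

Lemma le_powint p f g : 0 <= p -> measurable_fun setT f -> measurable_fun setT g ->
  (forall x, `|f x| <= `|g x|) -> (powint p f <= powint p g)%E.
Proof.
move=> p0 mf mg fg; apply: ge0_le_integral => //.
- exact: measurable_powint.
- exact: measurable_powint.
- by move=> x _; rewrite lee_fin powR_le.
Qed.

Lemma powintD p f g : 0 <= p -> measurable_fun setT f -> measurable_fun setT g ->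
  (powint p (fun x => (f x + g x)%R) <= (2 `^ p)%:E * (powint p f + powint p g))%E.
Proof.
move=> p0 mf mg.
have mfp := measurable_powint p mf; have mgp := measurable_powint p mg.
have k0 : (0 <= (2 `^ p : R)%:E)%E by rewrite lee_fin powR_ge0.
have -> : ((2 `^ p)%:E * (powint p f + powint p g) =
    \int[m]_x ((2 `^ p)%:E * ((`|f x| `^ p)%:E + (`|g x| `^ p)%:E)))%E.
  rewrite ge0_integralZl //; last 2 first.
  - exact: emeasurable_funD.
  - by move=> x _; rewrite -EFinD lee_fin addr_ge0 ?powR_ge0.
  by rewrite ge0_integralD // => x _; rewrite lee_fin powR_ge0.
apply: ge0_le_integral => //.
- by apply: measurable_powint; exact: measurable_funD.
- by apply: measurable_funeM; exact: emeasurable_funD.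
- move=> x _; rewrite -EFinD -EFinM lee_fin (le_trans _ (ler_powRD _ _ _)) //.
  by apply: powR_le => //; exact: ler_normD.
Qed.

Lemma powintZ p c f : measurable_fun setT f ->
  (powint p (fun x => (c * f x)%R) = (`|c| `^ p)%:E * powint p f)%E.
Proof.
move=> mf; rewrite /powint -ge0_integralZl //.
- by apply: eq_integral => x _; rewrite normrM powRM // EFinM.
- exact: measurable_powint.
Qed.

Lemma powintN p f : powint p (fun x => - f x) = powint p f.
Proof. by apply: eq_integral => x _; rewrite normrN. Qed.

Lemma powintD_lty p f g : 0 <= p -> measurable_fun setT f -> measurable_fun setT g ->
  (powint p f < +oo -> powint p g < +oo -> powint p (fun x => (f x + g x)%R) < +oo)%E.
Proof.
move=> p0 mf mg foo goo; rewrite (le_lt_trans (powintD p0 mf mg)) //.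
by rewrite lte_mul_pinfty ?lee_fin ?powR_ge0 // lte_add_pinfty.
Qed.

Lemma powint_abs_integrable p f : measurable_fun setT f -> (powint p f < +oo)%E ->
  m.-integrable setT (EFin \o (fun x => `|f x| `^ p)).
Proof.
move=> mf foo; apply/integrableP; split; first exact: measurable_powint.
by rewrite (eq_integral (fun x => (`|f x| `^ p)%:E)) // => x _ /=;
  rewrite ger0_norm ?powR_ge0.
Qed.

End powint.

Section mollification_rV.
Context {R : realType} {n : nat}.
Local Notation mu := (lebesgue_rV n : {measure set 'rV[R]_n -> \bar R}).
Local Notation mu2 := ((lebesgue_rV n \x lebesgue_rV n)%E : {measure set ('rV[R]_n *
  'rV[R]_n)%type -> \bar R}).
Local Notation B r := [set x : 'rV[R]_n | `|x| <= r].
Implicit Types (f g rho : 'rV[R]_n -> R) (p : R).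

Lemma powint_locint p f : 1 <= p -> measurable_fun setT f -> (powint mu p f < +oo)%E ->
  locint f.
Proof.
move=> p1 mf foo; split=> // r.
have i1 := (locint_cst 1).2 r : mu.-integrable (B r) (EFin \o (fun=> 1)).
have i2 := integrableS measurableT (measurable_rV_ball r) (@subsetT _ _)
  (powint_abs_integrable mf foo).
apply: le_integrable (integrableD (measurable_rV_ball r) i1 i2) => //.
- exact: measurable_rV_ball.
- by apply/measurable_EFinP; exact: measurable_funTS.
- move=> x _ /=; rewrite lee_fin [leRHS]ger0_norm ?addr_ge0 ?powR_ge0 //.
  exact: le1D_powR.
Qed.

Lemma mollifierW d d' rho : d <= d' -> mollifier d rho -> mollifier d' rho.
Proof.
move=> dd' [C r0 re r1 rd]; split=> // x d'x; apply: rd.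
exact: le_lt_trans d'x.
Qed.

Lemma lcont_oppr_rV : lcont (lebesgue_rV n) (nbhs (0 : 'rV[R]_n)) (fun h (x : 'rV[R]_n)
  => x - h).
Proof.
apply: (lcont_rV (h := fun h : 'rV[R]_n => - h)) => i.
have c : (fun y : 'rV[R]_n => y ord0 i) @ (0 : 'rV[R]_n) --> (0 : R).
  have := @coord_continuous R 1 n ord0 i (0 : 'rV[R]_n).
  by rewrite /continuous_at mxE.
rewrite -[X in _ --> X]oppr0; apply: cvg_trans (cvgN c).
by apply: near_eq_cvg; near=> y; rewrite mxE.
Unshelve. all: by end_near. Qed.

Lemma mpres_rV_subr (h : 'rV[R]_n) : mpres (lebesgue_rV n) (fun x : 'rV[R]_n => x - h).
Proof. exact: mpres_rV_addr. Qed.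

Lemma near0_ball (P : 'rV[R]_n -> Prop) : (\forall h \near (0 : 'rV[R]_n), P h) ->
  exists2 d : R, 0 < d & forall h, `|h| <= d -> P h.
Proof.
move=> /nbhs_ballP[e /= e0 h]; exists (e / 2); first by rewrite divr_gt0.
move=> z ze; apply: h => //; rewrite -ball_normE /= sub0r normrN.
by rewrite (le_lt_trans ze) // ltr_pdivrMr // ltr_pMr // ltr1n.
Qed.

Lemma convolE rho f x : measurable_fun setT rho -> measurable_fun setT f ->
  convol rho f x = \int[mu]_h (rho h * f (x - h)).
Proof.
move=> mr mf; rewrite convolC //.
by apply: eq_Rintegral => h _; rewrite mulrC.
Qed.

Lemma mollify_rV p f (e : R) : 1 < p -> measurable_fun setT f ->
  (powint mu p f < +oo)%E -> 0 < e ->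
  exists2 d : R, 0 < d & forall rho, mollifier d rho ->
    (powint mu p (fun x => (convol rho f x - f x)%R) <= e%:E)%E.
Proof.
move=> p1 mf foo e0.
have := Lp_continuity (nbhs_filter (0 : 'rV[R]_n)) mpres_rV_subr lcont_oppr_rV (ltW p1)
  mf foo e0.
move=> /near0_ball[d d0 dP]; exists d => // rho [Cr r0 re r1 rd].
have mr := continuous_measurable_rV (Ccinf_continuous Cr).
have lf := powint_locint (ltW p1) mf foo.
apply: (@mollify_Lp _ _ _ _ R (lebesgue_rV n) (lebesgue_rV n) (fun h x =>
  x - h) (B d) p f (convol rho f) rho e) => //.
- exact: measurable_subr_pair.
- exact: continuous_measurable_rV (smooth_continuous (smooth_convol Cr lf)).
- by move=> h /negP; rewrite -ltNge; exact: rd.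
- exact: ltW.
- by move=> x; rewrite convolE.
Qed.

Lemma convol_shift_integrable rho f x : Ccinf rho -> locint f ->
  mu.-integrable setT (EFin \o (fun h => rho h * f (x - h))).
Proof.
move=> Cr lf.
have := integrable_mpres (mpres_rV_subl x) (convol_integrable x (Ccinf_continuous Cr)
  Cr.2 lf).
apply: eq_integrable => // h _ /=; congr (_ * _)%:E; congr (rho _).
by rewrite opprB addrC subrK.
Qed.

(** Shifting both points by the same [h] leaves [z.1 - z.2], and with it the weight, unchanged. The
    weighted difference of [convol rho f] is therefore the [rho]-average of the shifts of the
    weighted difference of [f], and averaging applies on pairs of points. *)
Lemma mollify_rV2 p f (k : 'rV[R]_n -> R) (e : R) : 1 < p -> measurable_fun setT f ->
  measurable_fun setT k -> (powint mu p f < +oo)%E ->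
  (powint mu2 p (fun z => ((f z.1 - f z.2) * k (z.1 - z.2))%R) < +oo)%E -> 0 < e ->
  exists2 d : R, 0 < d & forall rho, mollifier d rho ->
    (powint mu2 p (fun z =>
      ((convol rho f z.1 - f z.1 - (convol rho f z.2 - f z.2)) * k (z.1 - z.2))%R) <=
      e%:E)%E.
Proof.
move=> p1 mf mk foo Foo e0.
set F := fun z : 'rV[R]_n * 'rV[R]_n => (f z.1 - f z.2) * k (z.1 - z.2).
have mkd : measurable_fun setT (fun z : 'rV[R]_n * 'rV[R]_n => k (z.1 - z.2)).
  exact: measurableT_comp mk measurable_subr_pair.
have mF : measurable_fun setT F.
  by apply: measurable_funM => //; apply: measurable_funB; exact: measurableT_comp.
pose s (h : 'rV[R]_n) (z : 'rV[R]_n * 'rV[R]_n) := (z.1 - h, z.2 - h).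
have mps h : mpres (lebesgue_rV n \x lebesgue_rV n)%E (s h).
  exact: (mpres_prod (mpres_rV_subr h) (mpres_rV_subr h)).
have ls : lcont (lebesgue_rV n \x lebesgue_rV n)%E (nbhs (0 : 'rV[R]_n)) s.
  exact: (lcont_prod (nbhs_filter _) mpres_rV_subr mpres_rV_subr lcont_oppr_rV
    lcont_oppr_rV).
have := Lp_continuity_prod (nbhs_filter (0 : 'rV[R]_n)) mps ls (ltW p1) mF Foo e0.
move=> /near0_ball[d d0 dP]; exists d => // rho [Cr r0 re r1 rd].
have mr := continuous_measurable_rV (Ccinf_continuous Cr).
have lf := powint_locint (ltW p1) mf foo.
have mc : measurable_fun setT (convol rho f).
  exact: continuous_measurable_rV (smooth_continuous (smooth_convol Cr lf)).
pose G (z : 'rV[R]_n * 'rV[R]_n) := (convol rho f z.1 - convol rho f z.2) * k (z.1 -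
  z.2).
have -> : powint mu2 p (fun z =>
  ((convol rho f z.1 - f z.1 - (convol rho f z.2 - f z.2)) * k (z.1 - z.2))%R) =
    powint mu2 p (fun z => G z - F z)%R.
  by apply: eq_integral => z _; congr (_ `^ _)%:E; congr `|_|; rewrite /G /F; ring.
apply: (mollify_Lp_prod (mu := lebesgue_rV n) (s := s) (D := B d) (rho := rho)) => //.
- pose X := ('rV[R]_n * 'rV[R]_n * 'rV[R]_n)%type.
  have mfst : measurable_fun setT (fun z : X => (z.1.1, z.2)).
    apply/measurable_fun_pairP; split; last exact: measurable_snd.
    exact: (measurableT_comp measurable_fst measurable_fst).
  have msnd : measurable_fun setT (fun z : X => (z.1.2, z.2)).
    apply/measurable_fun_pairP; split; last exact: measurable_snd.
    exact: (measurableT_comp measurable_snd measurable_fst).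
  apply/measurable_fun_pairP; split.
    exact: (measurableT_comp measurable_subr_pair mfst).
  exact: (measurableT_comp measurable_subr_pair msnd).
- by apply: measurable_funM => //; apply: measurable_funB; exact: measurableT_comp.
- by move=> h /negP; rewrite -ltNge; exact: rd.
- exact: ltW.
- move=> z; rewrite /G !convolE //.
  have i1 := convol_shift_integrable z.1 Cr lf;
    have i2 := convol_shift_integrable z.2 Cr lf.
  rewrite -RintegralB // -RintegralZr //; last exact: integrable_subr.
  apply: eq_Rintegral => h _; rewrite /F /s /=.
  by rewrite opprB addrA subrK; ring.
Qed.

End mollification_rV.

(** * The Slobodeckij kernel *)

Section kernel.
Context {R : realType} {n : nat}.
Local Notation mu := (lebesgue_rV n : {measure set 'rV[R]_n -> \bar R}).
Local Notation mu2 := ((lebesgue_rV n \x lebesgue_rV n)%E : {measure set ('rV[R]_n *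
  'rV[R]_n)%type -> \bar R}).
Implicit Types (f g chi : 'rV[R]_n -> R) (p a r : R) (z : 'rV[R]_n * 'rV[R]_n).

Lemma dyadic_ge1 r : 1 <= r -> exists j, 2 ^+ j <= r < 2 ^+ j.+1.
Proof.
move=> r1; have r0 : 0 <= r by lra.
have m0 : (0 < Num.truncn r)%N by rewrite truncn_gt0.
have /andP[mr rm] := truncn_itv r0.
exists (trunc_log 2 (Num.truncn r)); apply/andP; split.
  by apply: le_trans mr; rewrite -natrX ler_nat trunc_logP.
apply: lt_le_trans rm _.
by rewrite -natrX ler_nat trunc_log_ltn.
Qed.

Lemma geometric_nneseries_lty (C q : R) : 0 <= C -> 0 <= q -> q < 1 ->
  (\sum_(0 <= j <oo) (C * q ^+ j)%:E < +oo)%E.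
Proof.
move=> C0 q0 q1.
have t0 j : (0 <= (C * q ^+ j)%:E)%E by rewrite lee_fin mulr_ge0 // exprn_ge0.
apply: (@le_lt_trans _ _ (C / (1 - q))%:E); last exact: ltry.
apply: lime_le; first by apply: is_cvg_nneseries => j _ _.
apply: nearW => N; rewrite sumEFin lee_fin.
have q1' : 1 - q != 0 by rewrite subr_eq0 eq_sym lt_eqF.
have -> : \sum_(0 <= i < N) C * q ^+ i = C * (1 - q ^+ N) / (1 - q).
  by rewrite -[LHS]/(series (geometric C q) N) geometric_seriesE // lt_eqF.
rewrite ler_pM2r ?invr_gt0 ?subr_gt0 // ler_piMr // gerBl exprn_ge0 //.
Qed.

Lemma euclidean_norm_ge (x : 'rV[R]_n) : `|x| <= euclidean_norm x.
Proof.
apply/rV_normP; first exact: sqrtr_ge0.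
move=> i; rewrite -sqrtr_sqr ler_sqrt; last by apply: sumr_ge0 => j _; rewrite sqr_ge0.
by rewrite (bigD1 i) //= lerDl; apply: sumr_ge0 => j _; rewrite sqr_ge0.
Qed.

(** For [a = n / p + theta] its p-th power is the weight of the Slobodeckij seminorm. At the origin
    it is 0 for [a != 0], by the convention for powers of 0. *)
Definition kern a (x : 'rV[R]_n) : R := euclidean_norm x `^ (- a).

Lemma kern_ge0 a x : 0 <= kern a x. Proof. exact: powR_ge0. Qed.

Lemma euclidean_norm0 : euclidean_norm (0 : 'rV[R]_n) = 0.
Proof.
rewrite /euclidean_norm big1 ?sqrtr0 // => i _.
by rewrite mxE expr0n.
Qed.

Lemma euclidean_normN x : euclidean_norm (- x : 'rV[R]_n) = euclidean_norm x.
Proof.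
by congr Num.sqrt; apply: eq_bigr => i _; rewrite mxE sqrrN.
Qed.

Lemma kernN a x : kern a (- x) = kern a x.
Proof. by rewrite /kern euclidean_normN. Qed.

Lemma kern_le a x : 0 < a -> kern a x <= `|x| `^ (- a).
Proof.
move=> a0; have [->|x0] := eqVneq x 0; first by rewrite /kern euclidean_norm0 normr0.
have nx : 0 < `|x| by rewrite normr_gt0.
have ex := lt_le_trans nx (euclidean_norm_ge x).
rewrite /kern !powRN lef_pV2 ?posrE ?powR_gt0 //.
by rewrite powR_le // ?euclidean_norm_ge // ltW.
Qed.

Lemma kern_powR a p x : kern a x `^ p = kern (a * p) x.
Proof. by rewrite /kern -powRrM mulNr. Qed.

Lemma measurable_kern a : measurable_fun setT (kern a).
Proof.
apply: measurable_fun_powRr; apply: measurableT_comp => //.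
  exact: (continuous_measurable_fun (@sqrt_continuous R)).
apply: measurable_sum => i; apply: measurable_funX.
exact: measurable_rV_coord.
Qed.

(** Dyadic shells: inside the unit ball their contributions decay with ratio
    [q1 = 2 ^ (alpha - n - p)], outside it with ratio [q2 = 2 ^ (n - alpha)]. The two conditions on
    [alpha] say that both ratios are below 1. *)
Lemma kernel_shells_lty p (alpha : R) : 0 < p -> n%:R < alpha -> alpha < n%:R + p ->
  (\int[mu]_h ((Num.min 1 `|h|) `^ p * `|h| `^ (- alpha))%:E < +oo)%E.
Proof.
move=> p0 na anp.
have a0 : 0 < alpha by apply: le_lt_trans na; rewrite ler0n.
pose B r : set 'rV[R]_n := [set x | `|x| <= r].
have mB r : measurable (B r) by exact: measurable_rV_ball.
pose q1 : R := 2 `^ (alpha - n%:R - p).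
pose q2 : R := 2 `^ (n%:R - alpha).
(* Bounds for the integrand where [2 ^ -(j + 1) < |h| <= 2 ^ -j], respectively
   [2 ^ j <= |h| < 2 ^ (j + 1)]. Each shell is enlarged to the ball containing it, whose volume is
   known. *)
pose c1 j : R := (2 ^- j) `^ p * (2 ^+ j.+1) `^ alpha.
pose c2 j : R := (2 ^+ j) `^ (- alpha).
pose t1 j h : \bar R := ((c1 j)%:E * (\1_(B (2 ^- j)) h)%:E)%E.
pose t2 j h : \bar R := ((c2 j)%:E * (\1_(B (2 ^+ j.+1)) h)%:E)%E.
have c10 j : 0 <= c1 j by rewrite mulr_ge0 ?powR_ge0.
have c20 j : 0 <= c2 j by rewrite powR_ge0.
have t10 j h : (0 <= t1 j h)%E by rewrite mule_ge0 ?lee_fin.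
have t20 j h : (0 <= t2 j h)%E by rewrite mule_ge0 ?lee_fin.
have mt1 j : measurable_fun setT (t1 j).
  by apply: measurable_funeM; apply/measurable_EFinP; exact: measurable_indic.
have mt2 j : measurable_fun setT (t2 j).
  by apply: measurable_funeM; apply/measurable_EFinP; exact: measurable_indic.
have mI (r : R) : measurable_fun [set: 'rV[R]_n] (fun h => (\1_(B r) h)%:E).
  by apply/measurable_EFinP; exact: measurable_indic.
have iB (c r : R) : 0 <= c -> 0 <= r ->
    (\int[mu]_h (c%:E * (\1_(B r) h)%:E) = (c * (2 * r) ^+ n)%:E)%E.
  move=> cc0 r0; rewrite ge0_integralZl ?lee_fin //.
  - rewrite integral_indic // setIT EFinM; congr (_ * _)%E.
    by rewrite mulr_natl -lebesgue_rV_ball.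
have E0 (x y : R) j : 0 <= x -> (x ^+ j) `^ y = (x `^ y) ^+ j.
  by move=> x0; rewrite -(powR_mulrn j x0) -(powR_mulrn j (powR_ge0 x y)) -!powRrM
    mulrC.
have two0 : (2 : R) != 0 by rewrite pnatr_eq0.
have two0' : 0 <= (2 : R) by rewrite ler0n.
have twop : 0 < (2 : R) by rewrite ltr0n.
have i1 j : (\int[mu]_h t1 j h <= ((2 `^ alpha * 2 ^+ n) * q1 ^+ j)%:E)%E.
  rewrite /t1 iB // ?invr_ge0 ?exprn_ge0 //.
  rewrite lee_fin le_eqVlt; apply/orP; left; apply/eqP.
  rewrite /c1 /q1 powRD ?two0 ?implybT // powRD ?two0 ?implybT // !powRN !powR_mulrn //.
  have -> : (2 ^- j) `^ p = (2 `^ p) ^- j.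
    by rewrite -(E0 2) // -powR_inv1 ?exprn_ge0 // -powRrM mulN1r powRN.
  have -> : (2 / 2 ^+ j) ^+ n = 2 ^+ n / (2 ^+ n) ^+ j :> R.
    by rewrite expr_div_n -!exprM mulnC.
  rewrite (E0 2) // exprS !exprMn !exprVn.
  by move: ((2 `^ p) ^+ j)^-1 ((2 ^+ n) ^+ j)^-1 ((2 `^ alpha) ^+ j) => x y A; ring.
have i2 j : (\int[mu]_h t2 j h <= ((2 ^+ n * 2 ^+ n) * q2 ^+ j)%:E)%E.
  rewrite /t2 iB // ?exprn_ge0 //.
  rewrite lee_fin le_eqVlt; apply/orP; left; apply/eqP.
  rewrite /c2 /q2 powRD ?two0 ?implybT // !powRN !powR_mulrn //.
  have -> : (2 * 2 ^+ j.+1) ^+ n = 2 ^+ n * 2 ^+ n * (2 ^+ n) ^+ j :> R.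
    by rewrite exprS !exprMn -!exprM mulnC mulrA.
  rewrite (E0 2) // !exprMn exprVn.
  by move: ((2 `^ alpha) ^+ j)^-1 ((2 ^+ n : R) ^+ j) (2 ^+ n : R) => x y A; ring.
have le h : (((Num.min 1 `|h|) `^ p * `|h| `^ (- alpha))%:E <=
   (\sum_(0 <= j <oo) t1 j h) + (\sum_(0 <= j <oo) t2 j h))%E.
  have s10 : (0 <= \sum_(0 <= j <oo) t1 j h)%E by exact: nneseries_ge0.
  have s20 : (0 <= \sum_(0 <= j <oo) t2 j h)%E by exact: nneseries_ge0.
  have [h0|h0] := eqVneq h 0.
    rewrite (_ : _ * _ = 0) ?adde_ge0 // h0 normr0.
    by rewrite [X in _ * X]powR0 ?mulr0 // oppr_eq0 gt_eqF.
  have nh : 0 < `|h| by rewrite normr_gt0.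
  have [h1|h1] := lerP `|h| 1.
    have : 1 <= `|h|^-1 by rewrite invf_ge1.
    move=> /dyadic_ge1[j /andP[j1 j2]].
    have hj : `|h| <= 2 ^- j by rewrite -[leLHS]invrK lef_pV2 ?posrE ?invr_gt0
      ?exprn_gt0.
    apply: (@le_trans _ _ (t1 j h)); last first.
      rewrite -[leLHS]adde0 leeD //.
      by apply: (le_trans _ (nneseries_lim_ge j.+1 _)) => //;
        rewrite big_nat_recr //= leeDr // sume_ge0.
    rewrite /t1 indicE mem_set // mule1 lee_fin /c1 ler_pM ?powR_ge0 //.
      by apply: powR_le => //; exact: ltW.
    rewrite -mulN1r powRrM powR_inv1 //.
    by rewrite powR_le ?invr_ge0 // ltW.
  have [j /andP[j1 j2]] := dyadic_ge1 (ltW h1).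
  apply: (@le_trans _ _ (t2 j h)); last first.
    rewrite -[leLHS]add0e leeD //.
    by apply: (le_trans _ (nneseries_lim_ge j.+1 _)) => //;
      rewrite big_nat_recr //= leeDr // sume_ge0.
  rewrite /t2 indicE mem_set /=; last by rewrite /B /= ltW.
  rewrite mule1 lee_fin /c2 powR1 mul1r !powRN.
  by rewrite lef_pV2 ?posrE ?powR_gt0 ?exprn_gt0 // powR_le ?exprn_ge0 // ltW.
have m1 : measurable_fun setT (fun h => \sum_(0 <= j <oo) t1 j h)%E.
  by apply: ge0_emeasurable_sum.
have m2 : measurable_fun setT (fun h => \sum_(0 <= j <oo) t2 j h)%E.
  by apply: ge0_emeasurable_sum.
have mn : measurable_fun setT (fun h : 'rV[R]_n => `|h|).
  by apply: continuous_measurable_rV; exact: norm_continuous.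
have mG : measurable_fun [set: 'rV[R]_n]
    (fun h => ((Num.min 1 `|h|) `^ p * `|h| `^ (- alpha))%:E).
  apply/measurable_EFinP; apply: measurable_funM; apply: measurable_fun_powRr => //.
  exact: measurable_minr.
apply: (@le_lt_trans _ _ (\int[mu]_h ((\sum_(0 <= j <oo) t1 j h) +
  (\sum_(0 <= j <oo) t2 j h)))%E).
  apply: ge0_le_integral => //.
  exact: emeasurable_funD.
rewrite ge0_integralD //; [|by move=> h _; exact: nneseries_ge0..].
rewrite !integral_nneseries //.
have P1' (x : R) : x < 0 -> (2 : R) `^ x < 1.
  move=> x0; rewrite -[x]opprK powRN invf_lt1 ?powR_gt0 //.
  have e1 : (1 : R) `^ (- x) = 1 by rewrite powR1.
  by rewrite -[ltLHS]e1 gt0_ltr_powR ?oppr_gt0 ?nnegrE // ltr1n.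
have Q1 : q1 < 1.
  by apply: P1'; lra.
have Q2 : q2 < 1.
  by apply: P1'; lra.
have K1 : 0 <= 2 `^ alpha * 2 ^+ n :> R by rewrite mulr_ge0 ?powR_ge0 ?exprn_ge0.
have K2 : 0 <= 2 ^+ n * 2 ^+ n :> R by rewrite mulr_ge0 ?exprn_ge0.
apply: lte_add_pinfty.
  apply: le_lt_trans (geometric_nneseries_lty K1 (powR_ge0 _ _) Q1).
  by apply: lee_nneseries => [j *|j *]; [exact: integral_ge0|exact: i1].
apply: le_lt_trans (geometric_nneseries_lty K2 (powR_ge0 _ _) Q2).
by apply: lee_nneseries => [j *|j *]; [exact: integral_ge0|exact: i2].
Qed.

Definition pairdiff a f z : R := (f z.1 - f z.2) * kern a (z.1 - z.2).

Lemma measurable_pairdiff a f : measurable_fun setT f ->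
  measurable_fun setT (pairdiff a f).
Proof.
move=> mf; apply: measurable_funM;
  last exact: measurableT_comp (measurable_kern a) measurable_subr_pair.
by apply: measurable_funB; exact: measurableT_comp.
Qed.

Lemma Ccinf_minr chi : Ccinf chi -> exists2 A : R, 0 <= A &
  forall x y, `|chi x - chi y| <= A * Num.min 1 `|x - y|.
Proof.
move=> Cchi; have [L L0 Lchi] := Ccinf_lipschitz Cchi.
have [M M0 Mchi] := Ccinf_bounded Cchi.
exists (L + M *+ 2); first by rewrite addr_ge0 // mulrn_wge0.
move=> x y; have [h1|h1] := lerP 1 `|x - y|.
  rewrite mulr1 (le_trans (ler_normB _ _)) // (le_trans (lerD (Mchi x) (Mchi y))) //.
  by rewrite -mulr2n lerDr.
by rewrite (le_trans (Lchi x y)) // ler_wpM2r // lerDl mulrn_wge0.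
Qed.

(** Increments of [chi] are at most [A * min(1, |x - y|)]; after translation by [y] the integral is
    the one of [kernel_shells_lty], so the bound is uniform in [y]. *)
Lemma kernel_bound chi p a : Ccinf chi -> 0 < p -> n%:R < a * p -> a * p < n%:R + p ->
  exists2 C : R, 0 <= C & forall y,
    (\int[mu]_x (`|pairdiff a chi (x, y)| `^ p)%:E <= C%:E)%E.
Proof.
move=> Cchi p0 na anp; have [A A0 Achi] := Ccinf_minr Cchi.
have a0 : 0 < a.
  have : 0 < a * p by apply: le_lt_trans na; rewrite ler0n.
  by rewrite pmulr_lgt0.
pose G (h : 'rV[R]_n) : \bar R := ((Num.min 1 `|h|) `^ p * `|h| `^ (- (a * p)))%:E.
have G0 h : (0 <= G h)%E by rewrite lee_fin mulr_ge0 ?powR_ge0.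
have mG : measurable_fun setT G.
  have mn : measurable_fun setT (fun h : 'rV[R]_n => `|h|).
    by apply: continuous_measurable_rV; exact: norm_continuous.
  apply/measurable_EFinP; apply: measurable_funM; apply: measurable_fun_powRr => //.
  exact: measurable_minr.
have Goo : (\int[mu]_h G h < +oo)%E by exact: kernel_shells_lty.
have Gfin : (\int[mu]_h G h)%E \is a fin_num.
  by rewrite ge0_fin_numE //; exact: integral_ge0.
exists (A `^ p * fine (\int[mu]_h G h)%E).
  by rewrite mulr_ge0 ?powR_ge0 // fine_ge0 //; exact: integral_ge0.
move=> y; have mchi := continuous_measurable_rV (Ccinf_continuous Cchi).
have ms : measurable_fun setT (fun x : 'rV[R]_n => x - y).
  exact: (mpres_rV_subr y).1.
rewrite EFinM fineK // -(ge0_integral_mpres (mpres_rV_subr y) mG G0).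
rewrite -ge0_integralZl ?lee_fin ?powR_ge0 //; last exact: measurableT_comp.
apply: ge0_le_integral => //.
- apply: measurable_powint.
  exact: (measurableT_comp (measurable_pairdiff a mchi) (pair2_measurable y)).
- by apply: measurable_funeM; exact: measurableT_comp.
- move=> x _; rewrite -EFinM lee_fin /pairdiff /= normrM (ger0_norm (kern_ge0 _ _)).
  rewrite powRM ?kern_ge0 // kern_powR mulrA ler_pM ?powR_ge0 //.
    rewrite -powRM ?le_min ?ler01 ?normr_ge0 //.
    by apply: powR_le => //; exact: ltW.
  by apply: kern_le; rewrite mulr_gt0.
Qed.

(** By Tonelli one integrates over the variable that the weight does not involve, where
    [kernel_bound] applies. *)
Lemma weighted_kernel_bound chi p a (w : 'rV[R]_n -> \bar R) :
  Ccinf chi -> 0 < p -> n%:R < a * p -> a * p < n%:R + p ->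
  measurable_fun setT w -> (forall x, 0 <= w x)%E -> (\int[mu]_x w x < +oo)%E ->
  (\int[mu2]_z (w z.1 * (`|pairdiff a chi z| `^ p)%:E) < +oo)%E /\
  (\int[mu2]_z (w z.2 * (`|pairdiff a chi z| `^ p)%:E) < +oo)%E.
Proof.
move=> Cchi p0 na anp mw w0 woo; have [C C0 HC] := kernel_bound Cchi p0 na anp.
have mchi := continuous_measurable_rV (Ccinf_continuous Cchi).
have mQ : measurable_fun setT (fun z => (`|pairdiff a chi z| `^ p)%:E).
  by apply: measurable_powint; exact: measurable_pairdiff.
have Q0 z : (0 <= (`|pairdiff a chi z| `^ p)%:E)%E by rewrite lee_fin powR_ge0.
have Qs x y : pairdiff a chi (x, y) = - pairdiff a chi (y, x).
  by rewrite /pairdiff /= -mulNr opprB -[y - x]opprB kernN.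
have Cw : (C%:E * \int[mu]_x w x < +oo)%E.
  by rewrite lte_mul_pinfty // ?lee_fin.
have HC' x : (\int[mu]_y (`|pairdiff a chi (x, y)| `^ p)%:E <= C%:E)%E.
  apply: le_trans (HC x).
  by apply: eq_lew; apply: eq_integral => y _; rewrite Qs normrN.
have m1 : measurable_fun setT (fun z => w z.1 * (`|pairdiff a chi z| `^ p)%:E)%E.
  by apply: emeasurable_funM => //; exact: measurableT_comp.
have m2 : measurable_fun setT (fun z => w z.2 * (`|pairdiff a chi z| `^ p)%:E)%E.
  by apply: emeasurable_funM => //; exact: measurableT_comp.
have p10 z : (0 <= w z.1 * (`|pairdiff a chi z| `^ p)%:E)%E by exact: mule_ge0.
have p20 z : (0 <= w z.2 * (`|pairdiff a chi z| `^ p)%:E)%E by exact: mule_ge0.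
have mx x : measurable_fun setT (fun y => (`|pairdiff a chi (x, y)| `^ p)%:E).
  exact: (measurableT_comp mQ (pair1_measurable x)).
have my y : measurable_fun setT (fun x => (`|pairdiff a chi (x, y)| `^ p)%:E).
  exact: (measurableT_comp mQ (pair2_measurable y)).
have mCw : measurable_fun setT (fun x => C%:E * w x)%E by exact: measurable_funeM.
have C0' : (0 <= C%:E)%E by rewrite lee_fin.
split; apply: le_lt_trans Cw;
  rewrite -(ge0_integralZl _ measurableT mw (fun x _ => w0 x) C0').
- rewrite (fubini_tonelli1 (m1 := lebesgue_rV n) (m2 := lebesgue_rV n) _ m1 p10).
  apply: ge0_le_integral => //.
  + by move=> x _; apply: integral_ge0 => y _; exact: (p10 (x, y)).
  + exact: (measurable_fun_fubini_tonelli_F (m2 := lebesgue_rV n) _ m1 p10).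
  + move=> x _; rewrite /fubini_F /= ge0_integralZl // muleC.
    exact: lee_wpmul2r.
- rewrite (fubini_tonelli2 (m1 := lebesgue_rV n) (m2 := lebesgue_rV n) _ m2 p20).
  apply: ge0_le_integral => //.
  + by move=> x _; apply: integral_ge0 => y _; exact: (p20 (y, x)).
  + exact: (measurable_fun_fubini_tonelli_G (m1 := lebesgue_rV n) _ m2 p20).
  + move=> x _; rewrite /fubini_G /= ge0_integralZl // muleC.
    exact: lee_wpmul2r.
Qed.

(** Where the difference is nonzero, one of the two points lies in the ball that carries [chi], so
    the indicator of this ball can serve as weight. *)
Lemma Ccinf_pairdiff_lty chi p a :
  Ccinf chi -> 0 < p -> n%:R < a * p -> a * p < n%:R + p ->
  (powint mu2 p (pairdiff a chi) < +oo)%E.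
Proof.
move=> Cchi p0 na anp; have [_ [r rchi]] := Cchi.
pose w (x : 'rV[R]_n) : \bar R := (\1_[set x : 'rV[R]_n | `|x| <= r] x)%:E.
have mB := @measurable_rV_ball R n r.
have mw : measurable_fun setT w by apply/measurable_EFinP; exact: measurable_indic.
have woo : (\int[mu]_x w x < +oo)%E by rewrite integral_indic // setIT
  lebesgue_rV_ball_lty.
have w0 x : (0 <= w x)%E by rewrite lee_fin.
have [I1 I2] := weighted_kernel_bound Cchi p0 na anp mw w0 woo.
have mchi := continuous_measurable_rV (Ccinf_continuous Cchi).
have mQ : measurable_fun setT (fun z => (`|pairdiff a chi z| `^ p)%:E).
  by apply: measurable_powint; exact: measurable_pairdiff.
have m1 : measurable_fun setT (fun z => w z.1 * (`|pairdiff a chi z| `^ p)%:E)%E.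
  by apply: emeasurable_funM => //; exact: measurableT_comp.
have m2 : measurable_fun setT (fun z => w z.2 * (`|pairdiff a chi z| `^ p)%:E)%E.
  by apply: emeasurable_funM => //; exact: measurableT_comp.
have Q0 z : (0 <= (`|pairdiff a chi z| `^ p)%:E)%E by rewrite lee_fin powR_ge0.
have p10 z : (0 <= w z.1 * (`|pairdiff a chi z| `^ p)%:E)%E by exact: mule_ge0.
have p20 z : (0 <= w z.2 * (`|pairdiff a chi z| `^ p)%:E)%E by exact: mule_ge0.
apply: le_lt_trans (lte_add_pinfty I1 I2).
rewrite -ge0_integralD //; apply: ge0_le_integral => //.
- exact: emeasurable_funD.
- move=> z _; rewrite -ge0_muleDl // -EFinD.
  have [z1|z1] := lerP `|z.1| r.
    rewrite indicE mem_set // -[leLHS]mul1e lee_wpmul2r // lee_fin.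
    by rewrite lerDl.
  have [z2|z2] := lerP `|z.2| r.
    rewrite [\1__ z.2]indicE mem_set // -[leLHS]mul1e lee_wpmul2r // lee_fin.
    by rewrite lerDr.
  rewrite /pairdiff !rchi // subrr mul0r normr0 powR0 ?gt_eqF // mule0 //.
Qed.

(** Increments of a product split into an increment of [chi] times a value of [f], controlled by
    [|f| ^ p] as weight, and a bounded factor times an increment of [f], known on pairs in [Omega].
    For a pair with one point outside [Omega], where [chi] and [f] vanish, the first kind of term
    suffices; this gives finiteness on the whole space. *)
Lemma product_pairdiff_lty f chi p a (Omega : set 'rV[R]_n) :
  Ccinf chi -> 0 < p -> n%:R < a * p -> a * p < n%:R + p -> measurable Omega ->
  measurable_fun setT f -> (powint mu p f < +oo)%E ->
  (forall x, ~ Omega x -> f x = 0) -> (forall x, ~ Omega x -> chi x = 0) ->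
  (\int[mu2]_(z in Omega `*` Omega) (`|pairdiff a f z| `^ p)%:E < +oo)%E ->
  (powint mu2 p (pairdiff a (fun x => chi x * f x)%R) < +oo)%E.
Proof.
move=> Cchi p0 na anp mO mf foo f0 chi0 Qoo.
have mchi := continuous_measurable_rV (Ccinf_continuous Cchi).
have [M M0 Mchi] := Ccinf_bounded Cchi.
have mfp : measurable_fun setT (fun x => (`|f x| `^ p)%:E) by exact: measurable_powint.
have fp0 x : (0 <= (`|f x| `^ p)%:E)%E by rewrite lee_fin powR_ge0.
have [I1 I2] := weighted_kernel_bound Cchi p0 na anp mfp fp0 foo.
pose g1 z := f z.1 * pairdiff a chi z; pose g2 z := f z.2 * pairdiff a chi z.
pose g3 z := M * (\1_(Omega `*` Omega) z * pairdiff a f z).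
have mg1 : measurable_fun setT g1.
  by apply: measurable_funM; [exact: measurableT_comp|exact: measurable_pairdiff].
have mg2 : measurable_fun setT g2.
  by apply: measurable_funM; [exact: measurableT_comp|exact: measurable_pairdiff].
have mOO : measurable (Omega `*` Omega) by exact: measurableX.
have mI : measurable_fun setT (\1_(Omega `*` Omega) : _ -> R) := measurable_indic mOO.
have m3 : measurable_fun setT (fun z => \1_(Omega `*` Omega) z * pairdiff a f z).
  by apply: measurable_funM; [exact: mI|exact: measurable_pairdiff].
have mg3 : measurable_fun setT g3.
  exact: measurable_funM (measurable_cst _) m3.
have g1oo : (powint mu2 p g1 < +oo)%E.
  apply: le_lt_trans I1; apply: eq_lew.
  by apply: eq_integral => z _; rewrite normrM powRM // EFinM.
have g2oo : (powint mu2 p g2 < +oo)%E.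
  apply: le_lt_trans I2; apply: eq_lew.
  by apply: eq_integral => z _; rewrite normrM powRM // EFinM.
have g3oo : (powint mu2 p g3 < +oo)%E.
  have E : powint mu2 p g3 = _ := powintZ mu2 p M m3.
  rewrite E; apply: lte_mul_pinfty; [by rewrite lee_fin powR_ge0|by []|].
  apply: le_lt_trans Qoo; apply: eq_lew.
  rewrite [RHS]integral_mkcond; apply: eq_integral => z _; rewrite patchE indicE.
  by case: (z \in _); rewrite ?mul1r // mul0r normr0 powR0 ?gt_eqF.
have p0' := ltW p0.
have abs (g : 'rV[R]_n * 'rV[R]_n ->
  R) : powint mu2 p (fun z => `|g z|) = powint mu2 p g.
  by apply: eq_integral => z _; rewrite normr_id.
have absm (g : 'rV[R]_n * 'rV[R]_n -> R) : measurable_fun setT g ->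
  measurable_fun setT (fun z => `|g z|).
  by move=> mg; exact: measurableT_comp.
have abD (g g' : 'rV[R]_n * 'rV[R]_n -> R) : measurable_fun setT g ->
  measurable_fun setT g' ->
    (powint mu2 p g < +oo)%E -> (powint mu2 p g' < +oo)%E ->
    (powint mu2 p (fun z => (`|g z| + `|g' z|)%R) < +oo)%E.
  move=> mg mg' goo goo'; apply: powintD_lty p0' (absm _ mg) (absm _ mg') _ _.
    by rewrite abs; exact: goo.
  by rewrite abs; exact: goo'.
have m12 := measurable_funD (absm _ mg1) (absm _ mg2).
have oo := abD _ _ m12 mg3 (abD _ _ mg1 mg2 g1oo g2oo) g3oo.
have mP : measurable_fun setT (pairdiff a (fun x => chi x * f x)).
  by apply: measurable_pairdiff; exact: measurable_funM.
apply: le_lt_trans oo;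
  apply: (le_powint _ p0' mP (measurable_funD (absm _ m12) (absm _ mg3))).
move=> z /=; rewrite [leRHS]ger0_norm ?addr_ge0 // (ger0_norm (addr_ge0 (normr_ge0 _)
  (normr_ge0 _))).
rewrite /g1 /g2 /g3 /pairdiff !mulrA !normrM.
rewrite !(ger0_norm (kern_ge0 _ _)) -!mulrDl ler_wpM2r ?kern_ge0 //.
rewrite (ger0_norm M0) indicE; have [[z1 z2]|nz] := pselect ((Omega `*` Omega) z).
  rewrite mem_set //= normr1 mulr1.
  have -> : chi z.1 * f z.1 - chi z.2 * f z.2 =
    f z.2 * (chi z.1 - chi z.2) + chi z.1 * (f z.1 - f z.2) by ring.
  rewrite (le_trans (ler_normD _ _)) // lerD //.
    by rewrite normrM ler_wpM2r // lerDr.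
  by rewrite normrM ler_wpM2r.
rewrite memNset // normr0 mulr0 mul0r addr0.
have [z1|z1] := pselect (Omega z.1); last first.
  rewrite (f0 _ z1) (chi0 _ z1) !mul0r normr0 !sub0r add0r !normrN.
  by rewrite normrM mulrC.
have z2 : ~ Omega z.2 by move=> z2; apply: nz.
by rewrite (f0 _ z2) (chi0 _ z2) !mulr0 normr0 !subr0 addr0 normrM mulrC.
Qed.

End kernel.

(** * L^p densities of distributions *)

Section poweR_norm.
Context {R : realType}.
Implicit Types (x : \bar R) (p e : R).

Lemma poweR_inv_le x p e : 0 < p -> 0 <= e -> (0 <= x)%E ->
  ((x `^ p^-1 <= e%:E) = (x <= (e `^ p)%:E))%E.
Proof.
move=> p0 e0; case: x => [x| |]; rewrite ?lee_fin // => x0; last first.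
  by rewrite poweRyr ?invr_eq0 ?gt_eqF // !leye_eq.
have xE : (x `^ p^-1) `^ p = x by rewrite -powRrM mulVf ?powRr1 // gt_eqF.
apply/idP/idP => h.
  by rewrite -xE powR_le ?powR_ge0 // ltW.
have -> : e = (e `^ p) `^ p^-1 by rewrite -powRrM mulfV ?powRr1 // gt_eqF.
by rewrite powR_le ?invr_ge0 // ltW.
Qed.

Lemma poweR_inv_lty x p : 0 < p -> ((x `^ p^-1 < +oo) = (x < +oo))%E.
Proof.
move=> p0; apply/idP/idP => [|/poweR_lty//].
by apply: lty_poweRy; rewrite invr_eq0 gt_eqF.
Qed.

Lemma Lnorm_powint d (T : measurableType d) (m : {measure set T ->
  \bar R}) p (g : T -> R) :
  ('N[m]_p%:E[EFin \o g] = (powint m p g) `^ p^-1)%E.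
Proof. by rewrite unlock. Qed.

End poweR_norm.

Section Lp_spaces.
Context {R : realType} {n : nat} (Omega : set 'rV[R]_n).
Hypothesis oO : open Omega.
Local Notation mu := (lebesgue_rV n : {measure set 'rV[R]_n -> \bar R}).
Local Notation mu2 := ((lebesgue_rV n \x lebesgue_rV n)%E : {measure set ('rV[R]_n *
  'rV[R]_n)%type -> \bar R}).
Implicit Types (f g : 'rV[R]_n -> R) (p theta e : R) (phi psi : testfun Omega).

Lemma Lp_normE p f : Lp_norm Omega p f = ((powint mu p (f \_ Omega)) `^ p^-1)%E.
Proof. exact: Lnorm_powint. Qed.

Lemma LpP p f : 0 < p -> Lp Omega p f <->
  measurable_fun setT (f \_ Omega) /\ (powint mu p (f \_ Omega) < +oo)%E.
Proof.
move=> p0; split.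
  move=> /andP[/set_mem mf /set_mem foo]; split => //.
  by have : (Lp_norm Omega p f < +oo)%E := foo; rewrite Lp_normE poweR_inv_lty.
move=> [mf foo]; apply/andP; split; apply/mem_set => //.
suff : (Lp_norm Omega p f < +oo)%E by [].
by rewrite Lp_normE poweR_inv_lty.
Qed.

Lemma slobodeckijE theta p f : 0 < p -> 0 < theta ->
  (slobodeckij_seminorm Omega theta p f =
  (\int[mu2]_(z in Omega `*` Omega) (`|pairdiff (n%:R / p +
    theta) f z| `^ p)%:E) `^ p^-1)%E.
Proof.
move=> p0 t0; congr (_ `^ _)%E; apply: eq_integral => z _; congr _%:E.
rewrite /pairdiff normrM powRM // (ger0_norm (kern_ge0 _ _)) kern_powR /kern powRN.
by rewrite mulrDl divfK // gt_eqF.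
Qed.

Lemma testfun_eq0 psi x : ~ Omega x -> psi x = 0.
Proof.
move=> Ox; have [_ _ sub] := set_mem (testfunP psi).
by apply/eqP/negPn/negP => px; apply/Ox/sub; exact: subset_closure.
Qed.

Lemma testfun_eq phi psi : (forall x, phi x = psi x) -> phi = psi.
Proof. by move=> h; apply/val_inj/funext. Qed.

Lemma regularE f psi :
  regular_distribution Omega f psi = \int[mu]_x ((f \_ Omega) x * psi x).
Proof.
rewrite /regular_distribution /Rintegral integral_mkcond; congr fine.
apply: eq_integral => x _; rewrite !patchE.
by case: ifP => //; rewrite mul0r.
Qed.

Lemma locint_mul g psi : locint g ->
  mu.-integrable setT (EFin \o (fun x => g x * psi x)).
Proof.
move=> lg; have Cpsi := testfun_Ccinf psi; have [_ [r rpsi]] := Cpsi.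
have [M M0 Mpsi] := Ccinf_bounded Cpsi.
have mpsi := continuous_measurable_rV (Ccinf_continuous Cpsi).
apply: le_integrable (locint_dom r M lg) => //.
- by apply/measurable_EFinP; apply: measurable_funM => //; exact: lg.1.
move=> x _ /=; rewrite lee_fin patchE; have [xr|xr] := lerP `|x| r.
  rewrite mem_set //= !normrM normr_id mulrC ler_wpM2r //.
  by rewrite (le_trans (Mpsi x)) // ler_norm.
by rewrite rpsi // mulr0 normr0.
Qed.

Lemma patch_id g : (forall x, ~ Omega x -> g x = 0) -> g \_ Omega = g.
Proof.
move=> g0; apply/funext => x; rewrite patchE; case: ifPn => // /negP xO.
by rewrite g0 // => Ox; apply: xO; exact: mem_set.
Qed.

Lemma measurable_patch g : measurable_fun setT g -> measurable_fun setT (g \_ Omega).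
Proof.
move=> mg; apply: (measurable_restrictT _ (open_measurable_rV oO)).1.
exact: measurable_funTS.
Qed.

Lemma powint_patch_le p g : 0 <= p -> measurable_fun setT g ->
  (powint mu p (g \_ Omega) <= powint mu p g)%E.
Proof.
move=> p0 mg; apply: le_powint => //; first exact: measurable_patch.
by move=> x; rewrite patchE; case: ifP => // _; rewrite normr0.
Qed.

Lemma regularB p f g : 1 <= p -> Lp Omega p f -> Lp Omega p g ->
  regular_distribution Omega (fun x => f x - g x) =
  regular_distribution Omega f - regular_distribution Omega g.
Proof.
move=> p1; have p0 : 0 < p by apply: lt_le_trans p1.
move=> /LpP[//|mf foo] /LpP[//|mg goo]; apply/funext => psi.
transitivity (regular_distribution Omega f psi - regular_distribution Omega g psi) =>
  //.
rewrite !regularE -RintegralB //; last 2 first.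
- exact: locint_mul (powint_locint p1 mf foo).
- exact: locint_mul (powint_locint p1 mg goo).
apply: eq_Rintegral => x _; rewrite !patchE; case: ifP => _; first by rewrite mulrBl.
by rewrite !mul0r subrr.
Qed.

Definition mi_seq k (nu : multiindex n k) : seq 'I_n :=
  flatten [seq nseq (nu i) i | i <- enum 'I_n].

Lemma size_mi_seq k (nu : multiindex n k) : size (mi_seq nu) = mi_size nu.
Proof.
rewrite size_flatten /shape -map_comp /mi_size sumnE big_map big_enum /=.
by apply: eq_bigr => i _; rewrite size_nseq.
Qed.

Lemma testfun_derivE k (nu : multiindex n k) psi :
  testfun_deriv nu psi = pd (mi_seq nu) psi :> (_ -> _).
Proof.
rewrite /testfun_deriv /mi_seq /pd; elim: (enum 'I_n) => //= i s IH.
rewrite foldr_cat -IH; elim: (nu i : nat) => //= m <-.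
by [].
Qed.

Lemma dist_deriv_regular k (nu : multiindex n k) psi :
  dist_deriv nu (regular_distribution Omega psi) =
  regular_distribution Omega (pd (rev (mi_seq nu)) psi).
Proof.
apply/funext => phi; rewrite /dist_deriv regularE testfun_derivE.
rewrite patch_id; last by move=> x; exact: testfun_eq0.
have -> : \int[mu]_x (psi x * pd (mi_seq nu) phi x) =
    \int[mu]_x (pd (mi_seq nu) phi x * psi x).
  by apply: eq_Rintegral => x _; rewrite mulrC.
rewrite integration_by_parts_pd; last 2 first.
- exact: testfun_Ccinf.
- exact: (testfun_Ccinf psi).1.
rewrite size_mi_seq signrMK.
rewrite regularE; apply: eq_Rintegral => x _; rewrite mulrC patchE.
by case: ifPn => // /negP xO; rewrite testfun_eq0 ?mulr0 ?mul0r // => Ox;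
  apply/xO/mem_set.
Qed.

End Lp_spaces.

(** Dominated convergence: the integrands are below [|f| ^ p] and vanish eventually at each
    point. *)
Lemma powint_trunc d (T : measurableType d) (R : realType)
    (m : {measure set T -> \bar R}) (p : R) (f : T -> R) (A : (set T)^nat) :
  0 < p -> measurable_fun setT f -> (powint m p f < +oo)%E ->
  (forall j, measurable (A j)) ->
  (forall x, f x != 0 -> exists N, forall j, (N <= j)%N -> A j x) ->
  forall e : R, 0 < e -> exists j0, forall j, (j0 <= j)%N ->
    (powint m p (fun x => (f x - f x * \1_(A j) x)%R) <= e%:E)%E.
Proof.
move=> p0 mf foo mA fA e e0.
pose F j x := (`|f x - f x * \1_(A j) x| `^ p)%:E.
have mF j : measurable_fun setT (F j).
  apply: measurable_powint; apply: measurable_funB => //; exact: measurable_funM.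
have ig := powint_abs_integrable mf foo.
have FA x : F ^~ x @ \oo --> (0%E : \bar R).
  apply: cvg_near_cst; have [f0|f0] := eqVneq (f x) 0.
    by apply: nearW => j; rewrite /F f0 mul0r subrr normr0 powR0 // gt_eqF.
  have [N AN] := fA _ f0; exists N => // j /= Nj.
  by rewrite /F indicE mem_set ?mulr1 ?subrr ?normr0 ?powR0 ?gt_eqF //; exact: AN.
have dom j x : (`|F j x| <= (EFin \o (fun x => (`|f x| `^ p)%R)) x)%E.
  rewrite /F /= lee_fin ger0_norm ?powR_ge0 //; apply: powR_le => //; first exact: ltW.
  rewrite indicE; case: (_ \in _); first by rewrite mulr1 subrr normr0.
  by rewrite mulr0 subr0.
have [_ _] := @dominated_convergence _ _ _ m setT measurableT F (fun=> 0%E)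
  (EFin \o (fun x => `|f x| `^ p)) mF (measurable_cst _)
  (aeW _ (fun x _ => FA x)) ig (aeW _ (fun x j _ => dom j x)).
rewrite integral0 => /cvge0_le-/(_ _ e0)[j0 _ h].
by exists j0 => j; exact: h.
Qed.

Lemma continuous_subr (R : realType) n (a : 'rV[R]_n) : continuous (fun x : 'rV[R]_n =>
  x - a).
Proof. by move=> x; exact: (cvgB cvg_id (cvg_cst a)). Qed.

(** * Compact exhaustion of an open set *)

Section exhaustion.
Context {R : realType} {n : nat} (Omega : set 'rV[R]_n).

(** The distance to the complement is expressed by an intersection over the complement, which needs
    no special case when [Omega] is the whole space. *)
Definition exhaust (j : nat) : set 'rV[R]_n :=
  [set x | `|x| <= j%:R] `&`
  \bigcap_(y in ~` Omega) [set x | j.+1%:R^-1 <= `|x - y|].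

Lemma closed_exhaust j : closed (exhaust j).
Proof.
apply: closedI.
  apply: (@preimage_closed _ _ (fun x : 'rV[R]_n => `|x|) [set t | t <= j%:R]).
    by move=> x _; exact: norm_continuous.
  exact: (@closed_le R).
apply: closed_bigI => y _.
apply: (@preimage_closed _ _ (fun x : 'rV[R]_n => `|x - y|) [set t | j.+1%:R^-1 <= t]).
  move=> x _; apply: (@continuous_comp _ _ _ (fun x : 'rV[R]_n => x - y) (fun x =>
    `|x|)).
    exact: continuous_subr.
  exact: norm_continuous.
exact: (@closed_ge R).
Qed.

Lemma compact_exhaust j : compact (exhaust j).
Proof.
have := @compact_closed_ball R n j%:R.
by move=> /(subclosed_compact (@closed_exhaust j)); apply => x [].
Qed.

Lemma measurable_exhaust j : measurable (exhaust j).
Proof. exact: closed_measurable_rV (@closed_exhaust j). Qed.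

Lemma exhaust_sub j : exhaust j `<=` Omega.
Proof.
move=> x [_ xO]; apply: contrapT => /xO /=.
by rewrite subrr normr0 leNgt invr_gt0 ltr0n.
Qed.

Lemma exhaust_near x : open Omega -> Omega x ->
  exists N, forall j, (N <= j)%N -> exhaust j x.
Proof.
move=> oO Ox; have /nbhs_ballP[e /= e0 xe] := open_nbhs_nbhs (conj oO Ox).
have [N1 xN1] : exists N1 : nat, `|x| <= N1%:R.
  by exists (Num.bound `|x|); rewrite ltW // archi_boundP.
have [N2 eN2] : exists N2 : nat, e^-1 <= N2%:R.
  by exists (Num.bound e^-1); rewrite ltW // archi_boundP // invr_ge0 ltW.
exists (maxn N1 N2) => j; rewrite geq_max => /andP[j1 j2]; split => /=.
  by rewrite (le_trans xN1) // ler_nat.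
move=> y yO /=; rewrite leNgt; apply/negP => xy; apply: yO; apply: xe.
rewrite -ball_normE /=; apply: lt_le_trans xy _.
rewrite -[leRHS]invrK lef_pV2 ?posrE ?invr_gt0 ?ltr0n //.
by rewrite (le_trans eN2) // ler_nat (leq_trans j2).
Qed.

End exhaustion.

Section shift.
Context {R : realType} {n : nat}.

Lemma smooth_shift (f : 'rV[R]_n -> R) (a : 'rV[R]_n) : smooth f ->
  smooth (fun x => f (x - a)).
Proof.
move=> sf k; elim: k f sf => [f sf|k IH f sf].
  move=> x; apply: (@continuous_comp _ _ _ (fun x : 'rV[R]_n => x - a) f).
    exact: continuous_subr.
  exact: smooth_continuous.
have E i x : (fun h : R => h^-1 *: ((fun x =>
  f (x - a)) (h *: delta_mx 0 i + x) - f (x - a))) =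
  (fun h : R => h^-1 *: (f (h *: delta_mx 0 i + (x - a)) - f (x - a))).
  by apply/funext => h; rewrite addrA.
split; first exact: Ck_continuous (IH f sf).
move=> i; split.
  move=> x; have := @smooth_derivable _ _ f i (x - a) sf.
  by rewrite /derivable /= -E.
rewrite (_ : partial_deriv i _ = fun x => partial_deriv i f (x - a)).
  by apply: IH; exact: smooth_partial.
apply/funext => x; rewrite /partial_deriv /derive /=.
by rewrite -E.
Qed.

End shift.

(** * The fundamental lemma of the calculus of variations and test functions in L^p *)

Section Lp_density.
Context {R : realType} {n : nat} (Omega : set 'rV[R]_n).
Hypothesis oO : open Omega.
Local Notation mu := (lebesgue_rV n : {measure set 'rV[R]_n -> \bar R}).
Implicit Types (f g : 'rV[R]_n -> R) (p theta e : R) (phi psi : testfun Omega).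

Lemma powint_bounded_mul p f g M : 0 <= p -> measurable_fun setT f ->
  measurable_fun setT g ->
  (forall x, `|g x| <= M) -> (powint mu p f < +oo ->
    powint mu p (fun x => (g x * f x)%R) < +oo)%E.
Proof.
move=> p0 mf mg gM foo.
have E := powintZ mu p M mf.
apply: (@le_lt_trans _ _ (powint mu p (fun x => (M * f x)%R))).
  apply: le_powint => //; [exact: measurable_funM|exact: measurable_funM|].
  by move=> x; rewrite !normrM ler_wpM2r // (le_trans (gM x)) // ler_norm.
by rewrite E lte_mul_pinfty // lee_fin powR_ge0.
Qed.

(** For a cutoff [chi], the value at [x] of the mollified [chi * f] is the pairing of [f] with the
    test function [rho (y - x) * chi y] in [y], hence 0. As mollification converges in L^p,
    [chi * f] is null; cutoffs equal to 1 on the exhausting compact sets give [f] itself. *)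
Lemma du_bois_reymond p f : 1 < p -> measurable_fun setT f -> (powint mu p f < +oo)%E ->
  (forall x, ~ Omega x -> f x = 0) ->
  (forall psi, \int[mu]_x (f x * psi x) = 0) -> powint mu p f = 0%E.
Proof.
move=> p1 mf foo f0 f_0; have p0 : 0 < p by lra.
have loc (chi : testfun Omega) : powint mu p (fun x => (chi x * f x)%R) = 0%E.
  have mchi := continuous_measurable_rV (Ccinf_continuous (testfun_Ccinf chi)).
  have mcf : measurable_fun setT (fun x => chi x * f x) by exact: measurable_funM.
  have [M _ chiM] := Ccinf_bounded (testfun_Ccinf chi).
  have cfoo := powint_bounded_mul (ltW p0) mf mchi chiM foo.
  apply/eqP; rewrite eq_le powint_ge0 andbT; apply/lee_addgt0Pr => e e0; rewrite add0e.
  have [d d0 dP] := mollify_rV p1 mcf cfoo e0.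
  have [rho mrho] := @mollifier_exists R n d d0.
  apply: le_trans (dP rho mrho); apply: eq_lew.
  apply: eq_integral => x _; congr (_ `^ _)%:E.
  suff -> : convol rho (fun x => chi x * f x) x = 0 by rewrite sub0r normrN.
  have [Cr _ re _ _] := mrho.
  have sg : (fun y => rho (y - x) * chi y) \in is_testfun Omega.
    have [s1 c1 k1] := set_mem (testfunP chi).
    apply: (@is_testfunS _ _ _ (fsupport chi)) => //.
    - by apply: smoothM => //; apply: smooth_shift; exact: Cr.1.
    - exact: closed_closure.
    - move=> y /= h; apply: subset_closure => /=.
      by apply: contra_neq h => ->; rewrite mulr0.
  rewrite -[RHS](f_0 (Testfun sg)); apply: eq_Rintegral => y _ /=.
  by rewrite -(re (x - y)) opprB mulrA mulrC.
apply/eqP; rewrite eq_le powint_ge0 andbT.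
have P0 : 0 < (2 : R) `^ p by rewrite powR_gt0.
apply/lee_addgt0Pr => e e0; rewrite add0e.
have fA x : f x != 0 -> exists N, forall j, (N <= j)%N -> exhaust Omega j x.
  move=> fx; apply: exhaust_near => //; apply: contrapT => /f0 fx0.
  by rewrite fx0 eqxx in fx.
have e0' : 0 < e / 2 `^ p by rewrite divr_gt0.
have [j /(_ j (leqnn j)) jP] := powint_trunc p0 mf foo (measurable_exhaust Omega) fA
  e0'.
have [chi [_ [U [_ KU chi1]]]] := cutoff_exists (@compact_exhaust _ _ Omega j) oO
  (@exhaust_sub _ _ Omega j).
have m1 : measurable_fun setT (fun x => f x * \1_(exhaust Omega j) x).
  by apply: measurable_funM => //; apply: measurable_indic; exact: measurable_exhaust.
have m2 : measurable_fun setT (fun x => f x - f x * \1_(exhaust Omega j) x).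
  exact: measurable_funB.
have mchi := continuous_measurable_rV (Ccinf_continuous (testfun_Ccinf chi)).
have k0 : powint mu p (fun x => (f x * \1_(exhaust Omega j) x)%R) = 0%E.
  apply/eqP; rewrite eq_le powint_ge0 andbT -(loc chi).
  apply: le_powint; [exact: ltW|exact: m1|exact: measurable_funM|].
  move=> x; rewrite indicE; have [Kx|Kx] := pselect (exhaust Omega j x).
    by rewrite mem_set // mulr1 chi1 ?mul1r //; exact: KU.
  by rewrite memNset // mulr0 normr0.
have h := powintD mu (ltW p0) m2 m1; rewrite k0 adde0 in h.
have E : powint mu p f = powint mu p (fun x =>
  (f x - f x * \1_(exhaust Omega j) x + f x * \1_(exhaust Omega j) x)%R).
  by apply: eq_integral => x _; rewrite subrK.
rewrite E; apply: le_trans h _.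
apply: (@le_trans _ _ ((2 `^ p)%:E * (e / 2 `^ p)%:E)%E).
  by apply: lee_wpmul2l jP; rewrite lee_fin powR_ge0.
by rewrite -EFinM lee_fin mulrCA divff ?mulr1 // gt_eqF.
Qed.

(** Truncate to a compact subset of [Omega] and mollify at a scale below half its distance to the
    complement. *)
Lemma testfun_dense_Lp p f e : 1 < p -> measurable_fun setT f ->
  (powint mu p f < +oo)%E ->
  (forall x, ~ Omega x -> f x = 0) -> 0 < e ->
  exists psi, (powint mu p (fun x => (f x - psi x)%R) <= e%:E)%E.
Proof.
move=> p1 mf foo f0 e0; have p0 : 0 < p by lra.
have P0 : 0 < (2 : R) `^ p by rewrite powR_gt0.
have fA x : f x != 0 -> exists N, forall j, (N <= j)%N -> exhaust Omega j x.
  move=> fx; apply: exhaust_near => //; apply: contrapT => /f0 fx0.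
  by rewrite fx0 eqxx in fx.
(* Truncation and mollification contribute [c] each, and adding them costs [2 ^ p]. *)
pose c := e / 2 `^ p / 2.
have c0 : 0 < c by rewrite !divr_gt0.
have [j /(_ j (leqnn j)) jP] := powint_trunc p0 mf foo (measurable_exhaust Omega) fA c0.
pose g x := f x * \1_(exhaust Omega j) x.
have m1 : measurable_fun setT g.
  by apply: measurable_funM => //; apply: measurable_indic; exact: measurable_exhaust.
have goo : (powint mu p g < +oo)%E.
  apply: le_lt_trans foo; apply: le_powint => //; first exact: ltW.
  move=> x; rewrite /g indicE; case: (_ \in _); first by rewrite mulr1.
  by rewrite mulr0 normr0.
have [d1 d10 d1P] := mollify_rV p1 m1 goo c0.
have [d2 d20 d2P] := compact_margin (@compact_exhaust _ _ Omega j) oO (@exhaust_sub _ _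
  Omega j).
pose d := Num.min d1 (d2 / 2).
have d0 : 0 < d by rewrite lt_min d10 divr_gt0.
have [rho mrho] := @mollifier_exists R n d d0.
have [Cr _ _ _ rd] := mrho.
have lg := powint_locint (ltW p1) m1 goo.
have tg : convol rho g \in is_testfun Omega.
  apply: (is_testfun_near (@compact_exhaust _ _ Omega j) d0).
  - move=> h hd; apply: d2P; rewrite (le_trans hd) //.
    by rewrite mulrC -ler_pdivlMr // /d ge_min lexx orbT.
  - exact: smooth_convol.
  - move=> x /(convol_neq0 rd)[y gy xy]; exists y => //.
    apply: contrapT => Ky; move: gy; rewrite /g indicE memNset // mulr0 eqxx //.
have mr : mollifier d1 rho by apply: mollifierW mrho; rewrite ge_min lexx.
have r1 := d1P _ mr.
exists (Testfun tg).
have mc : measurable_fun setT (convol rho g).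
  exact: continuous_measurable_rV (smooth_continuous (smooth_convol Cr lg)).
have m2 : measurable_fun setT (fun x => f x - g x) by exact: measurable_funB.
have m3 : measurable_fun setT (fun x => - (convol rho g x - g x)).
  by apply: measurable_funN; exact: measurable_funB.
have h := powintD mu (ltW p0) m2 m3; rewrite powintN in h.
have E : powint mu p (fun x => (f x - Testfun tg x)%R) =
    powint mu p (fun x => (f x - g x + - (convol rho g x - g x))%R).
  by apply: eq_integral => x _; congr (`|_| `^ _)%:E; rewrite /=; ring.
rewrite E; apply: le_trans h _.
apply: (@le_trans _ _ ((2 `^ p)%:E * (c%:E + c%:E))%E).
  by apply: lee_wpmul2l; [rewrite lee_fin powR_ge0|exact: leeD].
rewrite -EFinD -EFinM lee_fin le_eqVlt; apply/orP; left; apply/eqP.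
by rewrite /c; field; rewrite gt_eqF.
Qed.

End Lp_density.

(** * Approximation for s >= 0 *)

Section sobolev_norms.
Context {R : realType} {n : nat} (Omega : set 'rV[R]_n).
Hypothesis oO : open Omega.
Local Notation mu := (lebesgue_rV n : {measure set 'rV[R]_n -> \bar R}).
Implicit Types (f g : 'rV[R]_n ->
  R) (s p theta : R) (phi psi : testfun Omega) (u : testfun Omega -> R).
Local Notation kof s := (Num.truncn s).
Local Notation thetaof s := (s - (Num.truncn s)%:R).

Lemma frac_itv s : 0 <= s -> 0 <= thetaof s < 1.
Proof.
move=> /truncn_itv/andP[h1 h2]; rewrite subr_ge0 h1 /=.
by rewrite ltrBlDr addrC -natr1 in h2 *.
Qed.

Lemma dist_Lp_norm_ge0 p u : (0 <= dist_Lp_norm p u)%E.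
Proof. by apply: le_ereal_inf_tmp => _ [f _ <-]; rewrite Lp_normE poweR_ge0. Qed.

Lemma dist_slobodeckij_ge0 theta p u : (0 <= dist_slobodeckij_seminorm theta p u)%E.
Proof. by apply: le_ereal_inf_tmp => _ [f _ <-]; exact: poweR_ge0. Qed.

(** The norms are infima over densities, so one good density per multi-index suffices. Each of the
    two sums has at most as many terms as there are multi-indices, whence the factor 2. *)
Lemma sobolev_norm_ge0_le s p u (c : R) : 0 <= c ->
  (forall nu : multiindex n (kof s), (mi_size nu <= kof s)%N ->
    exists2 f, Lp_density p (dist_deriv nu u) f & (Lp_norm Omega p f <= c%:E)%E) ->
  (thetaof s != 0 -> forall nu : multiindex n (kof s), mi_size nu = kof s ->
    exists2 f, Lp_density p (dist_deriv nu u) f &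
      (slobodeckij_seminorm Omega (thetaof s) p f <= c%:E)%E) ->
  (sobolev_norm_ge0 s p u <= (c *+ (2 * #|{: multiindex n (kof s)}|))%:E)%E.
Proof.
move=> c0 gc sc; rewrite mulnC muln2 -addnn mulrnDr EFinD.
have S (P : pred (multiindex n (kof s))) (F : multiindex n (kof s) -> \bar R) :
    (forall nu, P nu -> (F nu <= c%:E)%E) ->
    (\sum_(nu | P nu) F nu <= (c *+ #|{: multiindex n (kof s)}|)%:E)%E.
  move=> FP; apply: (@le_trans _ _ (\sum_(nu | P nu) c%:E)%E); first exact: lee_sum.
  by rewrite sumEFin lee_fin sumr_const ler_wpMn2l // max_card.
apply: leeD.
  apply: S => nu /gc[f df fc]; apply: le_trans fc.
  by apply: ereal_inf_lbound; exists f.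
case: ifPn => t0; first by rewrite lee_fin mulrn_wge0.
apply: S => nu /eqP/(sc t0)[f df fc]; apply: le_trans fc.
by apply: ereal_inf_lbound; exists f.
Qed.

Lemma sobolev_norm_ge0_ge0 s p u : (0 <= sobolev_norm_ge0 s p u)%E.
Proof.
apply: adde_ge0; first by apply: sume_ge0 => *; exact: dist_Lp_norm_ge0.
by case: ifP => // _; apply: sume_ge0 => *; exact: dist_slobodeckij_ge0.
Qed.

(** All summands are nonnegative, so each lies below [c], and an infimum below [c] is witnessed by a
    density. For [c = +oo] this provides densities of finite norm. *)
Lemma sobolev_norm_ge0_lt s p u (c : \bar R) : (sobolev_norm_ge0 s p u < c)%E ->
  (forall nu : multiindex n (kof s), (mi_size nu <= kof s)%N ->
    exists2 f, Lp_density p (dist_deriv nu u) f & (Lp_norm Omega p f < c)%E) /\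
  (thetaof s != 0 -> forall nu : multiindex n (kof s), mi_size nu = kof s ->
    exists2 f, Lp_density p (dist_deriv nu u) f &
      (slobodeckij_seminorm Omega (thetaof s) p f < c)%E).
Proof.
rewrite /sobolev_norm_ge0 => uc; split=> [nu nuk|t0 nu nuk].
- have : (dist_Lp_norm p (dist_deriv nu u) < c)%E.
    apply: le_lt_trans uc; rewrite (bigD1 nu) //= -addeA leeDl // adde_ge0 //.
      by apply: sume_ge0 => *; exact: dist_Lp_norm_ge0.
    by case: ifP => // _; apply: sume_ge0 => *; exact: dist_slobodeckij_ge0.
  by move=> /ereal_inf_lt[_ [f df <-] fc]; exists f.
- have : (dist_slobodeckij_seminorm (thetaof s) p (dist_deriv nu u) < c)%E.
    apply: le_lt_trans uc;
      rewrite (negbTE t0) (bigD1 nu (P := fun nu => mi_size nu == _)) /=;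
      last exact/eqP.
    rewrite addeCA leeDl // adde_ge0 //.
      by apply: sume_ge0 => *; exact: dist_Lp_norm_ge0.
    by apply: sume_ge0 => *; exact: dist_slobodeckij_ge0.
  by move=> /ereal_inf_lt[_ [f df <-] fc]; exists f.
Qed.

Lemma mollifier_all (I : finType) (P : I -> ('rV[R]_n -> R) -> Prop) :
  (forall i, exists2 d : R, 0 < d & forall rho, mollifier d rho -> P i rho) ->
  exists2 d : R, 0 < d & forall rho, mollifier d rho -> forall i, P i rho.
Proof.
move=> H.
suff [d d0 dP] : exists2 d : R, 0 < d & forall rho, mollifier d rho ->
    forall i, i \in enum I -> P i rho.
  by exists d => // rho /dP h i; apply: h; rewrite mem_enum.
elim: (enum I) => [|i l [d d0 dP]]; first by exists 1.
have [d' d'0 d'P] := H i; exists (Num.min d d'); first by rewrite lt_min d0.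
move=> rho mrho j; rewrite inE => /orP[/eqP ->|jl].
  by apply: d'P; apply: mollifierW mrho; rewrite ge_min lexx orbT.
by apply: dP => //; apply: mollifierW mrho; rewrite ge_min lexx.
Qed.

Lemma pd_local (U : set 'rV[R]_n) l f g : open U -> (forall x, U x -> f x = g x) ->
  forall x, U x -> pd l f x = pd l g x.
Proof.
move=> oU fg; elim: l => [|i l IH] x Ux //=; first exact: fg.
apply: near_eq_derive; have := open_nbhs_nbhs (conj oU Ux).
by apply: filterS => y Uy; exact: IH.
Qed.

(** The product is [n + theta * p] with [0 < theta < 1], in the range where [kernel_shells_lty]
    converges. *)
Lemma frac_exponent s p : 0 <= s -> 1 < p -> thetaof s != 0 ->
  [/\ 0 < thetaof s, n%:R < (n%:R / p + thetaof s) * p &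
      (n%:R / p + thetaof s) * p < n%:R + p].
Proof.
move=> /frac_itv/andP[t0 t1] p1 tn0; have p0 : 0 < p by lra.
have t0' : 0 < thetaof s by rewrite lt_def tn0.
rewrite mulrDl divfK ?gt_eqF //; split => //; first by rewrite ltrDl mulr_gt0.
by rewrite ltrD2l gtr_pMl.
Qed.

End sobolev_norms.

Section approximation_ge0.
Context {R : realType} {n : nat} (Omega : set 'rV[R]_n).
Hypothesis oO : open Omega.
Local Notation mu := (lebesgue_rV n : {measure set 'rV[R]_n -> \bar R}).
Local Notation mu2 := ((lebesgue_rV n \x lebesgue_rV n)%E : {measure set ('rV[R]_n *
  'rV[R]_n)%type -> \bar R}).
Implicit Types (f g : 'rV[R]_n ->
  R) (s p theta : R) (phi psi chi : testfun Omega) (u : testfun Omega -> R).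
Local Notation kof s := (Num.truncn s).
Local Notation thetaof s := (s - (Num.truncn s)%:R).

Lemma testfun_smooth_mul (chi : testfun Omega) (z : 'rV[R]_n -> R) : smooth z ->
  (fun x => chi x * z x) \in is_testfun Omega.
Proof.
move=> sz; have [sf cf fO] := set_mem (testfunP chi).
apply: (@is_testfunS _ _ _ (fsupport chi)) => //; last first.
- move=> x /= h; apply: subset_closure => /=.
  by apply: contra_neq h => ->; rewrite mul0r.
- exact: closed_closure.
- exact: smoothM.
Qed.

Lemma regular_approx_ge0 s p u chi (e : R) : 0 <= s -> 1 < p ->
  (sobolev_norm_ge0 s p (dist_mul chi u) < +oo)%E -> 0 < e ->
  exists psi, (sobolev_norm_ge0 s p (regular_distribution Omega psi - dist_mul chi u)%R
    < e%:E)%E.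
Proof.
move=> s0 p1 woo e0; have p0 : 0 < p by lra.
set w := dist_mul chi u in woo *; set k := kof s; set theta := thetaof s.
pose a := n%:R / p + theta.
have [A B] := sobolev_norm_ge0_lt woo.
(* One density per multi-index; for those of highest order and [theta != 0] it is taken from the
   seminorm clause, so that it serves for both terms of the norm. *)
have /choice[f fP] : forall nu : multiindex n k, exists g, (mi_size nu <= k)%N ->
    Lp_density p (dist_deriv nu w) g /\ (theta != 0 -> mi_size nu = k ->
     (slobodeckij_seminorm Omega theta p g < +oo)%E).
  move=> nu.
  have [/andP[t0 /eqP nuk]|nk] := boolP ((theta != 0) && (mi_size nu == k)).
    by have [g dg gc] := B t0 nu nuk; exists g.
  have [nuk|nuk] := leqP (mi_size nu) k; last by exists (fun=> 0).
  have [g dg _] := A nu nuk; exists g => _; split => // t0 /eqP nuk'.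
  by rewrite t0 nuk' in nk.
have [ssupp csupp supO] := set_mem (testfunP chi).
have [chi' [_ [U [oU suppU U1]]]] := cutoff_exists csupp oO supO.
have Cchi' := testfun_Ccinf chi';
  have mchi' := continuous_measurable_rV (Ccinf_continuous Cchi').
have [M _ chi'M] := Ccinf_bounded Cchi'.
have chichi' x : chi x * chi' x = chi x.
  have [Ux|nUx] := pselect (U x); first by rewrite U1 ?mulr1.
  suff -> : chi x = 0 by rewrite mul0r.
  by apply/eqP/negPn/negP => cx; apply/nUx/suppU; exact: subset_closure.
(* Since [chi'] is 1 near the support of [chi], this is still a density of the same distribution, as
   [reg_g] checks, but one that can be mollified inside [Omega]. *)
pose g nu x := chi' x * (f nu \_ Omega) x.
pose good (nu : multiindex n k) := (mi_size nu <= k)%N.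
have fP1 nu : good nu ->
  measurable_fun setT (f nu \_ Omega) /\ (powint mu p (f nu \_ Omega) < +oo)%E.
  by move=> /fP[[/LpP h _] _]; exact: h.
have mg nu : good nu -> measurable_fun setT (g nu).
  by move=> /fP1[mf _]; exact: measurable_funM.
have goo nu : good nu -> (powint mu p (g nu) < +oo)%E.
  by move=> /fP1[mf foo]; exact: (powint_bounded_mul (ltW p0) mf mchi' chi'M foo).
have lg nu : good nu -> locint (g nu).
  by move=> h; exact: (powint_locint (ltW p1) (mg _ h) (goo _ h)).
have fO nu x : ~ Omega x -> (f nu \_ Omega) x = 0 by move=> Ox; rewrite patchE memNset.
have gO nu x : ~ Omega x -> g nu x = 0 by move=> Ox; rewrite /g fO ?mulr0.
pose cut z (sz : smooth z) : testfun Omega :=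
  Testfun (testfun_smooth_mul chi' sz).
have wf nu phi : good nu -> \int[mu]_x ((f nu \_ Omega) x * phi x) =
    (-1) ^+ mi_size nu * w (testfun_deriv nu phi).
  by move=> /fP[[_ e1] _]; rewrite -regularE -e1.
pose nu0 : multiindex n k := [ffun=> ord0].
have nu0s : mi_size nu0 = 0%N by rewrite /mi_size big1 // => i _; rewrite ffunE.
have nu0d phi : testfun_deriv nu0 phi = phi.
  rewrite /testfun_deriv; elim: (enum 'I_n) => //= i l ->.
  by rewrite ffunE.
have gn0 : good nu0 by rewrite /good nu0s.
(* The weak derivative relation for arbitrary smooth [z]: it is tested on [chi' * z], whose
   derivatives agree with those of [z] wherever [chi] is nonzero. *)
have key nu (z : 'rV[R]_n -> R) : good nu -> smooth z ->
    \int[mu]_x (g nu0 x * pd (mi_seq nu) z x) =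
      (-1) ^+ mi_size nu * \int[mu]_x (g nu x * z x).
  move=> gnu sz; have sdz := smooth_pd (mi_seq nu) sz.
  have -> : \int[mu]_x (g nu0 x * pd (mi_seq nu) z x) =
    \int[mu]_x ((f nu0 \_ Omega) x * cut _ sdz x).
    by apply: eq_Rintegral => x _; rewrite /g /= mulrA (mulrC (chi' x)).
  have -> : \int[mu]_x (g nu x * z x) = \int[mu]_x ((f nu \_ Omega) x * cut _ sz x).
    by apply: eq_Rintegral => x _; rewrite /g /= mulrA (mulrC (chi' x)).
  rewrite wf // wf // nu0s expr0 mul1r nu0d signrMK.
  rewrite /w /dist_mul; congr u; apply: testfun_eq => x /=; rewrite testfun_derivE.
  have [Ux|nUx] := pselect (U x).
    rewrite U1 // mul1r; congr (_ * _); apply: (pd_local _ oU _ Ux).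
    by move=> y Uy /=; rewrite U1 ?mul1r.
  suff -> : chi x = 0 by rewrite !mul0r.
  by apply/eqP/negPn/negP => cx; apply/nUx/suppU; exact: subset_closure.
have reg_g nu : good nu -> dist_deriv nu w = regular_distribution Omega (g nu).
  move=> gnu; apply/funext => phi; rewrite regularE patch_id; last exact: gO.
  have sphi := (testfun_Ccinf phi).1.
  have -> : \int[mu]_x (g nu x * phi x) =
    (-1) ^+ mi_size nu * \int[mu]_x (g nu0 x * pd (mi_seq nu) phi x).
    by rewrite key // signrMK.
  rewrite /dist_deriv; congr (_ * _).
  have sd := (testfun_Ccinf (testfun_deriv nu phi)).1.
  transitivity (\int[mu]_x ((f nu0 \_ Omega) x * cut _ sd x)); last first.
    by apply: eq_Rintegral => x _; rewrite /g /= testfun_derivE mulrA (mulrC (chi' x)).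
  rewrite wf // nu0s mul1r nu0d /w /dist_mul; congr u; apply: testfun_eq => x /=.
  by rewrite mulrA chichi'.
(* [N] is the factor in [sobolev_norm_ge0_le]; dividing [e] by [N.+1] makes the final inequality
   strict. *)
pose N := (2 * #|{: multiindex n k}|)%N.
pose c := e / N.+1%:R.
have c0 : 0 < c by rewrite divr_gt0.
have cp0 : 0 < c `^ p by rewrite powR_gt0.
have [d1 d10 d1P] : exists2 d : R, 0 < d & forall rho, mollifier d rho ->
  forall nu, good nu ->
    (powint mu p (fun x => (convol rho (g nu) x - g nu x)%R) <= (c `^ p)%:E)%E.
  apply: (mollifier_all (P := fun nu rho => good nu ->
    (powint mu p (fun x => (convol rho (g nu) x - g nu x)%R) <= (c `^ p)%:E)%E)) => nu.
  have [gnu|ngnu] := boolP (good nu); last by exists 1 => // rho _ /negP; rewrite ngnu.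
  by have [d d0 dP] := mollify_rV p1 (mg _ gnu) (goo _ gnu) cp0; exists d => // rho /dP.
have [d2 d20 d2P] : exists2 d : R, 0 < d & forall rho, mollifier d rho -> forall nu,
    theta != 0 -> mi_size nu = k ->
    (powint mu2 p (pairdiff a (fun x =>
      (convol rho (g nu) x - g nu x)%R)) <= (c `^ p)%:E)%E.
  apply: (mollifier_all (P := fun nu rho => theta != 0 -> mi_size nu = k ->
    (powint mu2 p (pairdiff a (fun x =>
      (convol rho (g nu) x - g nu x)%R)) <= (c `^ p)%:E)%E)) => nu.
  have [/andP[t0 /eqP nuk]|nk] := boolP ((theta != 0) && (mi_size nu == k)); last first.
    by exists 1 => // rho _ t0 /eqP nuk; rewrite t0 nuk in nk.
  have gnu : good nu by rewrite /good nuk.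
  have [t0' na anp] := @frac_exponent R n s p s0 p1 t0.
  have soo := (fP _ gnu).2 t0 nuk; have [mf foo] := fP1 _ gnu.
  have Qoo : (\int[mu2]_(z in Omega `*` Omega) (`|pairdiff a (f nu \_ Omega) z| `^
    p)%:E < +oo)%E.
    rewrite (slobodeckijE Omega (f nu) p0 t0') (poweR_inv_lty _ p0) in soo.
    apply: le_lt_trans soo; apply: eq_lew.
    apply: eq_integral => z /set_mem[z1 z2].
    by rewrite /pairdiff !patchE !mem_set.
  have goo2 := product_pairdiff_lty Cchi' p0 na anp (open_measurable_rV oO) mf foo (fO
    nu) (@testfun_eq0 _ _ _ chi') Qoo.
  have [d d0 dP] := mollify_rV2 p1 (mg _ gnu) (measurable_kern a) (goo _ gnu) goo2 cp0.
  by exists d => // rho /dP.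
have [sK cK KO] := set_mem (testfunP chi').
have [d3 d30 d3P] := compact_margin cK oO KO.
(* Half of [d3], as [is_testfun_near] needs the margin [2 * d] around the support of [chi']. *)
pose d := Num.min (Num.min d1 d2) (d3 / 2).
have d0 : 0 < d by rewrite !lt_min d10 d20 divr_gt0.
have [rho mrho] := @mollifier_exists R n d d0.
have [Cr _ re _ rd] := mrho.
have mr1 : mollifier d1 rho by apply: mollifierW mrho; rewrite !ge_min lexx.
have mr2 : mollifier d2 rho by apply: mollifierW mrho; rewrite !ge_min lexx orbT.
have tg : convol rho (g nu0) \in is_testfun Omega.
  apply: (is_testfun_near cK d0).
  - move=> h hd; apply: d3P; rewrite (le_trans hd) //.
    by rewrite mulrC -ler_pdivlMr // /d ge_min lexx orbT.
  - exact: smooth_convol Cr (lg _ gn0).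
  - move=> x /(convol_neq0 rd)[y gy xy]; exists y => //.
    apply: subset_closure => /=; apply: contra_neq gy => cy.
    by rewrite /g cy mul0r.
exists (Testfun tg).
have ig nu : good nu -> mu.-integrable setT (EFin \o g nu).
  move=> gnu; have := locint_mul chi' (powint_locint (ltW p1) (fP1 _ gnu).1 (fP1 _
    gnu).2).
  by apply: eq_integrable => // x _ /=; rewrite mulrC.
(* The mollifier is moved onto the test function, where it commutes with derivatives; [key] applies
   to the smooth function so obtained, and the mollifier is moved back. *)
have dpsi nu : good nu -> dist_deriv nu (regular_distribution Omega (Testfun tg)) =
    regular_distribution Omega (convol rho (g nu)).
  move=> gnu; apply/funext => phi; rewrite /dist_deriv !regularE.
  have Cphi := testfun_Ccinf phi.
  have iphi := Ccinf_integrable Cphi.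
  have Cdphi := Ccinf_pd (mi_seq nu) Cphi.
  have lphi := locint_integrable iphi.
  have mrho' := continuous_measurable_rV (Ccinf_continuous Cr).
  have mphi := continuous_measurable_rV (Ccinf_continuous Cphi).
  have mdphi := continuous_measurable_rV (Ccinf_continuous Cdphi).
  rewrite (patch_id (@testfun_eq0 _ _ _ (Testfun tg))) testfun_derivE.
  rewrite (convol_adjoint (Ccinf_continuous Cr) Cr.2 re (ig _ gn0) (Ccinf_integrable
    Cdphi)).
  have -> : convol rho (pd (mi_seq nu) phi) = pd (mi_seq nu) (convol rho phi).
    rewrite convolC // -pd_convol //; last first.
      exact: locint_integrable (Ccinf_integrable Cr).
    by rewrite convolC.
  rewrite key //; last exact: smooth_convol.
  rewrite signrMK.
  rewrite -(convol_adjoint (Ccinf_continuous Cr) Cr.2 re (ig _ gnu) iphi).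
  apply: eq_Rintegral => x _; rewrite patchE; case: ifPn => // /negP xO.
  by rewrite testfun_eq0 ?mulr0 // => Ox; apply/xO/mem_set.
have mc nu : good nu -> measurable_fun setT (convol rho (g nu)).
  move=> gnu; exact: continuous_measurable_rV (smooth_continuous (smooth_convol Cr (lg
    _ gnu))).
have Lc nu : good nu -> Lp Omega p (fun x => convol rho (g nu) x - g nu x).
  move=> gnu; apply/LpP => //.
  have mcg : measurable_fun setT (fun x =>
    convol rho (g nu) x - g nu x) by apply: measurable_funB; [exact: mc|exact: mg].
  split; first exact: measurable_patch.
  apply: le_lt_trans (powint_patch_le oO (ltW p0) mcg) _.
  by apply: le_lt_trans (d1P _ mr1 _ gnu) (ltry _).
have dens nu : good nu ->
  Lp_density p (dist_deriv nu (regular_distribution Omega (Testfun tg) - w))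
    (fun x => convol rho (g nu) x - g nu x).
  move=> gnu; split; first exact: Lc.
  have Lg : Lp Omega p (g nu).
    by apply/LpP => //; rewrite patch_id; [split; [exact: mg|exact: goo]|exact: gO].
  have Lr : Lp Omega p (convol rho (g nu)).
    have := Lc _ gnu; move=> /LpP[//|m1 oo1]; have /LpP[//|m2 oo2] := Lg.
    have mpc := measurable_patch oO (mc _ gnu).
    apply/LpP; [exact: p0|split; first exact: mpc].
    have := powintD_lty (ltW p0) m1 m2 oo1 oo2.
    apply: le_lt_trans; apply: eq_lew.
    apply: eq_integral => x _; rewrite !patchE; case: ifP => // _;
      last by rewrite addr0.
    by rewrite subrK.
  rewrite (regularB (ltW p1) Lr Lg) -dpsi // -reg_g //; apply/funext => phi.
  by rewrite /dist_deriv /= mulrBr.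
apply: (@le_lt_trans _ _ (c *+ N)%:E); last first.
  by rewrite lte_fin -mulr_natr -mulrA gtr_pMr // mulrC ltr_pdivrMr // mul1r ltr_nat.
apply: (sobolev_norm_ge0_le (ltW c0)).
- move=> nu gnu; exists (fun x => convol rho (g nu) x - g nu x); first exact: dens.
  rewrite Lp_normE (poweR_inv_le p0 (ltW c0) (powint_ge0 _ _ _)).
  apply: le_trans (d1P _ mr1 _ gnu); apply: (powint_patch_le oO (ltW p0)).
  by apply: measurable_funB; [exact: mc|exact: mg].
- move=> t0 nu nuk; have [t0' _ _] := @frac_exponent R n s p s0 p1 t0.
  have Q0 z : (0 <= (`|pairdiff a (fun x =>
    convol rho (g nu) x - g nu x) z| `^ p)%:E)%E.
    by rewrite lee_fin powR_ge0.
  have mcg : measurable_fun setT (fun x => convol rho (g nu) x - g nu x).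
    by apply: measurable_funB; [apply: mc|apply: mg]; rewrite /good nuk.
  exists (fun x => convol rho (g nu) x - g nu x).
    by apply: dens; rewrite /good nuk.
  rewrite slobodeckijE //.
  rewrite (poweR_inv_le p0 (ltW c0) (integral_ge0 _ (fun z _ => Q0 z))).
  apply: le_trans (d2P _ mr2 _ t0 nuk).
  apply: ge0_subset_integral => //.
  + by apply: measurableX; exact: open_measurable_rV.
  + by apply: measurable_powint; exact: measurable_pairdiff.
Qed.

End approximation_ge0.

(** * Near-minimizers *)

Section signed_power.
Context {R : realType}.
Implicit Types (a b c e q r x y t : R).

(** For [r <= 1], [powR_dist] with exponent [r^-1] gives a Hoelder bound; for [r > 1], the tangent
    inequality gives a Lipschitz bound on [0, 2]. *)
Lemma powR_unif r e : 0 < r -> 0 < e -> exists2 t, 0 < t & forall x y,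
  0 <= x <= 2 -> 0 <= y <= 2 -> `|x - y| <= t -> `|x `^ r - y `^ r| <= e.
Proof.
move=> r0 e0; have [r1|r1] := leP r 1.
  exists (e `^ r^-1); first exact: powR_gt0.
  move=> x y /andP[x0 _] /andP[y0 _] xy.
  have ir : 1 <= r^-1 by rewrite invf_ge1.
  have := powR_dist (powR_ge0 x r) (powR_ge0 y r) ir.
  rewrite -!powRrM mulfV ?gt_eqF // !powRr1 // => h.
  have K c : 0 <= c -> c = (c `^ r^-1) `^ r.
    by move=> c0; rewrite -powRrM mulVf ?powRr1 // gt_eqF.
  rewrite (K _ (normr_ge0 _)) (K _ (ltW e0)).
  by apply: powR_le; [exact: ltW|exact: powR_ge0|exact: le_trans h xy].
pose M := r * 2 `^ (r - 1).
have M0 : 0 < M by rewrite mulr_gt0 // powR_gt0.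
exists (e / M); first by rewrite divr_gt0.
have main x y : 0 <= x <= 2 -> 0 <= y -> y <= x -> x - y <= e / M ->
  x `^ r - y `^ r <= e.
  move=> /andP[x0 x2] y0 yx xy; have := powR_tangent x0 y0 r1.
  move=> h; have : x `^ r - y `^ r <= r * x `^ (r - 1) * (x - y) by lra.
  move=> /le_trans; apply; apply: (@le_trans _ _ (M * (x - y))).
    rewrite ler_wpM2r ?subr_ge0 // ler_wpM2l ?(ltW r0) // powR_le //.
    by rewrite subr_ge0 ltW.
  by rewrite mulrC -ler_pdivlMr.
move=> x y hx hy xy; have /andP[x0 _] := hx; have /andP[y0 _] := hy.
have [yx|xy'] := leP y x.
  have : y `^ r <= x `^ r by apply: powR_le => //; exact: ltW.
  rewrite ger0_norm ?subr_ge0 // in xy.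
  by move=> h; rewrite ger0_norm ?subr_ge0 //; exact: main.
have : x `^ r <= y `^ r by apply: powR_le => //; exact: ltW.
rewrite distrC ger0_norm ?subr_ge0 ?(ltW xy') // in xy.
by move=> h; rewrite distrC ger0_norm ?subr_ge0 //; apply: main => //; exact: ltW.
Qed.

Lemma powRV q x : 0 < x -> x^-1 `^ q = (x `^ q)^-1.
Proof.
by move=> x0; rewrite -[x^-1](powR_inv1 (ltW x0)) -powRrM mulN1r powRN.
Qed.

(** The signed power, sgn(a) |a|^r. For [r = q - 1] it is the derivative of |a|^q / q. *)
Definition spow r a : R := (Num.max a 0) `^ r - (Num.max (- a) 0) `^ r.

Lemma spow_ge0 r a : 0 < r -> 0 <= a -> spow r a = a `^ r.
Proof.
move=> r0 a0; rewrite /spow (max_idPl a0) (max_idPr _) ?oppr_le0 //.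
by rewrite powR0 ?subr0 // gt_eqF.
Qed.

Lemma spowN r a : spow r (- a) = - spow r a.
Proof. by rewrite /spow opprK opprB. Qed.

Lemma spow_abs r a : 0 < r -> `|spow r a| = `|a| `^ r.
Proof.
move=> r0; have [a0|a0] := leP 0 a.
  by rewrite spow_ge0 // (ger0_norm a0) ger0_norm ?powR_ge0.
have na : 0 <= - a by rewrite oppr_ge0 ltW.
by rewrite -normrN -spowN spow_ge0 // ger0_norm ?powR_ge0 // -(normrN a) ger0_norm.
Qed.

Lemma spow_mul q a : 1 < q -> spow (q - 1) a * a = `|a| `^ q.
Proof.
move=> q1; have r0 : 0 < q - 1 by lra.
have main b : 0 <= b -> spow (q - 1) b * b = `|b| `^ q.
  by move=> b0; rewrite spow_ge0 // ger0_norm // mulrC powR_succ // gt_eqF //; lra.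
have [a0|a0] := leP 0 a; first exact: main.
by rewrite -mulrNN -spowN -normrN main // oppr_ge0 ltW.
Qed.

Lemma spowM r c a : 0 < r -> 0 <= c -> spow r (c * a) = c `^ r * spow r a.
Proof.
move=> r0 c0; have main b : 0 <= b -> spow r (c * b) = c `^ r * spow r b.
  by move=> b0; rewrite !spow_ge0 // ?mulr_ge0 // powRM.
have [a0|a0] := leP 0 a; first exact: main.
have na : 0 <= - a by rewrite oppr_ge0 ltW.
by have := main _ na; rewrite mulrN !spowN mulrN => /oppr_inj.
Qed.

Lemma spow_mul_le r a b : 0 < r -> spow r a * b <= `|a| `^ r * `|b|.
Proof. by move=> r0; rewrite -spow_abs // -normrM ler_norm. Qed.

Lemma spow_tangent q c d : 1 < q ->
  `|c| `^ q + q * (spow (q - 1) c * (d - c)) <= `|d| `^ q.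
Proof.
move=> q1; have r0 : 0 < q - 1 by lra.
have := powR_tangent (normr_ge0 c) (normr_ge0 d) q1.
apply: le_trans; rewrite lerD2l -mulrA ler_wpM2l //; first by lra.
rewrite mulrBr spow_mul // mulrBr [`|c| `^ _ * `|c|]mulrC powR_succ ?gt_eqF //;
  last by lra.
by rewrite lerD2r spow_mul_le.
Qed.

Lemma spow_unif r e : 0 < r -> 0 < e -> exists2 t, 0 < t & forall x y,
  `|x| <= 2 -> `|y| <= 2 -> `|x - y| <= t -> `|spow r x - spow r y| <= e.
Proof.
move=> r0 e0; have e20 : 0 < e / 2 by rewrite divr_gt0.
have [t t0 tP] := powR_unif r0 e20; exists t => // x y x2 y2 xy.
have D (a b : R) : `|Num.max a 0 - Num.max b 0| <= `|a - b|.
  have [a0|a0] := leP a 0; have [b0|b0] := leP b 0.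
  - by rewrite subrr normr0.
  - by rewrite sub0r normrN !(gtr0_norm b0) distrC ger0_norm; lra.
  - by rewrite subr0 (gtr0_norm a0) ger0_norm; lra.
  - by [].
have P (a : R) : `|a| <= 2 -> 0 <= Num.max a 0 <= 2.
  by move=> a2; rewrite le_max lexx orbT ge_max (le_trans (ler_norm a) a2) ler0n.
rewrite /spow (_ : _ - _ - _ = (Num.max x 0 `^ r - Num.max y 0 `^ r) +
  - (Num.max (- x) 0 `^ r - Num.max (- y) 0 `^ r)); last by ring.
rewrite (le_trans (ler_normD _ _)) // normrN (splitr e) lerD //; apply: tP.
- exact: P.
- exact: P.
- exact: le_trans (D _ _) xy.
- by apply: P; rewrite normrN.
- by apply: P; rewrite normrN.
- by apply: le_trans (D _ _) _; rewrite -opprD normrN.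
Qed.

(** The tangent at [a + t * b] bounds the increment by [q * t] times the signed power there times
    [b]. Replacing that signed power by the one at [a] costs the error term; by homogeneity, uniform
    continuity on [-2, 2] makes it uniform in [a] and [b]. *)
Lemma spow_expansion q e : 1 < q -> 0 < e -> exists2 t0, 0 < t0 & forall a b t,
  0 < t <= t0 -> `|a + t * b| `^ q <=
    `|a| `^ q + q * (t * (spow (q - 1) a * b) + t * (e * (`|a| `^ q + `|b| `^ q))).
Proof.
move=> q1 e0; have r0 : 0 < q - 1 by lra.
have q0 : 0 < q by lra.
have [t t0 tP] := spow_unif r0 e0; exists (Num.min t 1);
  first by rewrite lt_min t0 ltr01.
move=> a b s /andP[s0]; rewrite le_min => /andP[st s1].
have main : (spow (q - 1) (a + s * b) - spow (q - 1) a) * b <= e * (`|a| `^ q +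
  `|b| `^ q).
  (* Normalization to [max(|a|, |b|) = 1]; then the sum of the q-th powers is at least 1 and absorbs
     the error [e]. *)
  pose l : R := Num.max `|a| `|b|.
  have l0' : 0 <= l by rewrite le_max normr_ge0.
  have [l0|l0] := eqVneq l 0.
    have b0 : b = 0.
      by apply/eqP; rewrite -normr_le0 -l0 le_max lexx orbT.
    by rewrite b0 mulr0 mulr_ge0 ?(ltW e0) // addr_ge0 // powR_ge0.
  have lp : 0 < l by rewrite lt_def l0.
  pose a' := a / l; pose b' := b / l.
  have aE : a = l * a' by rewrite mulrC divfK.
  have bE : b = l * b' by rewrite mulrC divfK.
  have a'1 : `|a'| <= 1 by rewrite normrM normfV (ger0_norm l0') ler_pdivrMr // mul1r
    le_max lexx.
  have b'1 : `|b'| <= 1 by rewrite normrM normfV (ger0_norm l0') ler_pdivrMr // mul1r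
    le_max lexx orbT.
  have ab1 : 1 <= `|a'| `^ q + `|b'| `^ q.
    have : `|a'| = 1 \/ `|b'| = 1.
      rewrite !normrM normfV (ger0_norm l0') /l.
      have [ab|ab] := leP `|a| `|b|; [right|left]; rewrite divff //.
        by have : l != 0 := l0; rewrite /l (max_idPr ab).
      by have : l != 0 := l0; rewrite /l (max_idPl (ltW ab)).
    have P1 : (1 : R) `^ q = 1 by rewrite powR1.
    by case=> ->; rewrite P1 ?lerDl ?lerDr powR_ge0.
  have -> : a + s * b = l * (a' + s * b') by rewrite {1}aE {1}bE; ring.
  have S : spow (q - 1) a = l `^ (q - 1) * spow (q - 1) a' by rewrite {1}aE spowM.
  rewrite S spowM // -mulrBr {1}bE mulrACA [l `^ _ * l]mulrC powR_succ ?gt_eqF //.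
  have -> : `|a| `^ q + `|b| `^ q = l `^ q * (`|a'| `^ q + `|b'| `^ q).
    by rewrite aE bE !normrM !powRM // (ger0_norm l0') -mulrDr.
  rewrite [leRHS]mulrCA ler_wpM2l ?powR_ge0 //.
  apply: (@le_trans _ _ (e * 1)); last by rewrite ler_wpM2l // ltW.
  rewrite (le_trans (ler_norm _)) // normrM ler_pM //; apply: tP.
  - rewrite (le_trans (ler_normD _ _)) // (_ : 2 =
    1 + 1) // lerD // normrM (gtr0_norm s0).
    by rewrite mulr_ile1 // ltW.
  - by rewrite (le_trans a'1) // ler1n.
  - by rewrite addrAC subrr add0r normrM (gtr0_norm s0) -[leRHS]mulr1 ler_pM // ltW.
have := spow_tangent (a + s * b) a q1.
have -> : a - (a + s * b) = - (s * b) by ring.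
move=> h; set X := `|a + s * b| `^ q in h *; set P := spow _ (a + _) in h main.
have sm : s * ((P - spow (q - 1) a) * b) <= s * (e * (`|a| `^ q + `|b| `^ q)).
  by rewrite ler_wpM2l // ltW.
have qsm := ler_wpM2l (ltW q0) sm.
move: h qsm; set A := `|a| `^ q; set B := `|b| `^ q; set Y := spow _ a => h qsm.
have -> : q * (s * (Y * b) + s * (e * (A + B))) =
  q * (s * (Y * b)) + q * (s * (e * (A + B))) by ring.
have E : q * (P * - (s * b)) = - (q * (s * ((P - Y) * b))) - q * (s * (Y * b)) by ring.
rewrite E in h; lra.
Qed.

End signed_power.

(** * An approximate Euler-Lagrange equation *)

Section variational_pair.
Context {R : realType} {V : lmodType R} (q : R).
Implicit Types (E : V -> R) (A : V -> V -> R) (v x : V).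

(* [E] models a sum of terms [\int |T v|^q] with [T] linear, and [A v] is the
   derivative at [v] of [q^-1 * E]. *)
Definition variational E A := [/\
  forall v, 0 <= E v,
  forall (c : R) v, E (c *: v) = `|c| `^ q * E v,
  forall v x, A v (- x) = - A v x &
  forall e : R, 0 < e -> exists2 t0 : R, 0 < t0 & forall v x (t : R), 0 < t <= t0 ->
    E (v + t *: x) <= E v + q * (t * A v x + t * (e * (E v + E x)))].

Lemma eq_variational E E' A A' : (forall v, E v = E' v) ->
  (forall v x, A v x = A' v x) ->
  variational E' A' -> variational E A.
Proof.
move=> EE AA; have -> : E = E' by apply/funext.
by have -> : A = A' by apply/funext => v; apply/funext => x.
Qed.

Lemma variational0 : variational (fun=> 0) (fun _ _ => 0).
Proof.
split=> [||v x|] //; first by move=> c v; rewrite mulr0.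
  by rewrite oppr0.
by move=> e e0; exists 1 => // v x t _; rewrite addr0 !mulr0 addr0 !mulr0 addr0.
Qed.

Lemma variationalD E1 A1 E2 A2 : variational E1 A1 -> variational E2 A2 ->
  variational (fun v => E1 v + E2 v) (fun v x => A1 v x + A2 v x).
Proof.
move=> [p1 h1 o1 s1] [p2 h2 o2 s2]; split.
- by move=> v; rewrite addr_ge0.
- by move=> c v; rewrite h1 h2 mulrDr.
- by move=> v x; rewrite o1 o2 opprD.
- move=> e e0; have [t1 t10 t1P] := s1 e e0; have [t2 t20 t2P] := s2 e e0.
  exists (Num.min t1 t2); first by rewrite lt_min t10.
  move=> v x t /andP[t0]; rewrite le_min => /andP[tt1 tt2].
  have := lerD (t1P v x t _) (t2P v x t _);
    rewrite t0 tt1 tt2 => /(_ isT isT) /le_trans; apply.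
  by apply: eq_lew; ring.
Qed.

Lemma variational_sum (I : Type) (r : seq I) (P : pred I) (E : I -> V -> R) (A : I ->
  V -> V -> R) :
  (forall i, P i -> variational (E i) (A i)) ->
  variational (fun v => \sum_(i <- r | P i) E i v) (fun v x =>
    \sum_(i <- r | P i) A i v x).
Proof.
move=> h; elim: r => [|i r IH].
  by apply: eq_variational variational0 => [v|v x]; rewrite big_nil.
case: (boolP (P i)) => Pi; last first.
  by apply: eq_variational IH => [v|v x]; rewrite big_cons (negbTE Pi).
apply: eq_variational (variationalD (h i Pi) IH) => [v|v x]; by rewrite big_cons Pi.
Qed.

(* A near-minimizer [v] of [q^-1 * E - w] satisfies the Euler-Lagrange equation
   [w = A v] up to a small error. *)
Lemma near_minimizer E A (w : V -> R) (C : R) : 1 < q -> variational E A -> scalar w ->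
  0 <= C -> (forall v, E v <= 1 -> `|w v| <= C) ->
  forall B e : R, 0 <= B -> 0 < e -> exists v, forall x, E x <= B ->
    `|w x - A v x| <= e.
Proof.
move=> q1 [E0 EZ AN Eexp] lw C0 wC B e B0 e0; have q0 : 0 < q by lra.
have wZ (c : R) x : w (c *: x) = c * w x.
  have w0 : w 0 = 0.
    have := lw 1 0 0; rewrite scaler0 addr0 mul1r.
    by move=> /eqP; rewrite -subr_eq0 opprD addrA subrr sub0r oppr_eq0 => /eqP.
  by have := lw c x 0; rewrite addr0 w0 addr0.
have wD x y : w (x + y) = w x + w y by have := lw 1 x y; rewrite scale1r mul1r.
(* Scaling [x] by [N^-1] brings its energy below 1; the summand 1 in [N] covers [E x = 0]. *)
have wE x : `|w x| <= C * (1 + E x `^ q^-1).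
  pose N := 1 + E x `^ q^-1.
  have N1 : 1 <= N by rewrite lerDl powR_ge0.
  have N0 : 0 < N by lra.
  have : E (N^-1 *: x) <= 1.
    rewrite EZ ger0_norm ?invr_ge0 ?(ltW N0) //.
    have -> : N^-1 `^ q = (N `^ q)^-1 by exact: powRV.
    rewrite mulrC ler_pdivrMr ?powR_gt0 // mul1r.
    have {1}-> : E x = (E x `^ q^-1) `^ q by rewrite -powRrM mulVf ?powRr1 // gt_eqF.
    by rewrite powR_le ?powR_ge0 ?ltW // ltrDr.
  move=> /wC; rewrite wZ normrM ger0_norm ?invr_ge0 ?(ltW N0) // mulrC ler_pdivrMr //.
pose p := (1 - q^-1)^-1.
have iq : 0 < q^-1 < 1 by rewrite invr_gt0 q0 invf_lt1.
have p0 : 0 < p by rewrite invr_gt0; lra.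
have pq : p^-1 + q^-1 = 1 by rewrite invrK subrK.
(* This weight in Young's inequality leaves [E x / (2 * q)], half of the energy term of [J]; the
   other half makes [J] bounded below and coercive. *)
pose K := (2 : R) `^ q^-1.
have K0 : 0 < K by rewrite powR_gt0.
have Kq : K `^ q = 2 by rewrite -powRrM mulVf ?powRr1 // gt_eqF.
pose D := C + (C * K) `^ p / p.
have wY x : `|w x| <= D + E x / (2 * q).
  apply: le_trans (wE x) _; rewrite mulrDr mulr1 /D -addrA lerD2l.
  have CK : 0 <= C * K by rewrite mulr_ge0 // (ltW K0).
  have EK : 0 <= E x `^ q^-1 / K by rewrite divr_ge0 ?powR_ge0 // ltW.
  have := conjugate_powR CK EK p0 q0 pq.
  have -> : C * K * (E x `^ q^-1 / K) = C * E x `^ q^-1 by field; rewrite gt_eqF.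
  move=> /le_trans; apply; rewrite lerD2l le_eqVlt; apply/orP; left; apply/eqP.
  rewrite powRM ?powR_ge0 ?invr_ge0 ?(ltW K0) // -powRrM mulVf ?gt_eqF // powRr1 //.
  have -> : K^-1 `^ q = (K `^ q)^-1 by exact: powRV.
  by rewrite Kq invfM mulrA.
pose J x := E x / q - w x.
have Eq x : E x / (2 * q) = E x / q / 2 by field; rewrite gt_eqF.
have Eq0 x : 0 <= E x / q by rewrite divr_ge0 // ltW.
have Jlb x : - D <= J x.
  have := wY x; rewrite Eq; have := Eq0 x; rewrite ler_norml => h /andP[h1 h2];
    rewrite /J; lra.
have hasinf : has_inf (range J).
  by split; [exists (J 0); exists 0 | exists (- D) => _ [x _ <-]].
have Jinf x : inf (range J) <= J x by apply: ge_inf; [exact: hasinf.2|exists x].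
(* Since [J 0 = 0], the infimum is at most 0, and a point within 1 of it has bounded energy. *)
have Einv x : J x <= inf (range J) + 1 -> E x <= 2 * q * (D + 1).
  move=> Jx; have J0 := Jinf 0; have : J 0 = 0.
    by rewrite /J -(scale0r (0 : V)) EZ wZ normr0 powR0 ?gt_eqF // !mul0r subrr.
  move=> J00; have := wY x; rewrite Eq ler_norml => /andP[h1 h2].
  have : E x / q / 2 <= D + 1 by move: Jx; rewrite /J; lra.
  by rewrite ler_pdivrMr // ler_pdivrMr //;
    rewrite (_ : (D + 1) * 2 * q = 2 * q * (D + 1)) //; ring.
pose M := 2 * q * (D + 1) + B + 1.
have D0 : 0 <= D by rewrite addr_ge0 // divr_ge0 ?powR_ge0 // ltW.
have M0 : 0 < M.
  by rewrite ltr_wpDl // addr_ge0 // !mulr_ge0 ?(ltW q0) // addr_ge0.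
(* The step [t] depends only on [M], which bounds the energies of every near-minimizer and every
   admissible [x] together; hence it can be fixed before [v]. *)
have [t t0 tP] := Eexp (e / (2 * M)) (divr_gt0 e0 (mulr_gt0 (ltr0n _ 2) M0)).
(* The distance to the infimum is measured against [t]: after division by [t], it and the expansion
   error contribute [e / 2] each. *)
pose dl := Num.min 1 (t * (e / 2)).
have dl0 : 0 < dl by rewrite lt_min ltr01 mulr_gt0 // divr_gt0.
have [_ [v _ <-] vJ] := inf_adherent dl0 hasinf.
have Ev : E v <= 2 * q * (D + 1).
  by apply: Einv; rewrite (le_trans (ltW vJ)) // lerD2l ge_min lexx.
exists v.
have main x : E x <= B -> w x - A v x <= e.
  move=> xB; have := tP v x t; rewrite t0 lexx => /(_ isT) h.
  have h1 : J (v + t *: x) <= J v + t * (A v x - w x) + t * (e / 2).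
    rewrite /J wD wZ.
    have : E (v + t *: x) / q <= E v / q + (t * A v x + t * (e / (2 * M) * (E v +
      E x))).
      rewrite ler_pdivrMr // mulrDl divfK ?gt_eqF //.
      by apply: le_trans h _; rewrite [X in _ + X]mulrC.
    have : t * (e / (2 * M) * (E v + E x)) <= t * (e / 2).
      rewrite ler_wpM2l ?(ltW t0) //.
      have EM : E v + E x <= M by rewrite /M; lra.
      apply: (@le_trans _ _ (e / (2 * M) * M)).
        by rewrite ler_wpM2l // divr_ge0 ?(ltW e0) // mulr_ge0 ?(ltW M0).
      by apply: eq_lew; field; rewrite gt_eqF.
    lra.
  have h2 := Jinf (v + t *: x).
  have h3 : inf (range J) + dl <= inf (range J) + t * (e / 2).
    by rewrite lerD2l ge_min lexx orbT.
  have : t * (w x - A v x) <= t * e by lra.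
  by rewrite ler_pM2l.
move=> x xB; rewrite ler_norml main // andbT.
have ENx : E (- x) = E x.
  have e1 : (1 : R) `^ q = 1 by rewrite powR1.
  by rewrite -scaleN1r EZ normrN1 e1 mul1r.
have wNx : w (- x) = - w x by rewrite -scaleN1r wZ mulN1r.
by have := main (- x); rewrite ENx wNx AN => /(_ xB); lra.
Qed.

End variational_pair.

(** * Approximation for s < 0 *)

Section variational_powint.
Context d (T : measurableType d) (R : realType) (m : {measure set T -> \bar R}).
Implicit Types (f g : T -> R) (p q b c : R).

Lemma measurable_spow q f : measurable_fun setT f ->
  measurable_fun setT (fun x => spow q (f x)).
Proof.
move=> mf; apply: measurable_funB; apply: measurable_fun_powRr.
  exact: measurable_maxr.
by apply: measurable_maxr => //; exact: measurable_funN.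
Qed.

Lemma hoelder_le p q f g b c : 0 < p -> 0 < q -> p^-1 + q^-1 = 1 ->
  measurable_fun setT f -> measurable_fun setT g -> 0 <= b -> 0 <= c ->
  (powint m p f <= (b `^ p)%:E)%E -> (powint m q g <= (c `^ q)%:E)%E ->
  m.-integrable setT (EFin \o (fun x =>
    f x * g x)) /\ `|\int[m]_x (f x * g x)| <= b * c.
Proof.
move=> p0 q0 pq mf mg b0 c0 fb gc.
have mfg : measurable_fun setT (fun x => f x * g x) by exact: measurable_funM.
have le : (\int[m]_x `|f x * g x|%:E <= (b * c)%:E)%E.
  have := hoelder m mf mg p0 q0 pq.
  rewrite (Lnorm_powint m p) (Lnorm_powint m q) Lnorm1 => /le_trans; apply;
    rewrite EFinM.
  apply: lee_pmul; rewrite ?poweR_ge0 //.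
    by rewrite poweR_inv_le // powint_ge0.
  by rewrite poweR_inv_le // powint_ge0.
have i : m.-integrable setT (EFin \o (fun x => f x * g x)).
  apply/integrableP; split; first exact/measurable_EFinP.
  exact: le_lt_trans le (ltry _).
split => //; rewrite (le_trans (le_normr_Rintegral measurableT i)) //.
have fin : (\int[m]_x `|f x * g x|%:E)%E \is a fin_num.
  by rewrite ge0_fin_numE ?(le_lt_trans le) ?ltry //; exact: integral_ge0.
by rewrite -lee_fin /Rintegral fineK.
Qed.

(** Comparing [|f|] with [|g|] pointwise, the product is at most [|f| ^ q + |g| ^ q]. *)
Lemma integrable_spow_mul q f g : 1 < q -> measurable_fun setT f ->
  measurable_fun setT g ->
  (powint m q f < +oo)%E -> (powint m q g < +oo)%E ->
  m.-integrable setT (EFin \o (fun x => spow (q - 1) (f x) * g x)).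
Proof.
move=> q1 mf mg foo goo; have r0 : 0 < q - 1 by lra.
have q0 : 0 < q by lra.
have i1 := powint_abs_integrable mf foo; have i2 := powint_abs_integrable mg goo.
apply: le_integrable (integrable_addr measurableT i1 i2) => //.
  by apply/measurable_EFinP; apply: measurable_funM => //; exact: measurable_spow.
move=> x _ /=; rewrite lee_fin normrM spow_abs // [leRHS]ger0_norm ?addr_ge0 ?powR_ge0
  //.
have [fg|gf] := leP `|f x| `|g x|.
  apply: (@le_trans _ _ (`|g x| `^ q)); last by rewrite lerDr powR_ge0.
  rewrite -(@powR_succ _ `|g x| q) ?gt_eqF // mulrC ler_wpM2l //.
  by apply: powR_le => //; exact: ltW.
apply: (@le_trans _ _ (`|f x| `^ q)); last by rewrite lerDl powR_ge0.
rewrite -(@powR_succ _ `|f x| q) ?gt_eqF // mulrC ler_wpM2r ?powR_ge0 //.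
exact: ltW.
Qed.

(** The pointwise expansion can be integrated because its step size does not depend on the point. *)
Lemma variational_powint (V : lmodType R) (L : V -> T -> R) q : 1 < q ->
  (forall (c : R) v w x, L (c *: v + w) x = c * L v x + L w x) ->
  (forall v, measurable_fun setT (L v)) -> (forall v, (powint m q (L v) < +oo)%E) ->
  variational q (fun v => fine (powint m q (L v)))
    (fun v w => \int[m]_x (spow (q - 1) (L v x) * L w x)).
Proof.
move=> q1 lin mL Loo; have q0 : 0 < q by lra.
have L0 x : L 0 x = 0.
  have := lin 1 0 0 x; rewrite scaler0 addr0 mul1r => /eqP.
  by rewrite -subr_eq0 opprD addrA subrr sub0r oppr_eq0 => /eqP.
have LZ c v x : L (c *: v) x = c * L v x by rewrite -[c *: v]addr0 lin L0 addr0.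
split.
- by move=> v; rewrite fine_ge0 // powint_ge0.
- move=> c v.
  have -> : L (c *: v) = (fun x => c * L v x) by apply/funext => x.
  by rewrite powintZ // fineM // ge0_fin_numE // powint_ge0.
- move=> v w; have im := integrable_spow_mul q1 (mL v) (mL w) (Loo v) (Loo w).
  rewrite -[RHS]mulN1r -RintegralZl //.
  by apply: eq_Rintegral => x _; rewrite -scaleN1r LZ !mulN1r mulrN.
- move=> e e0; have [t0 t00 tP] := @spow_expansion R q e q1 e0;
  exists t0 => // v w t tt.
  have iv := powint_abs_integrable (mL v) (Loo v).
  have iw := powint_abs_integrable (mL w) (Loo w).
  have ivw := powint_abs_integrable (mL (v + t *: w)) (Loo (v + t *: w)).
  have im := integrable_spow_mul q1 (mL v) (mL w) (Loo v) (Loo w).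
  have is_ := integrable_addr measurableT iv iw.
  have ies := integrable_scaler measurableT e is_.
  have ites := integrable_scaler measurableT t ies.
  have itm := integrable_scaler measurableT t im.
  have isum := integrable_addr measurableT itm ites.
  have iq := integrable_scaler measurableT q isum.
  have -> : fine (powint m q (L v)) + q *
      (t * (\int[m]_x (spow (q - 1) (L v x) * L w x)) +
       t * (e * (fine (powint m q (L v)) + fine (powint m q (L w))))) =
      \int[m]_x (`|L v x| `^ q + q * (t * (spow (q - 1) (L v x) * L w x) +
        t * (e * (`|L v x| `^ q + `|L w x| `^ q)))).
    rewrite RintegralD // RintegralZl // RintegralD // !RintegralZl //.
    by rewrite RintegralD.
  apply: le_Rintegral => //; first exact: integrable_addr.
  move=> x _; have -> : L (v + t *: w) x = L v x + t * L w x by rewrite addrC lin addrC.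
  exact: tP.
Qed.

End variational_powint.

Section conjugate.
Context {R : realType}.
Implicit Types p : R.

Lemma conjugate_gt1 p : 1 < p -> 1 < conjugate_exponent p.
Proof.
move=> p1; have p0 : 0 < p by lra.
have ip1 : p^-1 < 1 by rewrite invf_lt1.
have ip0 : 0 < p^-1 by rewrite invr_gt0.
by rewrite /conjugate_exponent invf_gt1; lra.
Qed.

Lemma conjugate_eq1 p : p^-1 + (conjugate_exponent p)^-1 = 1.
Proof. by rewrite invrK addrC subrK. Qed.

Lemma conjugate_mul p : 1 < p -> (conjugate_exponent p - 1) * p = conjugate_exponent p.
Proof.
move=> p1; rewrite /conjugate_exponent; have p0 : p != 0 by rewrite gt_eqF //; lra.
have : 1 - p^-1 != 0.
  rewrite subr_eq0 eq_sym; have : p^-1 < 1 by rewrite invf_lt1 //; lra.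
  by move/lt_eqF ->.
by move=> h; field; rewrite p0 /= subr_eq0; apply: contra_neq h => ->;
  rewrite invr1 subrr.
Qed.

End conjugate.

Section dual_approximation.
Context {R : realType} {n : nat} (Omega : set 'rV[R]_n).
Hypothesis oO : open Omega.
Local Notation mu := (lebesgue_rV n : {measure set 'rV[R]_n -> \bar R}).
Local Notation mu2 := ((lebesgue_rV n \x lebesgue_rV n)%E : {measure set ('rV[R]_n *
  'rV[R]_n)%type -> \bar R}).
Implicit Types (f g h : 'rV[R]_n -> R) (p q B e : R) (phi psi eta : testfun Omega).

Lemma testfun_pd l psi : pd l psi \in is_testfun Omega.
Proof.
elim: l => [|i l IH]; first exact: testfunP.
exact: (testfun_partial_subproof i (Testfun IH)).
Qed.

(* An L^p function paired with a derivative of [eta] is nearly a test function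
   paired with [eta], uniformly for bounded derivatives in the dual exponent. *)
Lemma Lp_pd_approx p g (l : seq 'I_n) B e : 1 < p -> measurable_fun setT g ->
  (powint mu p g < +oo)%E -> (forall x, ~ Omega x -> g x = 0) -> 0 <= B -> 0 < e ->
  exists psi, forall eta,
    (powint mu (conjugate_exponent p) (pd l eta) <= (B `^ (conjugate_exponent p))%:E)%E
    ->
    `|\int[mu]_x (g x * pd l eta x) - \int[mu]_x (psi x * eta x)| <= e.
Proof.
move=> p1 mg goo g0 B0 e0; set q := conjugate_exponent p.
have p0 : 0 < p by lra.
have q0 : 0 < q by have := conjugate_gt1 p1; rewrite -/q; lra.
(* Hoelder's inequality yields [c * B <= e]; the [+ 1] covers [B = 0]. *)
pose c := e / (B + 1).
have c0 : 0 < c by rewrite divr_gt0 // ltr_wpDl.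
have [psi0 psiP] := testfun_dense_Lp oO p1 mg goo g0 (powR_gt0 p c0).
have tpsi : (fun x => (-1) ^+ size l * pd (rev l) psi0 x) \in is_testfun Omega.
  exact: (testfunP (((-1) ^+ size l : R) *: Testfun (testfun_pd (rev l) psi0))).
have Cd := Ccinf_pd (rev l) (testfun_Ccinf psi0).
exists (Testfun tpsi) => eta etaB.
have Ceta := testfun_Ccinf eta.
have Cdeta := Ccinf_pd l Ceta.
have mde := continuous_measurable_rV (Ccinf_continuous Cdeta).
have mpsi := continuous_measurable_rV (Ccinf_continuous (testfun_Ccinf psi0)).
have -> : \int[mu]_x (Testfun tpsi x * eta x) = \int[mu]_x (psi0 x * pd l eta x).
  transitivity (\int[mu]_x (pd l eta x * psi0 x));
    last by apply: eq_Rintegral => x _; rewrite mulrC.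
  rewrite integration_by_parts_pd //; last exact: (testfun_Ccinf psi0).1.
  have i : mu.-integrable setT (EFin \o (fun x => eta x * pd (rev l) psi0 x)).
    exact: Ccinf_integrable (CcinfM Ceta Cd.1).
  rewrite -RintegralZl //; apply: eq_Rintegral => x _ /=.
  by rewrite -mulrA (mulrC (pd _ _ _)).
have i1 : mu.-integrable setT (EFin \o (fun x => g x * pd l eta x)).
  have [b b0 gb] : exists2 b : R, 0 <= b & (powint mu p g <= (b `^ p)%:E)%E.
    exists ((fine (powint mu p g)) `^ p^-1); first exact: powR_ge0.
    rewrite -powRrM mulVf ?gt_eqF // powRr1 ?fine_ge0 ?powint_ge0 // fineK //.
    by rewrite ge0_fin_numE // powint_ge0.
  exact: (hoelder_le p0 q0 (conjugate_eq1 p) mg mde b0 B0 gb etaB).1.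
have i2 : mu.-integrable setT (EFin \o (fun x => psi0 x * pd l eta x)).
  exact: Ccinf_integrable (CcinfM (testfun_Ccinf psi0) Cdeta.1).
rewrite -RintegralB //.
have mgp : measurable_fun setT (fun x => g x - psi0 x) by exact: measurable_funB.
have [_ h] := hoelder_le p0 q0 (conjugate_eq1 p) mgp mde (ltW c0) B0 psiP etaB.
have -> : \int[mu]_x (g x * pd l eta x - psi0 x * pd l eta x) =
   \int[mu]_x ((g x - psi0 x) * pd l eta x) by apply: eq_Rintegral => x _;
     rewrite mulrBl.
apply: le_trans h _; rewrite /c -mulrA -[leRHS]mulr1 ler_wpM2l ?(ltW e0) //.
by rewrite mulrC ler_pdivrMr ?mul1r ?lerDl // ltr_wpDl.
Qed.

End dual_approximation.

Section bounded_integrable.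
Context d (T : measurableType d) (R : realType) (m : {measure set T -> \bar R}).

Lemma bounded_integrable (A : set T) (f : T -> R) (M : R) : measurable A ->
  (m A < +oo)%E ->
  measurable_fun setT f -> 0 <= M -> (forall x, `|f x| <= M * \1_A x) ->
  m.-integrable setT (EFin \o f) /\ \int[m]_x `|f x| <= M * fine (m A).
Proof.
move=> mA Aoo mf M0 fM.
have mI : measurable_fun setT (fun x => (\1_A x : R)%:E).
  by apply/measurable_EFinP; exact: measurable_indic.
have le : (\int[m]_x `|f x|%:E <= (M * fine (m A))%:E)%E.
  rewrite EFinM fineK ?ge0_fin_numE //.
  have <- : (\int[m]_x (\1_A x)%:E = m A)%E by rewrite integral_indic // setIT.
  rewrite -ge0_integralZl ?lee_fin //.
  have mabs : measurable_fun setT (fun x => (`|f x|)%:E).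
    by apply/measurable_EFinP; exact: measurableT_comp.
  apply: ge0_le_integral => //; first exact: measurable_funeM.
  by move=> x _; rewrite -EFinM lee_fin.
have i : m.-integrable setT (EFin \o f).
  by apply/integrableP; split; [exact/measurable_EFinP|exact: le_lt_trans le (ltry _)].
split => //; rewrite -lee_fin /Rintegral fineK //.
by rewrite ge0_fin_numE ?(le_lt_trans le) ?ltry //; exact: integral_ge0.
Qed.

End bounded_integrable.

Section marginal.
Context {R : realType} {n : nat}.
Local Notation mu := (lebesgue_rV n : {measure set 'rV[R]_n -> \bar R}).
Local Notation mu2 := ((lebesgue_rV n \x lebesgue_rV n)%E : {measure set ('rV[R]_n *
  'rV[R]_n)%type -> \bar R}).
Implicit Types (f g zeta : 'rV[R]_n -> R) (H : 'rV[R]_n * 'rV[R]_n ->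
  R) (M N : R) (K : set 'rV[R]_n).

Lemma indic_setX K x y : (\1_(K `*` K) (x, y) : R) = \1_K x * \1_K y.
Proof.
rewrite !indicE; have [xK|xK] := pselect (K x); have [yK|yK] := pselect (K y).
- by rewrite !mem_set ?mulr1.
- by rewrite (mem_set xK) (memNset yK) memNset ?mulr0 // => -[].
- by rewrite (memNset xK) memNset ?mul0r // => -[].
- by rewrite (memNset xK) memNset ?mul0r // => -[].
Qed.

(* The second variable contributes the same marginal with the opposite sign. *)
Lemma antisymmetric_marginal K H M : measurable K -> (mu K < +oo)%E ->
  measurable_fun setT H ->
  0 <= M -> (forall z, `|H z| <= M * \1_(K `*` K) z) ->
  (forall x y, H (y, x) = - H (x, y)) ->
  exists g, [/\ measurable_fun setT g, exists2 N, 0 <= N & forall x,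
    `|g x| <= N * \1_K x &
    forall zeta N, measurable_fun setT zeta -> (forall x, `|zeta x| <= N) ->
      \int[mu2]_z (H z * (zeta z.1 - zeta z.2)) = \int[mu]_x (g x * zeta x)].
Proof.
move=> mK Koo mH M0 HM Hanti.
have mKK : measurable (K `*` K) by exact: measurableX.
have KKoo : (mu2 (K `*` K) < +oo)%E.
  have E := product_measure1E (lebesgue_rV n) (lebesgue_rV n) mK mK.
  by rewrite [ltLHS]E lte_mul_pinfty // ge0_fin_numE.
have mHx x : measurable_fun setT (fun y => H (x, y)).
  exact: (measurableT_comp mH (pair1_measurable x)).
have I1 x : \1_K x <= 1 :> R by rewrite indicE; case: (_ \in _).
have I0 x : 0 <= \1_K x :> R by rewrite indicE.
(* The slice of [H] at [x] is bounded by [M * \1_K x] times the indicator of [K], so the marginal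
   again vanishes outside [K]. *)
have Hx x := bounded_integrable mK Koo (mHx x) (mulr_ge0 M0 (I0 x))
  (fun y => le_trans (HM (x, y)) (eq_ind _ (fun t => M * \1_(K `*` K) (x,
    y) <= t) (lexx _) _
     (etrans (congr1 _ (indic_setX K x y)) (mulrA _ _ _)))).
pose g x := \int[mu]_y H (x, y).
have [iH _] := bounded_integrable mKK KKoo mH M0 HM.
have mg : measurable_fun setT g.
  have := measurable_fubini_F (m1 := lebesgue_rV n) (m2 := lebesgue_rV n) iH.
  by move=> h; apply: (measurableT_comp _ h); exact: fine_measurable.
have gM x : `|g x| <= M * fine (mu K) * \1_K x.
  apply: le_trans (le_normr_Rintegral measurableT (Hx x).1) _.
  by apply: le_trans (Hx x).2 _; rewrite mulrAC.
have muK0 : 0 <= M * fine (mu K) by rewrite mulr_ge0 // fine_ge0.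
exists (fun x => 2 * g x); split.
- exact: measurable_funM.
- exists (2 * (M * fine (mu K))); first by rewrite mulr_ge0.
  by move=> x; rewrite normrM ger0_norm // -mulrA ler_wpM2l.
move=> zeta N mz zN; have N0 : 0 <= N by exact: le_trans (normr_ge0 _) (zN 0).
have mHz1 : measurable_fun setT (fun z => H z * zeta z.1).
  by apply: measurable_funM => //; exact: measurableT_comp.
have mHz2 : measurable_fun setT (fun z => H z * zeta z.2).
  by apply: measurable_funM => //; exact: measurableT_comp.
have HzM x z : `|H z * zeta x| <= (M * N) * \1_(K `*` K) z.
  by rewrite normrM mulrAC ler_pM.
have [iHz1 _] := bounded_integrable mKK KKoo mHz1 (mulr_ge0 M0 N0) (fun z => HzM z.1 z).
have [iHz2 _] := bounded_integrable mKK KKoo mHz2 (mulr_ge0 M0 N0) (fun z => HzM z.2 z).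
have mgz : measurable_fun setT (fun x => g x * zeta x) by exact: measurable_funM.
have gzM x : `|g x * zeta x| <= (M * fine (mu K) * N) * \1_K x.
  by rewrite normrM mulrAC ler_pM.
have [igz _] := bounded_integrable mK Koo mgz (mulr_ge0 muK0 N0) gzM.
have E1 : \int[mu2]_z (H z * zeta z.1) = \int[mu]_x (g x * zeta x).
  rewrite /Rintegral; congr fine.
  rewrite -(integral12_prod_meas1 (m1 := lebesgue_rV n) (m2 := lebesgue_rV n) iHz1).
  apply: eq_integral => x _; rewrite /fubini_F /= EFinM /g /Rintegral fineK; last first.
    exact: integrable_fin_num (Hx x).1.
  rewrite muleC -(integralZl measurableT (Hx x).1 (zeta x)).
  by apply: eq_integral => y _; rewrite /= -EFinM mulrC.
have E2 : \int[mu2]_z (H z * zeta z.2) = - \int[mu]_x (g x * zeta x).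
  rewrite -mulN1r -RintegralZl // /Rintegral; congr fine.
  rewrite -(integral21_prod_meas1 (m1 := lebesgue_rV n) (m2 := lebesgue_rV n) iHz2).
  apply: eq_integral => x _; rewrite /fubini_G /= mulN1r -mulrN mulrC EFinM.
  rewrite /g /Rintegral fineK; last exact: integrable_fin_num (Hx x).1.
  rewrite -(integralZl measurableT (Hx x).1 (- zeta x)).
  by apply: eq_integral => y _; rewrite /= -EFinM Hanti !mulNr mulrC.
transitivity (\int[mu2]_z (H z * zeta z.1 - H z * zeta z.2)).
  by apply: eq_Rintegral => z _; rewrite mulrBr.
rewrite RintegralB // E1 E2 opprK.
transitivity (2 * \int[mu]_x (g x * zeta x)); first by ring.
by rewrite -RintegralZl //; apply: eq_Rintegral => x _; rewrite mulrA.
Qed.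

End marginal.

(** * Difference quotients on pairs of points of Omega *)

Section energy.
Context {R : realType} {n : nat} (Omega : set 'rV[R]_n).
Hypothesis oO : open Omega.
Local Notation mu := (lebesgue_rV n : {measure set 'rV[R]_n -> \bar R}).
Local Notation mu2 := ((lebesgue_rV n \x lebesgue_rV n)%E : {measure set ('rV[R]_n *
  'rV[R]_n)%type -> \bar R}).
Implicit Types (f g : 'rV[R]_n ->
  R) (p q t B e a : R) (phi psi eta : testfun Omega) (l : seq 'I_n).

Lemma pd_lin l (c : R) f g : smooth f -> smooth g ->
  pd l (fun x => c * f x + g x) = fun x => c * pd l f x + pd l g x.
Proof.
move=> sf sg; elim: l => //= i l IH; rewrite IH; apply/funext => x.
have df := @smooth_derivable _ _ _ i x (smooth_pd l sf).
have dg := @smooth_derivable _ _ _ i x (smooth_pd l sg).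
rewrite /partial_deriv (deriveD (derivableZ (k := c) df) dg).
by rewrite (deriveZ c df).
Qed.

Lemma Ccinf_powint_lty q f : 0 < q -> Ccinf f -> (powint mu q f < +oo)%E.
Proof.
move=> q0 Cf; have [_ [r fr]] := Cf; have [M M0 fM] := Ccinf_bounded Cf.
have mf := continuous_measurable_rV (Ccinf_continuous Cf).
have mB := @measurable_rV_ball R n r.
have Boo := lebesgue_rV_ball_lty n r.
have mfq : measurable_fun setT (fun x => `|f x| `^ q).
  by apply: measurable_fun_powRr; exact: measurableT_comp.
have fMB x : `| `|f x| `^ q| <= M `^ q * \1_[set x : 'rV[R]_n | `|x| <= r] x.
  rewrite ger0_norm ?powR_ge0 // indicE; have [xr|xr] := lerP `|x| r.
    by rewrite mem_set // mulr1 powR_le // ltW.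
  by rewrite fr // normr0 powR0 ?gt_eqF // mulr_ge0 ?powR_ge0.
have [/integrableP[_ i] _] := bounded_integrable mB Boo mfq (powR_ge0 _ _) fMB.
apply: le_lt_trans i; apply: eq_lew.
by apply: eq_integral => x _ /=; rewrite [in RHS]ger0_norm ?powR_ge0.
Qed.

(** Extension by 0 of the difference quotient from pairs in [Omega], so that the seminorm on [Omega]
    becomes a [powint] over the full product. *)
Definition pairO a f (z : 'rV[R]_n * 'rV[R]_n) : R := \1_(Omega `*` Omega) z * pairdiff
  a f z.

Lemma measurable_pairO a f : measurable_fun setT f -> measurable_fun setT (pairO a f).
Proof.
move=> mf; have mOO : measurable (Omega `*` Omega).
  by apply: measurableX; exact: open_measurable_rV.
have mI : measurable_fun setT (\1_(Omega `*` Omega) : _ -> R) := measurable_indic mOO.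
exact: measurable_funM mI (measurable_pairdiff a mf).
Qed.

Lemma powint_pairO a q f : 0 < q -> powint mu2 q (pairO a f) =
  (\int[mu2]_(z in Omega `*` Omega) (`|pairdiff a f z| `^ q)%:E)%E.
Proof.
move=> q0; rewrite [RHS]integral_mkcond; apply: eq_integral => z _.
rewrite /pairO patchE indicE.
by case: (z \in _); rewrite ?mul1r // mul0r normr0 powR0 ?gt_eqF.
Qed.

Lemma Ccinf_pairO_lty f q a : Ccinf f -> 0 < q -> n%:R < a * q -> a * q < n%:R + q ->
  (powint mu2 q (pairO a f) < +oo)%E.
Proof.
move=> Cf q0 na anq; apply: le_lt_trans (Ccinf_pairdiff_lty Cf q0 na anq).
have mf := continuous_measurable_rV (Ccinf_continuous Cf).
apply: (le_powint _ (ltW q0) (measurable_pairO a mf) (measurable_pairdiff a mf)) => z.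
by rewrite /pairO indicE; case: (_ \in _); rewrite ?mul1r // mul0r normr0.
Qed.

(* Truncating away from the diagonal and from the boundary of Omega makes the
   kernel bounded, so that Fubini's theorem applies. *)
Lemma pairO_approx p a (v : testfun Omega) (l : seq 'I_n) B e :
  let q := conjugate_exponent p in
  1 < p -> n%:R < a * q -> a * q < n%:R + q -> 0 <= B -> 0 < e ->
  exists psi, forall eta, (powint mu q (pd l eta) <= (B `^ q)%:E)%E ->
    (powint mu2 q (pairO a (pd l eta)) <= (B `^ q)%:E)%E ->
    `|\int[mu2]_z (spow (q - 1) (pairO a (pd l v) z) * pairO a (pd l eta) z) -
      \int[mu]_x (psi x * eta x)| <= e.
Proof.
move=> q p1 na anq B0 e0; have p0 : 0 < p by lra.
have q1 : 1 < q := conjugate_gt1 p1; have q0 : 0 < q by lra.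
have r0 : 0 < q - 1 by lra.
have a0 : 0 < a.
  have : 0 < a * q by apply: le_lt_trans na; rewrite ler0n.
  by rewrite pmulr_lgt0.
have Cv := Ccinf_pd l (testfun_Ccinf v).
have mv := continuous_measurable_rV (Ccinf_continuous Cv).
have [Mv Mv0 vM] := Ccinf_bounded Cv.
pose h z := spow (q - 1) (pairO a (pd l v) z).
have mh : measurable_fun setT h by apply: measurable_spow; exact: measurable_pairO.
have hoo : (powint mu2 p h < +oo)%E.
  apply: le_lt_trans (Ccinf_pairO_lty Cv q0 na anq).
  apply: eq_lew; apply: eq_integral => z _.
  by rewrite /h spow_abs // -powRrM conjugate_mul.
pose S j := (exhaust Omega j `*` exhaust Omega j) `&` [set z : 'rV[R]_n * 'rV[R]_n |
  j.+1%:R^-1 <= `|z.1 - z.2|].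
have mS j : measurable (S j).
  apply: measurableI; first by apply: measurableX; exact: measurable_exhaust.
  have mN : measurable_fun setT (fun z : 'rV[R]_n * 'rV[R]_n => `|z.1 - z.2|).
    have mn : measurable_fun setT (fun x : 'rV[R]_n => `|x|).
      by apply: continuous_measurable_rV; exact: norm_continuous.
    exact: measurableT_comp mn measurable_subr_pair.
  have := mN measurableT _ (measurable_itv `[j.+1%:R^-1, +oo[); rewrite setTI.
  congr measurable; apply/seteqP; split => z /=; rewrite in_itv /= andbT //.
have hS z : h z != 0 -> exists N, forall j, (N <= j)%N -> S j z.
  move=> hz; have [[z1 z2]|nz] := pselect ((Omega `*` Omega) z); last first.
    exfalso; move: hz; rewrite /h /pairO indicE memNset // mul0r.
    by rewrite -normr_gt0 spow_abs // normr0 powR0 ?ltxx // gt_eqF.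
  have z12 : 0 < `|z.1 - z.2|.
    rewrite normr_gt0 subr_eq0; apply: contra_neqN hz => /eqP z12.
    rewrite /h /pairO /pairdiff z12 subrr mul0r mulr0.
    by rewrite spow_ge0 // powR0 // gt_eqF.
  have [N1 N1P] := exhaust_near oO z1; have [N2 N2P] := exhaust_near oO z2.
  have [N3 N3P] : exists N3 : nat, `|z.1 - z.2|^-1 <= N3%:R.
    by exists (Num.bound `|z.1 - z.2|^-1); rewrite ltW // archi_boundP // invr_ge0.
  exists (maxn N1 (maxn N2 N3)) => j; rewrite !geq_max => /and3P[j1 j2 j3].
  split; first by split; [exact: N1P|exact: N2P].
  rewrite /= -[leRHS]invrK lef_pV2 ?posrE ?invr_gt0 ?ltr0n //.
  by rewrite (le_trans N3P) // ler_nat (leq_trans j3).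
(* Half of [e] pays for the truncation, through Hoelder's inequality; the other half is left for
   [Lp_pd_approx]. *)
pose c := e / 2 / (B + 1).
have c0 : 0 < c by rewrite !divr_gt0 // ltr_wpDl.
have [j /(_ j (leqnn j)) jP] := powint_trunc p0 mh hoo mS hS (powR_gt0 p c0).
pose hj z := h z * \1_(S j) z.
have mI : measurable_fun setT (\1_(S j) : _ -> R) := measurable_indic (mS j).
have mhj : measurable_fun setT hj by exact: measurable_funM mh mI.
(* The weight belonging to [eta] is moved into [H], so that plain increments of the derivative of
   [eta] remain, as [antisymmetric_marginal] requires. *)
pose H z := hj z * kern a (z.1 - z.2).
have mH : measurable_fun setT H.
  exact: measurable_funM mhj (measurableT_comp (measurable_kern a)
    measurable_subr_pair).
pose k : R := j.+1%:R `^ a.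
have k0 : 0 <= k by exact: powR_ge0.
have kS z : S j z -> kern a (z.1 - z.2) <= k.
  move=> [_ /= zj]; apply: le_trans (kern_le _ a0) _.
  rewrite powRN /k -[leRHS]invrK lef_pV2 ?posrE ?invr_gt0 ?powR_gt0 ?ltr0n //;
    last first.
    by apply: lt_le_trans zj; rewrite invr_gt0 ltr0n.
  rewrite -powRV ?ltr0n //; apply: powR_le => //; first exact: ltW.
(* On [S j] the weight is at most [k], a difference quotient of [v] at most [(Mv + Mv) * k], and its
   signed power is multiplied by one more weight. *)
pose M := ((Mv + Mv) * k) `^ (q - 1) * k.
have M0 : 0 <= M by rewrite mulr_ge0 // powR_ge0.
pose K := exhaust Omega j.
have mK : measurable K := measurable_exhaust Omega j.
have Koo : (mu K < +oo)%E.
  apply: le_lt_trans (lebesgue_rV_ball_lty n j%:R); apply: le_measure.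
  - by rewrite inE.
  - by rewrite inE; exact: measurable_rV_ball.
  - by move=> x [].
have HM z : `|H z| <= M * \1_(K `*` K) z.
  rewrite /H /hj indicE; have [Sz|nSz] := pselect (S j z); last first.
    by rewrite memNset // mulr0 mul0r normr0 mulr_ge0 // indicE.
  rewrite mem_set // mulr1 indicE mem_set; last by case: Sz.
  rewrite mulr1 normrM (ger0_norm (kern_ge0 _ _)) /M ler_pM ?kern_ge0 ?kS //.
  rewrite /h spow_abs //; apply: powR_le => //; first exact: ltW.
  have [[z1 z2] _] := Sz; rewrite /pairO indicE mem_set; last first.
    by split; [exact: exhaust_sub z1|exact: exhaust_sub z2].
  rewrite mul1r /pairdiff normrM (ger0_norm (kern_ge0 _ _)) ler_pM ?kern_ge0 ?kS //.
  by rewrite (le_trans (ler_normB _ _)) // lerD.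
(* The truncation set is symmetric, the weight even, the increment odd, and the signed power
   preserves oddness. *)
have Hanti x y : H (y, x) = - H (x, y).
  have S1 : \1_(S j) (y, x) = \1_(S j) (x, y) :> R.
    rewrite !indicE; suff -> : ((y, x) \in S j) = ((x, y) \in S j) by [].
    apply/idP/idP => /set_mem[[/= s1 s2] s3]; apply/mem_set.
      by split; [|rewrite /= distrC].
    by split; [|rewrite /= distrC].
  have S2 : \1_(Omega `*` Omega) (y, x) = \1_(Omega `*` Omega) (x, y) :> R.
    by rewrite !indic_setX mulrC.
  have S3 : pairdiff a (pd l v) (y, x) = - pairdiff a (pd l v) (x, y).
    by rewrite /pairdiff /= -mulNr opprB -[y - x]opprB kernN.
  rewrite /H /hj S1 /h /pairO S2 S3 mulrN spowN /= -[y - x]opprB kernN.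
  by rewrite !mulNr.
have [g [mg [N N0 gN] gP]] := antisymmetric_marginal mK Koo mH M0 HM Hanti.
have gO x : ~ Omega x -> g x = 0.
  move=> Ox; apply/eqP;
    rewrite -normr_le0 (le_trans (gN x)) // indicE memNset ?mulr0 //.
  by move=> /exhaust_sub.
have goo : (powint mu p g < +oo)%E.
  have mgp : measurable_fun setT (fun x => `|g x| `^ p).
    by apply: measurable_fun_powRr; exact: measurableT_comp.
  have gp x : `| `|g x| `^ p| <= N `^ p * \1_K x.
    rewrite ger0_norm ?powR_ge0 //; have := gN x; rewrite indicE; case: (_ \in _).
      by rewrite !mulr1 => ?; apply: powR_le => //; exact: ltW.
    by rewrite !mulr0 normr_le0 => /eqP ->; rewrite normr0 powR0 ?gt_eqF.
  have [/integrableP[_ i] _] := bounded_integrable mK Koo mgp (powR_ge0 _ _) gp.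
  apply: le_lt_trans i; apply: eq_lew.
  by apply: eq_integral => x _ /=; rewrite [in RHS]ger0_norm ?powR_ge0.
have e20 : 0 < e / 2 by rewrite divr_gt0.
have [psi psiP] := Lp_pd_approx oO l p1 mg goo gO B0 e20.
exists psi => eta etaB1 etaB2.
have Ce := Ccinf_pd l (testfun_Ccinf eta).
have me := continuous_measurable_rV (Ccinf_continuous Ce).
have [Me _ eM] := Ccinf_bounded Ce.
have mQ := measurable_pairO a me.
have mhh : measurable_fun setT (fun z => h z - hj z) by exact: measurable_funB mh mhj.
have pq := conjugate_eq1 p.
have [i1 h1] := hoelder_le p0 q0 pq mhh mQ (ltW c0) B0 jP etaB2.
have E : \int[mu2]_z (hj z * pairO a (pd l eta) z) = \int[mu]_x (g x * pd l eta x).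
  rewrite -(gP _ _ me eM); apply: eq_Rintegral => z _; rewrite /H /pairO /pairdiff.
  have [Sz|nSz] := pselect (S j z);
    last by rewrite /hj [\1_(S j) z]indicE memNset // mulr0 !mul0r.
  rewrite [\1__ z]indicE mem_set ?mul1r; last first.
    by have [[z1 z2] _] := Sz; split; [exact: exhaust_sub z1|exact: exhaust_sub z2].
  by rewrite mulrA mulrAC.
have i2 : mu2.-integrable setT (EFin \o (fun z => h z * pairO a (pd l eta) z)).
  have Qoo : (powint mu2 q (pairO a (pd l eta)) < +oo)%E by exact: le_lt_trans etaB2
    (ltry _).
  exact: integrable_spow_mul q1 (measurable_pairO a mv) mQ (Ccinf_pairO_lty Cv q0 na
    anq) Qoo.
have i3 : mu2.-integrable setT (EFin \o (fun z => hj z * pairO a (pd l eta) z)).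
  have := integrable_subr measurableT i2 i1.
  apply: eq_integrable => // z _ /=; congr _%:E; ring.
have D : \int[mu2]_z (h z * pairO a (pd l eta) z) - \int[mu2]_z (hj z * pairO a (pd l
  eta) z) =
   \int[mu2]_z ((h z - hj z) * pairO a (pd l eta) z).
  rewrite -RintegralB //.
  by apply: eq_Rintegral => z _; rewrite [RHS]mulrBl.
have cB : c * B <= e / 2.
  rewrite /c -mulrA -[leRHS]mulr1 ler_wpM2l ?(ltW e20) //.
  by rewrite mulrC ler_pdivrMr ?mul1r ?lerDl // ltr_wpDl.
have := psiP _ etaB1; rewrite -E => h2.
rewrite (splitr e).
have -> : \int[mu2]_z (spow (q - 1) (pairO a (pd l v) z) * pairO a (pd l eta) z) -
    \int[mu]_x (psi x * eta x) =
   (\int[mu2]_z (h z * pairO a (pd l eta) z) - \int[mu2]_z (hj z * pairO a (pd l eta)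
     z)) +
   (\int[mu2]_z (hj z * pairO a (pd l eta) z) - \int[mu]_x (psi x * eta x)).
  by rewrite addrA subrK.
rewrite (le_trans (ler_normD _ _)) // lerD // D.
exact: le_trans h1 cB.
Qed.

End energy.

(** * Scaling, pairing with test functions and uniqueness of densities *)

Section norm_scaling.
Context {R : realType} {n : nat} (Omega : set 'rV[R]_n).
Hypothesis oO : open Omega.
Local Notation mu := (lebesgue_rV n : {measure set 'rV[R]_n -> \bar R}).
Local Notation mu2 := ((lebesgue_rV n \x lebesgue_rV n)%E : {measure set ('rV[R]_n *
  'rV[R]_n)%type -> \bar R}).
Implicit Types (f g : 'rV[R]_n ->
  R) (s t p q c d : R) (phi psi eta : testfun Omega) (u v : testfun Omega -> R).
Local Notation kof s := (Num.truncn s).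
Local Notation thetaof s := (s - (Num.truncn s)%:R).
Local Notation reg := (regular_distribution Omega).

Lemma patchM c f : (fun x => c * f x) \_ Omega = fun x => c * (f \_ Omega) x.
Proof. by apply/funext => x; rewrite !patchE; case: ifP => // _; rewrite mulr0. Qed.

Lemma LpZ p c f : 0 < p -> Lp Omega p f -> Lp Omega p (fun x => c * f x).
Proof.
move=> p0 /(LpP _ _ p0)[mf foo]; apply/(LpP _ _ p0); rewrite patchM; split.
  exact: measurable_funM.
by rewrite (powintZ mu p c mf) lte_mul_pinfty // lee_fin powR_ge0.
Qed.

Lemma LpB p f g : 0 < p -> Lp Omega p f -> Lp Omega p g ->
  Lp Omega p (fun x => f x - g x).
Proof.
move=> p0 /LpP[//|mf foo] /LpP[//|mg goo].
have E : (fun x => f x - g x) \_ Omega = fun x => (f \_ Omega) x + - (g \_ Omega) x.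
  by apply/funext => x; rewrite !patchE; case: ifP => // _; rewrite subr0.
have mNg : measurable_fun setT (fun x => - (g \_ Omega) x) by exact: measurable_funN.
have Ngoo : (powint mu p (fun x => (- (g \_ Omega) x)%R) < +oo)%E by rewrite powintN.
apply/(LpP _ _ p0); rewrite E; split; first exact: measurable_funD.
exact: powintD_lty (ltW p0) mf mNg foo Ngoo.
Qed.

Lemma regularZ p c f : 1 <= p -> Lp Omega p f ->
  reg (fun x => c * f x) = c *: reg f.
Proof.
move=> p1; have p0 : 0 < p by apply: lt_le_trans p1.
move=> /LpP[//|mf foo]; apply/funext => psi.
transitivity (c * reg f psi) => //.
rewrite !regularE -RintegralZl //; last exact: locint_mul (powint_locint p1 mf foo).
by rewrite patchM; apply: eq_Rintegral => x _; rewrite mulrA.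
Qed.

Lemma dist_derivZ k (nu : multiindex n k) c u : dist_deriv nu (c *: u) =
  c *: dist_deriv nu u.
Proof. by apply/funext => psi; rewrite /dist_deriv /= mulrCA. Qed.

Lemma dist_derivB k (nu : multiindex n k) u v :
  dist_deriv nu (u - v) = dist_deriv nu u - dist_deriv nu v.
Proof. by apply/funext => psi; rewrite /dist_deriv /= mulrBr. Qed.

Lemma Lp_normZ p c f : 0 < p -> 0 <= c -> Lp Omega p f -> forall d, 0 <= d ->
  (Lp_norm Omega p f <= d%:E -> Lp_norm Omega p (fun x => c * f x)%R <= (c * d)%:E)%E.
Proof.
move=> p0 c0 /LpP[//|mf foo] d d0; rewrite !Lp_normE patchM => h.
rewrite (poweR_inv_le p0 d0 (powint_ge0 _ _ _)) in h.
rewrite (poweR_inv_le p0 (mulr_ge0 c0 d0) (powint_ge0 _ _ _)) (powintZ mu p c mf).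
rewrite powRM // EFinM (ger0_norm c0); apply: lee_pmul => //;
  first by rewrite lee_fin powR_ge0.
exact: powint_ge0.
Qed.

Lemma slobodeckijZ theta p c f : 0 < p -> 0 < theta -> 0 <= c -> Lp Omega p f ->
  forall d, 0 <= d ->
  (slobodeckij_seminorm Omega theta p f <= d%:E ->
   slobodeckij_seminorm Omega theta p (fun x => c * f x)%R <= (c * d)%:E)%E.
Proof.
move=> p0 t0 c0 /LpP[//|mf foo] d d0; rewrite !slobodeckijE //.
rewrite -!powint_pairO //; set a := n%:R / p + theta.
have patchO g : pairO Omega a g = pairO Omega a (g \_ Omega).
  apply/funext => z; rewrite /pairO indicE.
  have [[z1 z2]|nz] := pselect ((Omega `*` Omega) z); last by rewrite memNset // !mul0r.
  by rewrite /pairdiff !patchE !mem_set.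
have E : pairO Omega a (fun x => c * f x) = fun z => c * pairO Omega a (f \_ Omega) z.
  by rewrite patchO patchM; apply/funext => z; rewrite /pairO /pairdiff -mulrBr; ring.
rewrite E patchO => h.
rewrite (poweR_inv_le p0 d0 (powint_ge0 _ _ _)) in h.
rewrite (poweR_inv_le p0 (mulr_ge0 c0 d0) (powint_ge0 _ _ _)) (powintZ mu2 p c
  (measurable_pairO oO a mf)).
rewrite powRM // EFinM (ger0_norm c0); apply: lee_pmul => //;
  first by rewrite lee_fin powR_ge0.
exact: powint_ge0.
Qed.

Definition mi_count s : nat := (2 * #|{: multiindex n (kof s)}|)%N.

(** Homogeneity up to the factor [mi_count], by scaling the densities one by one. The later uses
    divide by a constant large enough to absorb it. *)
Lemma sobolev_norm_ge0_scale s p c d u : 0 <= s -> 1 < p -> 0 <= c -> 0 <= d ->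
  (sobolev_norm_ge0 s p u < d%:E)%E ->
  (sobolev_norm_ge0 s p (c *: u) <= ((c * d) *+ mi_count s)%:E)%E.
Proof.
move=> s0 p1 c0 d0 ud; have p0 : 0 < p by lra.
have [A B] := sobolev_norm_ge0_lt ud.
apply: sobolev_norm_ge0_le; first exact: mulr_ge0.
  move=> nu /A[f [Lf df] fd]; exists (fun x => c * f x).
    by split; [exact: LpZ|rewrite dist_derivZ df (regularZ _ (ltW p1) Lf)].
  exact: Lp_normZ (ltW fd).
move=> t0 nu nuk; have [t0' _ _] := @frac_exponent R n s p s0 p1 t0.
have [f [Lf df] fd] := B t0 nu nuk; exists (fun x => c * f x).
  by split; [exact: LpZ|rewrite dist_derivZ df (regularZ _ (ltW p1) Lf)].
exact: slobodeckijZ (ltW fd).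
Qed.

Definition mi0 k : multiindex n k := [ffun=> ord0].

Lemma mi_size0 k : mi_size (mi0 k) = 0%N.
Proof. by rewrite /mi_size big1 // => i _; rewrite ffunE. Qed.

Lemma testfun_deriv0 k psi : testfun_deriv (mi0 k) psi = psi.
Proof.
rewrite /testfun_deriv; elim: (enum 'I_n) => //= i l ->.
by rewrite ffunE.
Qed.

Lemma dist_deriv0 k u : dist_deriv (mi0 k) u = u.
Proof. by apply/funext => psi; rewrite /dist_deriv mi_size0 mul1r testfun_deriv0. Qed.

(** The multi-index 0 gives an L^q density of [u], to which Hoelder's inequality applies. Evaluation
    at [psi] is thus a bounded functional, and it extends the distribution of [psi] beyond test
    functions. *)
Lemma sobolev_ge0_pairing_le t q p psi : 0 <= t -> 0 < q -> 0 < p -> q^-1 + p^-1 = 1 ->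
  exists2 C : R, 0 <= C & forall u d, 0 <= d -> (sobolev_norm_ge0 t q u < d%:E)%E ->
    `|u psi| <= C * d.
Proof.
move=> t0 q0 p0 pq; have Cpsi := testfun_Ccinf psi.
have poo := Ccinf_powint_lty p0 Cpsi.
have mpsi := continuous_measurable_rV (Ccinf_continuous Cpsi).
exists ((fine (powint mu p psi)) `^ p^-1); first exact: powR_ge0.
move=> u d d0 /sobolev_norm_ge0_lt[A _].
have nu0 : (mi_size (mi0 (kof t)) <= kof t)%N by rewrite mi_size0.
have [f [/(LpP _ _ q0)[mf foo] df] fd] := A (mi0 (kof t)) nu0.
rewrite dist_deriv0 in df; rewrite df regularE mulrC.
apply: (hoelder_le q0 p0 pq mf mpsi d0 (powR_ge0 _ _) _ _).2.
  by rewrite -(poweR_inv_le q0 d0 (powint_ge0 _ _ _)); rewrite Lp_normE in fd;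
    exact: ltW.
rewrite -powRrM mulVf ?gt_eqF // powRr1 ?fine_ge0 ?powint_ge0 // fineK //.
by rewrite ge0_fin_numE; [exact: poo|exact: powint_ge0].
Qed.

Lemma dist_mul_regular phi psi : dist_mul phi (reg psi) = reg (testfun_mul phi psi).
Proof.
apply/funext => eta; rewrite /dist_mul !regularE; apply: eq_Rintegral => x _.
by rewrite !patchE; case: ifP => _ /=; rewrite ?mul0r // mulrA (mulrC (psi x)).
Qed.

Lemma testfun_Lp p psi : 0 < p -> Lp Omega p psi.
Proof.
move=> p0; have Cpsi := testfun_Ccinf psi; apply/LpP => //.
rewrite (patch_id (@testfun_eq0 _ _ _ psi)); split; last exact: Ccinf_powint_lty.
exact: continuous_measurable_rV (Ccinf_continuous Cpsi).
Qed.

Lemma regular_testfunB psi phi : reg (psi - phi) = reg psi - reg phi.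
Proof. exact: (regularB (lexx 1) (testfun_Lp psi ltr01) (testfun_Lp phi ltr01)). Qed.

Lemma regular_testfunZ c psi : reg (c *: psi) = c *: reg psi.
Proof. exact: (regularZ c (lexx 1) (testfun_Lp psi ltr01)). Qed.

Lemma density_unique p f g : 1 < p -> Lp Omega p f -> Lp Omega p g -> reg f = reg g ->
  powint mu p (fun x => ((f \_ Omega) x - (g \_ Omega) x)%R) = 0%E.
Proof.
move=> p1 Lf Lg fg; have p0 : 0 < p by lra.
have /(LpP _ _ p0)[m oo] := LpB p0 Lf Lg.
have E : (fun x => f x - g x) \_ Omega = fun x => (f \_ Omega) x - (g \_ Omega) x.
  by apply/funext => x; rewrite !patchE; case: ifP => // _; rewrite subr0.
rewrite -E; apply: (du_bois_reymond oO p1 m oo).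
  by move=> x Ox; rewrite patchE memNset.
by move=> psi; rewrite -regularE (regularB (ltW p1) Lf Lg) fg subrr.
Qed.

(** If [f] vanishes off a null set [N], its difference quotient vanishes off the pairs with a point
    in [N], which form a null set of the product. *)
Lemma pairO_null q a f : 0 < q -> measurable_fun setT f -> powint mu q f = 0%E ->
  powint mu2 q (pairO Omega a f) = 0%E.
Proof.
move=> q0 mf f0; have mfq := measurable_powint q mf.
have : ae_eq mu setT (fun x => (`|f x| `^ q)%:E) (cst 0%E).
  apply/(ae_eq_integral_abs mu measurableT mfq).
  by rewrite -[RHS]f0; apply: eq_integral => x _; rewrite /= ger0_norm ?powR_ge0.
move=> [N [mN N0 fN]].
have mNT : measurable (N `*` [set: 'rV[R]_n]) by exact: measurableX.
have mTN : measurable ([set: 'rV[R]_n] `*` N) by exact: measurableX.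
have fN' x : ~ N x -> f x = 0.
  move=> Nx; apply/eqP/negPn/negP => fx; apply: Nx; apply: fN => /= h.
  have : `|f x| `^ q = 0 by have := h I => -[].
  by move=> /eqP; rewrite powR_eq0 normr_eq0 (negbTE fx).
have mQ := measurable_powint q (measurable_pairO oO a mf).
apply/eqP; rewrite eq_le powint_ge0 andbT -(integral0 mu2 setT).
apply: eq_lew.
apply: (ae_eq_integral _ _ measurableT mQ (measurable_cst 0%E)).
exists ((N `*` setT) `|` (setT `*` N)); split.
- exact: measurableU.
- apply/eqP; rewrite eq_le measure_ge0 andbT.
  have E1 : mu2 (N `*` setT) = 0%E.
    have E := product_measure1E (lebesgue_rV n) (lebesgue_rV n) mN measurableT.
    by rewrite [LHS]E N0 mul0e.
  have E2 : mu2 (setT `*` N) = 0%E.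
    have E := product_measure1E (lebesgue_rV n) (lebesgue_rV n) measurableT mN.
    by rewrite [LHS]E N0 mule0.
  apply: le_trans (measureU2 mu2 mNT mTN) _; rewrite -[leRHS]adde0.
  apply: leeD; apply: eq_lew; [exact: E1|exact: E2].
- move=> z /= nz; have [z1|z1] := pselect (N z.1); first by left.
  have [z2|z2] := pselect (N z.2); first by right.
  exfalso; apply: nz => _.
  by rewrite /pairO /pairdiff !fN' // subrr mul0r mulr0 normr0 powR0 // gt_eqF.
Qed.

End norm_scaling.

Arguments mi_count {R} n s.

(** * Comparison of the energy with the Sobolev norm *)

Section energy_norm.
Context {R : realType} {n : nat} (Omega : set 'rV[R]_n).
Hypothesis oO : open Omega.
Variables (t q : R).
Hypotheses (t0 : 0 <= t) (q1 : 1 < q).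
Local Notation mu := (lebesgue_rV n : {measure set 'rV[R]_n -> \bar R}).
Local Notation mu2 := ((lebesgue_rV n \x lebesgue_rV n)%E : {measure set ('rV[R]_n *
  'rV[R]_n)%type -> \bar R}).
Local Notation k := (Num.truncn t).
Local Notation theta := (t - (Num.truncn t)%:R).
Local Notation a := (n%:R / q + theta).
Local Notation reg := (regular_distribution Omega).
Implicit Types (v eta psi : testfun Omega) (nu : multiindex n k).

Let q0 : 0 < q := lt_trans ltr01 q1.

Definition mi_deriv nu eta : 'rV[R]_n -> R := pd (rev (mi_seq nu)) eta.

Definition Lp_energy nu eta : R := fine (powint mu q (mi_deriv nu eta)).
Definition slob_energy nu eta : R := fine (powint mu2 q (pairO Omega a (mi_deriv nu
  eta))).

Definition energy eta : R :=
  \sum_(nu | (mi_size nu <= k)%N) Lp_energy nu eta +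
  \sum_(nu | (theta != 0) && (mi_size nu == k)) slob_energy nu eta.

Definition pairing v eta : R :=
  \sum_(nu | (mi_size nu <= k)%N)
    \int[mu]_x (spow (q - 1) (mi_deriv nu v x) * mi_deriv nu eta x) +
  \sum_(nu | (theta != 0) && (mi_size nu == k))
    \int[mu2]_z (spow (q - 1) (pairO Omega a (mi_deriv nu v) z) *
                 pairO Omega a (mi_deriv nu eta) z).

Lemma Ccinf_mi_deriv nu eta : Ccinf (mi_deriv nu eta).
Proof. exact: Ccinf_pd (testfun_Ccinf eta). Qed.

Lemma measurable_mi_deriv nu eta : measurable_fun setT (mi_deriv nu eta).
Proof. exact: continuous_measurable_rV (Ccinf_continuous (Ccinf_mi_deriv nu eta)). Qed.

Lemma Lp_energy_lty nu eta : (powint mu q (mi_deriv nu eta) < +oo)%E.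
Proof. exact: Ccinf_powint_lty q0 (Ccinf_mi_deriv nu eta). Qed.

Lemma slob_energy_lty nu eta : theta != 0 ->
  (powint mu2 q (pairO Omega a (mi_deriv nu eta)) < +oo)%E.
Proof.
move=> tn0; have [_ na anq] := @frac_exponent R n t q t0 q1 tn0.
exact: (Ccinf_pairO_lty oO (Ccinf_mi_deriv nu eta) q0 na anq).
Qed.

Lemma mi_deriv_lin nu (c : R) v eta x :
  mi_deriv nu (c *: v + eta) x = c * mi_deriv nu v x + mi_deriv nu eta x.
Proof.
exact: (congr1 (fun f =>
  f x) (pd_lin (rev (mi_seq nu)) c (testfun_Ccinf v).1 (testfun_Ccinf eta).1)).
Qed.

Lemma energy_variational : variational q energy pairing.
Proof.
apply: variationalD; apply: variational_sum => nu Pnu.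
  apply: (variational_powint q1 (mi_deriv_lin nu)).
    exact: measurable_mi_deriv.
  exact: Lp_energy_lty.
have /andP[tn0 _] := Pnu.
apply: (@variational_powint _ _ _ mu2 _ (fun eta =>
  pairO Omega a (mi_deriv nu eta)) q q1).
- move=> c v w z; rewrite /pairO /pairdiff !mi_deriv_lin; ring.
- by move=> v; apply: measurable_pairO => //; exact: measurable_mi_deriv.
- by move=> v; exact: slob_energy_lty.
Qed.

Lemma Lp_energy_ge0 nu eta : 0 <= Lp_energy nu eta.
Proof. by rewrite fine_ge0 // powint_ge0. Qed.

Lemma slob_energy_ge0 nu eta : 0 <= slob_energy nu eta.
Proof. by rewrite fine_ge0 // powint_ge0. Qed.

Lemma energy_ge0 eta : 0 <= energy eta.
Proof.
by apply: addr_ge0; apply: sumr_ge0 => *; [exact: Lp_energy_ge0|exact: slob_energy_ge0].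
Qed.

Lemma Lp_energy_le nu eta (B : R) : (mi_size nu <= k)%N -> energy eta <= B ->
  (powint mu q (mi_deriv nu eta) <= B%:E)%E.
Proof.
move=> nuk; rewrite -lee_fin; apply: le_trans.
rewrite -[leLHS]fineK ?ge0_fin_numE ?powint_ge0 //; last exact: Lp_energy_lty.
rewrite lee_fin /energy (bigD1 nu) //= -addrA lerDl addr_ge0 //; apply: sumr_ge0 => *.
  exact: Lp_energy_ge0.
exact: slob_energy_ge0.
Qed.

Lemma slob_energy_le nu eta (B : R) : theta != 0 -> mi_size nu = k -> energy eta <= B ->
  (powint mu2 q (pairO Omega a (mi_deriv nu eta)) <= B%:E)%E.
Proof.
move=> tn0 nuk; rewrite -lee_fin; apply: le_trans.
rewrite -[leLHS]fineK ?ge0_fin_numE ?powint_ge0 //; last exact: slob_energy_lty.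
have S : slob_energy nu eta <=
    \sum_(nu | (theta != 0) && (mi_size nu == k)) slob_energy nu eta.
  rewrite (bigD1 nu) /=; last by rewrite tn0 nuk eqxx.
  by rewrite lerDl; apply: sumr_ge0 => *; exact: slob_energy_ge0.
rewrite lee_fin; apply: (le_trans S); rewrite /energy lerDr.
by apply: sumr_ge0 => *; exact: Lp_energy_ge0.
Qed.

Lemma mi_deriv_density nu eta : Lp_density q (dist_deriv nu (reg eta)) (mi_deriv nu
  eta).
Proof.
split; last exact: dist_deriv_regular.
exact: (testfun_Lp (Testfun (testfun_pd (rev (mi_seq nu)) eta)) q0).
Qed.

Lemma mi_deriv_patch nu eta : mi_deriv nu eta \_ Omega = mi_deriv nu eta.
Proof. exact: patch_id (@testfun_eq0 _ _ _ (Testfun (testfun_pd (rev (mi_seq nu))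
  eta))). Qed.

Lemma regular_norm_le eta (c : R) : 0 <= c -> energy eta <= c `^ q ->
  (sobolev_norm_ge0 t q (reg eta) <= (c *+ mi_count n t)%:E)%E.
Proof.
move=> c0 ec; apply: sobolev_norm_ge0_le => // [nu nuk|tn0 nu nuk].
  exists (mi_deriv nu eta); first exact: mi_deriv_density.
  rewrite Lp_normE mi_deriv_patch (poweR_inv_le q0 c0 (powint_ge0 _ _ _)).
  exact: Lp_energy_le.
exists (mi_deriv nu eta); first exact: mi_deriv_density.
have [t0' _ _] := @frac_exponent R n t q t0 q1 tn0.
rewrite slobodeckijE // -powint_pairO // (poweR_inv_le q0 c0 (powint_ge0 _ _ _)).
exact: slob_energy_le.
Qed.

Lemma regular_norm_lty eta : (sobolev_norm_ge0 t q (reg eta) < +oo)%E.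
Proof.
apply: le_lt_trans (@regular_norm_le eta (energy eta `^ q^-1) (powR_ge0 _ _) _) (ltry
  _).
by rewrite -powRrM mulVf ?gt_eqF // powRr1 // energy_ge0.
Qed.

Lemma pairO_patch (f : 'rV[R]_n -> R) : pairO Omega a (f \_ Omega) = pairO Omega a f.
Proof.
apply/funext => z; rewrite /pairO indicE.
have [[z1 z2]|nz] := pselect ((Omega `*` Omega) z); last by rewrite memNset // !mul0r.
by rewrite /pairdiff !patchE !mem_set.
Qed.

(* The L^q densities of [u - reg eta], [u] and [reg eta] agree a.e., which turns
   bounds on the norms of the first two into a bound on the energy of [eta]. *)
Lemma energy_le_norm : exists2 B : R, 0 <= B & forall u eta,
  (sobolev_norm_ge0 t q u < 2%:E)%E ->
    (sobolev_norm_ge0 t q (u - reg eta)%R < 2%:E)%E ->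
  energy eta <= B.
Proof.
(* Norms below 2 give q-th powers below [P]; the inner factor [P] comes from subtracting the two
   densities, the outer one from passing to the density of [reg eta]. *)
pose P : R := 2 `^ q; pose C : R := P * (P * (P + P)).
have P0 : 0 <= P by exact: powR_ge0.
have C0 : 0 <= C by rewrite !mulr_ge0 // addr_ge0.
exists (C *+ mi_count n t); first exact: mulrn_wge0.
move=> u eta /sobolev_norm_ge0_lt[Au Bu] /sobolev_norm_ge0_lt[Av Bv].
have main d (T : measurableType d) (m : {measure set T -> \bar R}) (D F G : T -> R) :
    measurable_fun setT D -> measurable_fun setT F -> measurable_fun setT G ->
    (powint m q F <= P%:E)%E -> (powint m q G <= P%:E)%E ->
    powint m q (fun x => F x - G x - D x)%R = 0%E -> fine (powint m q D) <= C.
  move=> mD mF mG FP GP FGD.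
  have mGN : measurable_fun setT (fun x => - G x) by exact: measurable_funN.
  have mFG : measurable_fun setT (fun x => F x - G x) by exact: measurable_funB.
  have mFGD : measurable_fun setT (fun x => - (F x - G x - D x)).
    by apply: measurable_funN; exact: measurable_funB.
  have h1 := powintD m (ltW q0) mF mGN; rewrite powintN in h1.
  have h2 := powintD m (ltW q0) mFG mFGD; rewrite powintN FGD adde0 in h2.
  have E : powint m q (fun x => F x - G x + - (F x - G x - D x))%R = powint m q D.
    by apply: eq_integral => x _; congr (`|_| `^ _)%:E; ring.
  rewrite E in h2.
  have P0' : (0 <= P%:E)%E by rewrite lee_fin.
  have h3 : (powint m q D <= C%:E)%E.
    apply: (le_trans h2); rewrite EFinM; apply: lee_wpmul2l => //.
    apply: (le_trans h1); rewrite EFinM EFinD; apply: lee_wpmul2l => //.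
    exact: leeD FP GP.
  rewrite -lee_fin fineK; first exact: h3.
  by rewrite ge0_fin_numE; [exact: le_lt_trans h3 (ltry C)|exact: powint_ge0].
have dens nu f g : Lp_density q (dist_deriv nu u) f ->
    Lp_density q (dist_deriv nu (u - reg eta)) g ->
    powint mu q (fun x => (f \_ Omega) x - (g \_ Omega) x - mi_deriv nu eta x)%R = 0%E.
  move=> [Lf ef] [Lg eg]; have [Ld ed] := mi_deriv_density nu eta.
  have Lfg := LpB q0 Lf Lg.
  have := density_unique oO q1 Lfg Ld.
  rewrite (regularB (ltW q1) Lf Lg) -ef -eg -ed dist_derivB opprB addrC subrK =>
    /(_ erefl) <-.
  apply: eq_integral => x _; congr (`|_| `^ _)%:E; rewrite mi_deriv_patch;
    congr (_ - _).
  by rewrite !patchE; case: ifP => // _; rewrite subr0.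
have P2 f : Lp Omega q f -> (Lp_norm Omega q f < 2%:E)%E ->
  (powint mu q (f \_ Omega) <= P%:E)%E.
  move=> Lf; rewrite Lp_normE => /ltW.
  by rewrite (poweR_inv_le q0 (ler0n _ 2) (powint_ge0 _ _ _)).
rewrite /mi_count mulnC muln2 -addnn mulrnDr.
have S (Q : pred (multiindex n k)) (F : multiindex n k -> R) :
    (forall nu, Q nu -> F nu <= C) ->
      \sum_(nu | Q nu) F nu <= C *+ #|{: multiindex n k}|.
  move=> FP; apply: (@le_trans _ _ (\sum_(nu | Q nu) C)); first exact: ler_sum.
  by rewrite sumr_const ler_wpMn2l // max_card.
apply: lerD; apply: S => nu.
  move=> nuk; have [f df fd] := Au nu nuk; have [g dg gd] := Av nu nuk.
  have /(LpP _ _ q0)[mf _] := df.1; have /(LpP _ _ q0)[mg _] := dg.1.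
  apply: (main _ _ _ _ _ _ (measurable_mi_deriv nu eta) mf mg (P2 _ df.1 fd) (P2 _ dg.1
    gd)).
  exact: dens.
move=> /andP[tn0 /eqP nuk]; have [f df fd] := Bu tn0 nu nuk;
  have [g dg gd] := Bv tn0 nu nuk.
have [t0' _ _] := @frac_exponent R n t q t0 q1 tn0.
have /(LpP _ _ q0)[mf _] := df.1; have /(LpP _ _ q0)[mg _] := dg.1.
have md := measurable_mi_deriv nu eta.
have P3 h : (slobodeckij_seminorm Omega theta q h < 2%:E)%E ->
    (powint mu2 q (pairO Omega a (h \_ Omega)) <= P%:E)%E.
  rewrite slobodeckijE // -powint_pairO // pairO_patch => /ltW.
  by rewrite (poweR_inv_le q0 (ler0n _ 2) (powint_ge0 _ _ _)).
apply: (main _ _ _ _ _ _ (measurable_pairO oO a md) (measurable_pairO oO a mf)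
  (measurable_pairO oO a mg) (P3 _ fd) (P3 _ gd)).
have mr : measurable_fun setT (fun x =>
  (f \_ Omega) x - (g \_ Omega) x - mi_deriv nu eta x).
  by apply: measurable_funB => //; exact: measurable_funB.
rewrite -(pairO_null oO a q0 mr (dens nu f g df dg)).
apply: eq_integral => z _; congr (`|_| `^ _)%:E; rewrite /pairO /pairdiff; ring.
Qed.

End energy_norm.

(** * Approximation in the dual norm *)

Section approximation_lt0.
Context {R : realType} {n : nat} (Omega : set 'rV[R]_n).
Hypothesis oO : open Omega.
Variables (t p : R).
Hypotheses (t0 : 0 <= t) (p1 : 1 < p).
Local Notation mu := (lebesgue_rV n : {measure set 'rV[R]_n -> \bar R}).
Local Notation k := (Num.truncn t).
Local Notation theta := (t - (Num.truncn t)%:R).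
Local Notation q := (conjugate_exponent p).
Local Notation reg := (regular_distribution Omega).
Implicit Types (v eta psi phi : testfun Omega) (nu : multiindex n k) (u : testfun Omega
  -> R).

Let p0 : 0 < p := lt_trans ltr01 p1.
Let q1 : 1 < q := conjugate_gt1 p1.
Let q0 : 0 < q := lt_trans ltr01 q1.

Let qp : q^-1 + p^-1 = 1.
Proof. by rewrite addrC conjugate_eq1. Qed.

(** One [psi] has to serve all [eta] of energy at most [B]: this uniformity becomes smallness in the
    dual norm. *)
Definition approximable (A : testfun Omega -> R) := forall B e : R, 0 <= B -> 0 < e ->
  exists psi, forall eta, energy t q eta <= B ->
    `|A eta - \int[mu]_x (psi x * eta x)| <= e.

Lemma testfun_mul_integrable psi eta : mu.-integrable setT (EFin \o (fun x =>
  psi x * eta x)).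
Proof. exact: Ccinf_integrable (CcinfM (testfun_Ccinf psi) (testfun_Ccinf eta).1). Qed.

Lemma approximableD A1 A2 : approximable A1 -> approximable A2 ->
  approximable (fun eta => A1 eta + A2 eta).
Proof.
move=> h1 h2 B e B0 e0; have e20 : 0 < e / 2 by rewrite divr_gt0.
have [psi1 P1] := h1 B _ B0 e20; have [psi2 P2] := h2 B _ B0 e20.
exists (psi1 + psi2) => eta etaB.
have -> : \int[mu]_x ((psi1 + psi2) x * eta x) =
    \int[mu]_x (psi1 x * eta x) + \int[mu]_x (psi2 x * eta x).
  rewrite -RintegralD //;
    [|exact: testfun_mul_integrable|exact: testfun_mul_integrable].
  by apply: eq_Rintegral => x _; rewrite -mulrDl.
rewrite opprD addrACA (splitr e) (le_trans (ler_normD _ _)) // lerD //;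
  [exact: P1|exact: P2].
Qed.

Lemma approximable_sum (I : Type) (r : seq I) (P : pred I) (A : I -> testfun Omega ->
  R) :
  (forall i, P i -> approximable (A i)) ->
  approximable (fun eta => \sum_(i <- r | P i) A i eta).
Proof.
move=> h; elim: r => [|i r IH].
  move=> B e B0 e0; exists 0 => eta _; rewrite big_nil sub0r normrN.
  rewrite (_ : \int[mu]_x _ = 0) ?normr0 ?ltW //.
  rewrite (_ : (fun x => _) = cst 0) ?Rintegral_cst ?mul0r //.
  by apply/funext => x; exact: mul0r.
have [Pi|nPi] := boolP (P i).
  rewrite (_ : (fun eta => _) = fun eta => A i eta + \sum_(j <- r | P j) A j eta).
    exact: approximableD (h i Pi) IH.
  by apply/funext => eta; rewrite big_cons Pi.
rewrite (_ : (fun eta => _) = fun eta => \sum_(j <- r | P j) A j eta) //.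
by apply/funext => eta; rewrite big_cons (negbTE nPi).
Qed.

Lemma pairing_approximable v : approximable (pairing t q v).
Proof.
have Bq (B : R) : 0 <= B -> B = (B `^ q^-1) `^ q.
  by move=> B0; rewrite -powRrM mulVf ?powRr1 // gt_eqF.
apply: approximableD; apply: approximable_sum => nu Pnu B e B0 e0.
- have mv := measurable_mi_deriv nu v.
  have mg := measurable_spow (q - 1) mv.
  have r0 : 0 < q - 1 by rewrite subr_gt0.
  have goo : (powint mu p (fun x => spow (q - 1) (mi_deriv nu v x)) < +oo)%E.
    apply: le_lt_trans (Lp_energy_lty q1 nu v); apply: eq_lew.
    by apply: eq_integral => x _; rewrite spow_abs // -powRrM conjugate_mul.
  have g0 x : ~ Omega x -> spow (q - 1) (mi_deriv nu v x) = 0.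
    move=> Ox; rewrite -mi_deriv_patch patchE memNset // spow_ge0 // powR0 // gt_eqF //.
  have [psi psiP] := Lp_pd_approx oO (rev (mi_seq nu)) p1 mg goo g0 (powR_ge0 B q^-1)
    e0.
  exists psi => eta etaB; apply: psiP; rewrite -Bq //.
  exact: (Lp_energy_le q1 Pnu etaB).
- have /andP[tn0 /eqP nuk] := Pnu.
  have [_ na anq] := @frac_exponent R n t q t0 q1 tn0.
  have [psi psiP] := pairO_approx oO v (rev (mi_seq nu)) p1 na anq (powR_ge0 B q^-1) e0.
  have nuk' : (mi_size nu <= k)%N by rewrite nuk.
  exists psi => eta etaB; apply: psiP; rewrite -Bq //.
    exact: (Lp_energy_le q1 nuk' etaB).
  exact: (slob_energy_le oO t0 q1 tn0 nuk etaB).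
Qed.

Lemma sobolev_norm_zero : (sobolev_norm_ge0 t q (0%R : testfun Omega -> R) <= 0)%E.
Proof.
have L0 : Lp Omega q (fun=> 0).
  exact: (testfun_Lp (0 : testfun Omega) q0).
have d0 nu : Lp_density q (dist_deriv nu (0 : testfun Omega -> R)) (fun=> 0).
  split => //; apply/funext => psi; rewrite /dist_deriv /= mulr0 regularE.
  rewrite (_ : (fun x => _) = cst 0) ?Rintegral_cst ?mul0r //.
  by apply/funext => x; rewrite patchE; case: ifP => _; rewrite mul0r.
have := @sobolev_norm_ge0_le R n Omega t q (0 : testfun Omega -> R) 0 (lexx 0).
rewrite mul0rn; apply.
  move=> nu _; exists (fun=> 0) => //.
  rewrite Lp_normE (poweR_inv_le q0 (lexx 0) (powint_ge0 _ _ _)) powR0 ?gt_eqF //.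
  rewrite (_ : powint _ _ _ = 0%E) //.
  rewrite /powint (eq_integral (cst 0%E)) ?integral0 // => x _.
  by rewrite patchE /=; case: ifP => _; rewrite normr0 powR0 // gt_eqF.
move=> tn0 nu _; exists (fun=> 0) => //.
have [t0' _ _] := @frac_exponent R n t q t0 q1 tn0.
rewrite (slobodeckijE Omega _ q0 t0') -powint_pairO // (poweR_inv_le q0 (lexx 0)
  (powint_ge0 _ _ _)) powR0 ?gt_eqF //.
rewrite (_ : powint _ _ _ = 0%E) //.
rewrite /powint (eq_integral (cst 0%E)) ?integral0 // => x _.
by rewrite /pairO /pairdiff subrr mul0r mulr0 normr0 powR0 // gt_eqF.
Qed.

Lemma sobolev0_zero : sobolev0 t q (0 : testfun Omega -> R).
Proof.
split; first exact: le_lt_trans sobolev_norm_zero (ltry 0).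
move=> e e0; exists 0; rewrite (_ : _ - _ = 0);
  first exact: le_lt_trans sobolev_norm_zero _.
rewrite sub0r; apply/funext => psi; rewrite /= -[LHS]/(- reg (0 : testfun Omega) psi).
rewrite -[0 : testfun Omega](scale0r (0 : testfun Omega)) regular_testfunZ.
by rewrite scale0r oppr0.
Qed.

Lemma sobolev0_regular eta : sobolev0 t q (reg eta).
Proof.
split; first exact (regular_norm_lty oO t0 q1 eta).
move=> e e0; exists eta; rewrite subrr.
exact: le_lt_trans sobolev_norm_zero _.
Qed.

Lemma sobolev0_subr u eta : sobolev0 t q u ->
  (sobolev_norm_ge0 t q (u - reg eta)%R < +oo)%E ->
  sobolev0 t q (u - reg eta).
Proof.
move=> [_ h] uoo; split => // e /h[psi psiP]; exists (psi - eta).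
by rewrite regular_testfunB opprB addrA subrK.
Qed.

Lemma sobolev0Z (c : R) u : 0 < c -> sobolev0 t q u -> sobolev0 t q (c *: u).
Proof.
move=> c0 [uoo h]; split.
  have uE : (sobolev_norm_ge0 t q u < (fine (sobolev_norm_ge0 t q u) + 1)%:E)%E.
    rewrite EFinD fineK ?ge0_fin_numE ?sobolev_norm_ge0_ge0 //.
    by rewrite lteDl ?lte01 // ge0_fin_numE ?sobolev_norm_ge0_ge0.
  have d0 : 0 <= fine (sobolev_norm_ge0 t q u) +
    1 by rewrite addr_ge0 // fine_ge0 ?sobolev_norm_ge0_ge0.
  exact (le_lt_trans (sobolev_norm_ge0_scale oO t0 q1 (ltW c0) d0 uE) (ltry _)).
move=> e e0; pose N : R := c * (mi_count n t)%:R + 1.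
have N0 : 0 < N by rewrite ltr_wpDl // mulr_ge0 // ltW.
have eN : 0 < e / N by rewrite divr_gt0.
have [psi psiP] := h _ eN; exists (c *: psi).
rewrite regular_testfunZ -scalerBr.
apply: le_lt_trans (sobolev_norm_ge0_scale oO t0 q1 (ltW c0) (ltW eN) psiP) _.
rewrite lte_fin -mulr_natr (_ : _ * _ = e * (c * (mi_count n t)%:R) / N); last by ring.
by rewrite ltr_pdivrMr // ltr_pM2l // ltrDl.
Qed.

(** The dual norm only speaks of the unit ball. Scaling [u] into it has to absorb the factor
    [mi_count] from [sobolev_norm_ge0_scale], hence [N]. *)
Lemma sobolev0_dual_bound F : sobolev0_dual t q F -> exists2 C : R, 0 <= C &
  forall u (d : R), 0 < d -> sobolev0 t q u -> (sobolev_norm_ge0 t q u < d%:E)%E ->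
    `|F u| <= C * d.
Proof.
move=> [Flin Foo]; set X := sobolev0_dual_norm t q F in Foo.
have F0 : F 0 = 0.
  have := Flin 1 0 0 sobolev0_zero sobolev0_zero; rewrite scaler0 addr0 mul1r => /eqP.
  by rewrite -subr_eq0 opprD addrA subrr sub0r oppr_eq0 => /eqP.
have X0 : (0 <= X)%E.
  apply: (@le_trans _ _ `|F 0|%:E); first by rewrite lee_fin.
  apply: ereal_sup_ubound; exists 0 => //; split; first exact: sobolev0_zero.
  by apply: le_trans sobolev_norm_zero _; rewrite lee01.
have Xfin : X \is a fin_num by rewrite ge0_fin_numE.
pose N : R := (mi_count n t)%:R + 1.
have N0 : 0 < N by rewrite ltr_wpDl.
exists (fine X * N); first by rewrite mulr_ge0 ?fine_ge0 // ltW.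
move=> u d d0 su ud; have dN : 0 < d * N by rewrite mulr_gt0.
have c0 : 0 < (d * N)^-1 by rewrite invr_gt0.
have : (`|F ((d * N)^-1 *: u)|%:E <= X)%E.
  apply: ereal_sup_ubound; exists ((d * N)^-1 *: u) => //; split;
    first exact: sobolev0Z.
  apply: le_trans (sobolev_norm_ge0_scale oO t0 q1 (ltW c0) (ltW d0) ud) _.
  rewrite lee_fin -mulr_natr (_ : _ * _ = (mi_count n t)%:R / N).
    by rewrite ler_pdivrMr // mul1r lerDl.
  by field; rewrite !gt_eqF.
rewrite -(fineK Xfin) lee_fin -[_ *: u]addr0 Flin //; last exact: sobolev0_zero.
rewrite F0 addr0 normrM gtr0_norm // mulrC ler_pdivrMr // => h.
by rewrite -mulrA (mulrC N).
Qed.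

Lemma dist_norm_lt (w : testfun Omega -> R) (F : (testfun Omega -> R) -> R) (c : R) :
  sobolev0_linear t q F ->
  (forall psi, F (reg psi) = w psi) -> 0 <= c ->
  (forall u, sobolev0 t q u -> (sobolev_norm_ge0 t q u <= 1)%E -> `|F u| <= c) ->
  (ereal_inf [set sobolev0_dual_norm t q F | F in [set F |
    sobolev0_dual t q F /\ forall psi, F (reg psi) = w psi]] <= c%:E)%E.
Proof.
move=> Flin Fw c0 Fc.
have Fle : (sobolev0_dual_norm t q F <= c%:E)%E.
  by apply: ge_ereal_sup => _ [u [su u1] <-]; rewrite lee_fin; exact: Fc.
have dF : sobolev0_dual t q F by split => //; exact (le_lt_trans Fle (ltry c)).
by apply: le_trans Fle; apply: ereal_inf_lbound; exists F.
Qed.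

Lemma dual_approx (w : testfun Omega -> R) (e : R) : scalar w ->
  (ereal_inf [set sobolev0_dual_norm t q F | F in [set F |
    sobolev0_dual t q F /\ forall psi, F (reg psi) = w psi]] < +oo)%E -> 0 < e ->
  exists psi, (ereal_inf [set sobolev0_dual_norm t q F | F in [set F |
    sobolev0_dual t q F /\ forall phi, F (reg phi) = (reg psi - w)%R phi]] < e%:E)%E.
Proof.
move=> lw /ereal_inf_lt[_ [F [dF Fw] _] _] e0.
have [C C0 FC] := sobolev0_dual_bound dF.
have wC eta : energy t q eta <= 1 -> `|w eta| <= C * (1 *+ mi_count n t + 1).
  move=> e1; rewrite -Fw; apply: FC; first by rewrite ltr_wpDl // mulrn_wge0.
    exact: sobolev0_regular.
  have E1 : energy t q eta <= 1 `^ q by rewrite powR1.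
  apply: le_lt_trans (regular_norm_le oO t0 q1 ler01 E1) _.
  by rewrite lte_fin ltrDl.
(* This bound concerns all test functions that will approximate elements of the unit ball, so it
   precedes the choice of [v] and [psi]. *)
have [B B0 BP] := energy_le_norm oO t0 q1.
have C1 : 0 <= C * (1 *+ mi_count n t + 1).
  by rewrite mulr_ge0 // addr_ge0 // mulrn_wge0.
have e40 : 0 < e / 4 by rewrite divr_gt0.
have [v vP] := near_minimizer q1 (energy_variational oO t0 q1) lw C1 wC B0 e40.
have [psi psiP] := pairing_approximable v B0 e40.
have [D D0 psiD] := sobolev_ge0_pairing_le psi t0 q0 p0 qp.
(* The distance from [u] to a test function may depend on [psi] through [D], since that test
   function is chosen last; [d <= 1] keeps the difference within the scope of [energy_le_norm]. *)
pose d := Num.min 1 (e / 4 / (C + D + 1)).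
have CD0 : 0 < C + D + 1 by rewrite ltr_wpDl // addr_ge0.
have d0 : 0 < d by rewrite lt_min ltr01 divr_gt0.
have d1 : d <= 1 by rewrite ge_min lexx.
have dCD : (C + D) * d <= e / 4.
  apply: (@le_trans _ _ ((C + D + 1) * d));
    first by rewrite ler_wpM2r ?(ltW d0) // lerDl.
  by rewrite mulrC -ler_pdivlMr // ge_min lexx orbT.
exists psi.
apply: (@le_lt_trans _ _ (3 * (e / 4))%:E); last by rewrite lte_fin; lra.
(* Evaluation at [psi] minus [F] extends [reg psi - w] to W^{t,q}_0. Its value at [u] splits into an
   error at [u - reg eta], the approximation of the pairing by [psi], and the Euler-Lagrange error
   at [eta], each at most [e / 4]. *)
apply: (@dist_norm_lt _ (fun u => u psi - F u)).
- move=> c u1 u2 s1 s2; rewrite (dF.1 _ _ _ s1 s2).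
  by rewrite -[(c *: u1 + u2) psi]/(c * u1 psi + u2 psi); ring.
- move=> phi; rewrite Fw -[RHS]/(reg psi phi - w phi); congr (_ - _).
  rewrite !regularE; apply: eq_Rintegral => x _; rewrite !patchE.
  by case: ifPn => _; rewrite ?mul0r // mulrC.
- by rewrite mulr_ge0 // ltW.
move=> u su u1; have [eta etaP] := su.2 _ d0.
have u2 : (sobolev_norm_ge0 t q u < 2%:E)%E by apply: le_lt_trans u1 _;
  rewrite lte_fin ltr1n.
have ue2 : (sobolev_norm_ge0 t q (u - reg eta)%R < 2%:E)%E.
  by apply: lt_le_trans etaP _; rewrite lee_fin (le_trans d1) // ler1n.
have etaB := BP _ _ u2 ue2.
have sue : sobolev0 t q (u - reg eta).
  by apply: sobolev0_subr => //; apply: lt_trans ue2 (ltry _).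
have h1 := psiD _ _ (ltW d0) etaP; have h2 := FC _ _ d0 sue etaP.
have h3 := vP _ etaB; have h4 := psiP _ etaB.
have Fu : F u = F (u - reg eta) + F (reg eta).
  have := dF.1 1 _ _ sue (sobolev0_regular eta); rewrite scale1r subrK mul1r.
  by [].
have uE : u psi = (u - reg eta) psi + reg eta psi.
  by rewrite -[(u - reg eta) psi]/(u psi - reg eta psi) subrK.
have rE : reg eta psi = \int[mu]_x (psi x * eta x).
  rewrite regularE; apply: eq_Rintegral => x _; rewrite mulrC patchE.
  by case: ifPn => // /negP xO; rewrite testfun_eq0 ?mulr0 ?mul0r // => Ox;
    apply/xO/mem_set.
rewrite uE Fu Fw rE.
set X := (u - reg eta) psi in h1 *; set Y := F _ in h2 *.
set I1 := \int[mu]_x _ in h4 *; set W := w eta in h3 *;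
  set Z := pairing _ _ _ _ in h3 h4.
have -> : X + I1 - (Y + W) = (X - Y) + ((I1 - Z) + (Z - W)) by ring.
apply: (le_trans (ler_normD _ _)).
have hXY : `|X - Y| <= (C + D) * d.
  by apply: (le_trans (ler_normB _ _)); rewrite mulrDl addrC lerD.
have h5 : `|(I1 - Z) + (Z - W)| <= e / 4 + e / 4.
  by apply: (le_trans (ler_normD _ _)); rewrite (distrC I1) (distrC Z W) lerD.
have := lerD (le_trans hXY dCD) h5; move=> /le_trans; apply; lra.
Qed.

Lemma regular_dual_lty psi :
  (ereal_inf [set sobolev0_dual_norm t q F | F in [set F |
    sobolev0_dual t q F /\ forall phi, F (reg phi) = reg psi phi]] < +oo)%E.
Proof.
have [D D0 psiD] := sobolev_ge0_pairing_le psi t0 q0 p0 qp.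
apply: (@le_lt_trans _ _ (D * 2)%:E); last exact: ltry.
apply: (@dist_norm_lt _ (fun u => u psi)) => //.
- move=> phi; rewrite !regularE; apply: eq_Rintegral => x _; rewrite !patchE.
  by case: ifPn => _; rewrite ?mul0r // mulrC.
- by rewrite mulr_ge0.
move=> u su u1; apply: psiD => //; apply: le_lt_trans u1 _.
by rewrite lte_fin ltr1n.
Qed.

End approximation_lt0.

(** * Density *)

Section sobolev_loc_density.
Context {R : realType} {n : nat} (Omega : set 'rV[R]_n).
Hypothesis oO : open Omega.
Local Notation mu := (lebesgue_rV n : {measure set 'rV[R]_n -> \bar R}).
Local Notation reg := (regular_distribution Omega).
Implicit Types (s p e : R) (phi psi chi eta : testfun Omega) (u v : testfun Omega -> R).

Lemma regular_is_distribution psi : is_distribution (reg psi).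
Proof.
split.
  move=> c phi eta; rewrite !regularE (patch_id (@testfun_eq0 _ _ _ psi)).
  rewrite -RintegralZl //; last exact: testfun_mul_integrable.
  rewrite -RintegralD //.
  - apply: eq_Rintegral => x _.
    by rewrite -[(c *: phi + eta) x]/(c * phi x + eta x); ring.
  - by apply: integrable_scaler => //; exact: testfun_mul_integrable.
  - exact: testfun_mul_integrable.
(* A distribution of order 0: the supremum of [|phi|] alone bounds the pairing. *)
move=> K cK KO; exists (\int[mu]_x `|psi x|), 0%N => phi _.
have [M M0 phiM] := Ccinf_bounded (testfun_Ccinf phi).
pose S := sup [set `|testfun_deriv (@mi0 n 0) phi x| | x in setT].
have phiS x : `|phi x| <= S.
  apply: ub_le_sup; last by exists x => //; rewrite testfun_deriv0.
  by exists M => _ [y _ <-]; rewrite testfun_deriv0.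
have S0 : 0 <= S by exact: le_trans (phiS 0).
have supge0 (nu : multiindex n 0) : 0 <= sup [set `|testfun_deriv nu phi x| | x in
  setT].
  have [M' _ M'P] := Ccinf_bounded (testfun_Ccinf (testfun_deriv nu phi)).
  apply: (@le_trans _ _ `|testfun_deriv nu phi 0|) => //.
  by apply: ub_le_sup; [exists M' => _ [y _ <-]|exists 0].
have ipsi := Ccinf_integrable (testfun_Ccinf psi).
have iabs : mu.-integrable setT (EFin \o (fun x => `|psi x|)).
  exact: (integrable_norm ipsi).
apply: (@le_trans _ _ ((\int[mu]_x `|psi x|) * S)).
  rewrite regularE (patch_id (@testfun_eq0 _ _ _ psi)).
  apply: (le_trans (le_normr_Rintegral measurableT (testfun_mul_integrable psi phi))).
  rewrite -RintegralZr //; apply: le_Rintegral => //.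
  - exact: (integrable_norm (testfun_mul_integrable psi phi)).
  - have := integrable_scaler measurableT S iabs.
    by apply: eq_integrable => // x _ /=; rewrite mulrC.
  - by move=> x _; rewrite normrM ler_wpM2l.
rewrite ler_wpM2l //; first by apply: Rintegral_ge0 => *.
rewrite (bigD1 (@mi0 n 0)) /=; last by rewrite mi_size0.
by rewrite lerDl; apply: sumr_ge0.
Qed.

Lemma sobolev_regular s p psi : 1 < p -> sobolev s p (reg psi).
Proof.
move=> p1; rewrite /sobolev /sobolev_norm /=; case: ifPn => [s0|].
  exact: regular_norm_lty.
rewrite -ltNge => s0; have s0' : 0 <= - s by rewrite oppr_ge0 ltW.
exact: regular_dual_lty.
Qed.

Lemma sobolev_loc_regular s p psi : 1 < p -> sobolev_loc Omega s p (reg psi).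
Proof.
move=> p1; split; first exact: regular_is_distribution.
by move=> phi; rewrite dist_mul_regular; exact: sobolev_regular.
Qed.

Lemma regular_approx s p u chi e : 1 < p -> scalar u -> sobolev s p (dist_mul chi u) ->
  0 < e -> exists psi, (sobolev_norm s p (reg psi - dist_mul chi u)%R < e%:E)%E.
Proof.
move=> p1 lu; rewrite /sobolev /sobolev_norm /=; case: ifPn => [s0|].
  exact: regular_approx_ge0.
rewrite -ltNge => s0; have s0' : 0 <= - s by rewrite oppr_ge0 ltW.
apply: dual_approx => // c phi eta; rewrite /dist_mul.
rewrite -lu; congr u; apply: testfun_eq => x.
rewrite -[LHS]/(chi x * (c * phi x + eta x)) -[RHS]/(c * (chi x * phi x) +
  chi x * eta x).
by ring.
Qed.

Lemma sobolev_norm_nonneg s p u : 1 < p -> (0 <= sobolev_norm s p u)%E.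
Proof.
move=> p1; rewrite /sobolev_norm; case: ifPn => [_|]; first exact: sobolev_norm_ge0_ge0.
rewrite -ltNge => s0; have s0' : 0 <= - s by rewrite oppr_ge0 ltW.
apply: le_ereal_inf_tmp => _ [F _ <-].
apply: (@le_trans _ _ `|F 0|%:E); first by rewrite lee_fin.
apply: ereal_sup_ubound; exists 0 => //; split; first exact: sobolev0_zero.
by apply: le_trans (sobolev_norm_zero _ s0' p1) _; rewrite lee01.
Qed.

Lemma multiplication_uniform s p (L : seq (testfun Omega)) e : 1 < p ->
  smooth_multiplication_triple Omega s p -> 0 < e ->
  exists2 d : R, 0 < d & forall phi, phi \in L -> forall u,
    (sobolev_norm s p u < d%:E)%E -> (sobolev_norm s p (dist_mul phi u) < e%:E)%E.
Proof.
move=> p1 smt e0; elim: L => [|phi L [d d0 dP]]; first by exists 1.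
have [C CP] := smt phi.
(* The constant of the multiplication bound may be 0 or negative; a positive one is needed to divide
   by. *)
pose C' : R := Num.max C 0 + 1.
have C'0 : 0 < C' by rewrite ltr_wpDl // le_max lexx orbT.
exists (Num.min d (e / C')); first by rewrite lt_min d0 divr_gt0.
move=> psi; rewrite inE => /orP[/eqP ->|psiL] u ud; last first.
  by apply: (dP _ psiL); apply: lt_le_trans ud _; rewrite lee_fin ge_min lexx.
have su : sobolev s p u by exact (lt_trans ud (ltry _)).
apply: le_lt_trans (CP u su).2 _.
apply: (@le_lt_trans _ _ (C'%:E * sobolev_norm s p u)%E).
  apply: lee_wpmul2r; first exact: sobolev_norm_nonneg.
  by rewrite lee_fin (@le_trans _ _ (Num.max C 0)) ?le_max ?lexx // lerDl.
have ufin : sobolev_norm s p u \is a fin_num.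
  by rewrite ge0_fin_numE ?sobolev_norm_nonneg.
move: ud; rewrite -(fineK ufin) -EFinM !lte_fin lt_min => /andP[_].
by rewrite ltr_pdivlMr // mulrC.
Qed.

Lemma supports_compact (L : seq (testfun Omega)) : exists K : set 'rV[R]_n,
  [/\ compact K, K `<=` Omega & forall phi, phi \in L -> fsupport phi `<=` K].
Proof.
elim: L => [|phi L [K [cK KO KP]]].
  by exists set0; split => //; exact: compact0.
have [_ cphi phiO] := set_mem (testfunP phi).
exists (fsupport phi `|` K); split; first exact: compactU.
  by move=> x [/phiO|/KO].
move=> psi; rewrite inE => /orP[/eqP ->|/KP KL] x xs; first by left.
by right; exact: KL.
Qed.

Lemma dense_testfun s p : 1 < p -> smooth_multiplication_triple Omega s p ->
  dense [set u : sobolev_loc_space Omega s p | exists psi, sval u = reg psi].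
Proof.
move=> p1 smt O [u0 Ou0] oO'.
have [L [e [e0 eP]]] : exists (L : seq (testfun Omega)) (e : R), 0 < e /\
    forall v : sobolev_loc_space Omega s p,
      sobolev_loc_ball s p L e (sval u0) (sval v) -> O v by exact: oO'.
have [[lu _] uloc] := svalP u0; set u := sval u0 in eP lu uloc.
have [K [cK KO KP]] := supports_compact L.
have [chi [_ [U [oU KU U1]]]] := cutoff_exists cK oO KO.
have [d d0 dP] := multiplication_uniform L p1 smt e0.
have [psi psiP] := regular_approx p1 lu (uloc chi) d0.
pose v : sobolev_loc_space Omega s p := exist _ _ (sobolev_loc_regular s psi p1).
exists v; split; last by exists psi.
apply: eP => phi phiL.
(* As [chi] is 1 on the support of [phi], multiplication by [phi] does not distinguish [u] from
   [chi u]. *)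
rewrite (_ : dist_mul phi _ = dist_mul phi (reg psi - dist_mul chi u)); first exact: dP.
apply/funext => eta; rewrite /dist_mul.
transitivity (reg psi (testfun_mul phi eta) - u (testfun_mul phi eta)) => //.
transitivity (reg psi (testfun_mul phi eta) -
  u (testfun_mul chi (testfun_mul phi eta))) => //; congr (_ - u _).
apply: testfun_eq => x /=; rewrite mulrA; congr (_ * _).
have [Ux|nUx] := pselect (U x); first by rewrite U1 // mul1r.
suff -> : phi x = 0 by rewrite mulr0.
by apply/eqP/negPn/negP => px; apply/nUx/KU/(KP _ phiL); exact: subset_closure.
Qed.

End sobolev_loc_density.

Theorem theorem5p10 (R : realType) (n : nat) (Omega : set 'rV[R]_n) (s p : R)
    (oOmega : open Omega) (Omega0 : Omega !=set0) (p1 : 1 < p)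
    (smt : smooth_multiplication_triple Omega s p) :
  (forall psi : testfun Omega, sobolev_loc Omega s p (regular_distribution Omega psi)) /\
  dense [set u : sobolev_loc_space Omega s p |
           exists psi : testfun Omega, sval u = regular_distribution Omega psi].
Proof.
split; first by move=> psi; exact: sobolev_loc_regular.
exact: dense_testfun.
Qed.
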